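(* Let $\Omega\subset\mathbb{P}(\mathbb{R}^d)$ be a properly convex domain, $x_0\in\Omega$, $R>0$, and let $M$ be a Morse gauge. There exists $\xi=\xi(M,R,x_0)>1$ such that for every projective geodesic ray $c:[0,\infty)\to\Omega$ which is $M$-Morse and every sequence $\{\gamma_n\}$ in $\mathrm{Aut}(\Omega)$ that $R$-tracks $c$ with respect to $x_0$, $$\liminf_{n\to\infty}\frac{\mu_{1,d}(\gamma_n)}{\mu_{1,d-1}(\gamma_n)}>1+\frac{1}{\xi-1}\quad\text{and}\quad\limsup_{n\to\infty}\frac{\mu_{1,d}(\gamma_n)}{\mu_{1,2}(\gamma_n)}<\xi.$$
   Context: A properly convex domain $\Omega\subset\mathbb{P}(\mathbb{R}^d)$ is a nonempty open convex set whose closure is a bounded convex subset of some affine chart. $\mathrm{Aut}(\Omega)\subset\mathrm{PGL}(d,\mathbb{R})$ is the group of projective transformations preserving $\Omega$. The Hilbert metric is $d_\Omega(x,y)=\frac12\log\frac{|a-y||b-x|}{|a-x||b-y|}$, where $a,b\in\partial\Omega$ are the points where the projective line through $x,y$ meets $\partial\Omega$, ordered $a,x,y,b$ along the line. A projective geodesic ray is a unit-speed (for $d_\Omega$) geodesic ray $c:[0,\infty)\to\Omega$ whose image is a projective line segment $[x,y)$ with $x\in\Omega$, $y\in\partial\Omega$. Morse: a Morse gauge is any function $M:\mathbb{R}_{\ge0}\times\mathbb{R}_{\ge0}\to\mathbb{R}_{\ge0}$. A geodesic $\ell$ is $M$-Morse if every $(\lambda,a)$-quasi-geodesic with endpoints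 on $\ell$ lies in the $M(\lambda,a)$-neighborhood of $\ell$. Tracking: $\{\gamma_n\}$ $R$-tracks $c$ with respect to $x_0$ if $d_\Omega(x_0,\gamma_n^{-1}c(n))<R$ for all $n\in\mathbb{N}$. For $g\in\mathrm{GL}(d,\mathbb{R})$ with singular values $\sigma_1(g)\ge\dots\ge\sigma_d(g)$, $\mu_{i,j}(g)=\log\frac{\sigma_i(g)}{\sigma_j(g)}$; this is well defined on $\mathrm{PGL}(d,\mathbb{R})$. A quotient with positive numerator and zero denominator is read as $+\infty$. *)

(* Defs.v *)
From HB Require Import structures.
From mathcomp Require Import all_boot all_order all_algebra.
From mathcomp Require Import all_classical all_reals all_analysis.
Import Order.TTheory GRing.Theory Num.Theory.
Import numFieldNormedType.Exports.

Set Implicit Arguments.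
Unset Strict Implicit.
Unset Printing Implicit Defensive.

Local Open Scope classical_set_scope.
Local Open Scope quotient_scope.
Local Open Scope ring_scope.

Section ProjectiveSpace.
Variables (R : realType) (d : nat).

Definition nzvec : Type := set_type [set v : 'cV[R]_d | v != 0].
HB.instance Definition _ := Topological.on nzvec.

Definition nzvec_of (v : 'cV[R]_d) (hv : v != 0) : nzvec :=
  exist _ v (mem_set hv).

Lemma nzvec_neq0 (v : nzvec) : val v != 0.
Proof. exact: set_mem (valP v). Qed.

Definition vec_prop (v w : nzvec) : bool :=
  `[< exists2 k : R, k != 0 & val w = k *: val v >].

Fact vec_prop_equiv : equiv_class_of vec_prop.
Proof.
split=> [v|v w|v u w].
- by apply/asboolP; exists 1; rewrite ?oner_neq0// scale1r.
- apply/asboolP/asboolP => -[k k0 e]; exists k^-1; rewrite ?invr_eq0//.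
    by rewrite e scalerA mulVf// scale1r.
  by rewrite e scalerA mulVf// scale1r.
- move=> /asboolP[k k0 e] /asboolP[l l0 e']; apply/asboolP.
  by exists (l * k); rewrite ?mulf_neq0// e' e scalerA.
Qed.

Canonical vec_prop_equivRel := EquivRelPack vec_prop_equiv.

(* P(R^d): nonzero vectors modulo scaling, with the quotient topology. *)
Definition projspace : Type := quotient_topology {eq_quot vec_prop}.
HB.instance Definition _ := Topological.on projspace.
HB.instance Definition _ := Quotient.on projspace.

Definition proj_class (v : nzvec) : projspace := \pi_projspace v.
Definition lift_vec (p : projspace) : 'cV[R]_d := val (repr p).

Definition glmx : Type := {A : 'M[R]_d | A \in unitmx}.
HB.instance Definition _ := Choice.on glmx.

Definition mx_prop (A B : glmx) : bool :=
  `[< exists2 k : R, k != 0 & val B = k *: val A >].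

Fact mx_prop_equiv : equiv_class_of mx_prop.
Proof.
split=> [v|v w|v u w].
- by apply/asboolP; exists 1; rewrite ?oner_neq0// scale1r.
- apply/asboolP/asboolP => -[k k0 e]; exists k^-1; rewrite ?invr_eq0//.
    by rewrite e scalerA mulVf// scale1r.
  by rewrite e scalerA mulVf// scale1r.
- move=> /asboolP[k k0 e] /asboolP[l l0 e']; apply/asboolP.
  by exists (l * k); rewrite ?mulf_neq0// e' e scalerA.
Qed.

Canonical mx_prop_equivRel := EquivRelPack mx_prop_equiv.

Definition PGL : Type := {eq_quot mx_prop}.
HB.instance Definition _ := Choice.on PGL.
HB.instance Definition _ := Quotient.on PGL.

Definition lift_mx (g : PGL) : 'M[R]_d := val (repr g).

Lemma lift_mx_unit (g : PGL) : lift_mx g \in unitmx.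
Proof. exact: valP. Qed.

Lemma pgl_act_subproof (g : PGL) (p : projspace) : lift_mx g *m lift_vec p != 0.
Proof.
apply: contra (nzvec_neq0 (repr p)) => /eqP e; apply/eqP.
by rewrite -(mulKmx (lift_mx_unit g) (val (repr p))) e mulmx0.
Qed.

Definition pgl_act (g : PGL) (p : projspace) : projspace :=
  proj_class (nzvec_of (pgl_act_subproof g p)).

Lemma pgl_inv_subproof (g : PGL) : invmx (lift_mx g) \in unitmx.
Proof. by rewrite unitmx_inv lift_mx_unit. Qed.

Definition pgl_inv (g : PGL) : PGL :=
  \pi_PGL (Sub (invmx (lift_mx g)) (pgl_inv_subproof g) : glmx).

(* Row vectors are linear functionals. *)
Definition pairing (f : 'rV[R]_d) (v : 'cV[R]_d) : R := (f *m v) 0 0.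

Definition affine_chart (f : 'rV[R]_d) : set projspace :=
  [set p | pairing f (lift_vec p) != 0].

(* The chart is identified with the affine hyperplane [pairing f v = 1]. *)
Definition chart_coord (f : 'rV[R]_d) (p : projspace) : 'cV[R]_d :=
  (pairing f (lift_vec p))^-1 *: lift_vec p.

Definition proper_chart (Omega : set projspace) (f : 'rV[R]_d) : Prop :=
  [/\ f != 0, closure Omega `<=` affine_chart f,
      bounded_set (chart_coord f @` closure Omega) &
      convex_set (chart_coord f @` closure Omega)].

Definition properly_convex (Omega : set projspace) : Prop :=
  [/\ Omega !=set0, open Omega &
      exists2 f, proper_chart Omega f & convex_set (chart_coord f @` Omega)].

Definition Aut (Omega : set projspace) : set PGL :=
  [set g | pgl_act g @` Omega = Omega].

Definition boundary (Omega : set projspace) : set projspace :=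
  closure Omega `\` interior Omega.

(* [r] is the Hilbert distance of the distinct points [x], [y]. Along a line the
   cross-ratio depends neither on the norm nor on the chart. *)
Definition is_hilbert_dist (Omega : set projspace) (x y : projspace) (r : R) :=
  exists (f : 'rV[R]_d) (a b : projspace) (s t : R),
    let X := chart_coord f x in let Y := chart_coord f y in
    let A := chart_coord f a in let B := chart_coord f b in
    [/\ proper_chart Omega f, boundary Omega a /\ boundary Omega b,
        0 < s /\ s < t < 1,
        X = (1 - s) *: A + s *: B /\ Y = (1 - t) *: A + t *: B &
        r = 2^-1 * ln ((`|A - Y| * `|B - X|) / (`|A - X| * `|B - Y|))].

Definition hilbert_dist (Omega : set projspace) (x y : projspace) : R :=
  if x == y then 0 else xget 0 (is_hilbert_dist Omega x y).

(* Two points of P(R^d) bound two projective segments; this is the one inside the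
   closure of [Omega], with [y] removed. *)
Definition segment_co (Omega : set projspace) (x y : projspace) :
    set projspace :=
  [set p | exists (f : 'rV[R]_d) (t : R),
    [/\ proper_chart Omega f, affine_chart f p, 0 <= t < 1 &
        chart_coord f p = (1 - t) *: chart_coord f x + t *: chart_coord f y]].

(* Rays and quasi-geodesics are total functions on R; only their values on
   [0, +oo), resp. on the parameter interval, are constrained. *)
Definition geodesic_ray (Omega : set projspace) (c : R -> projspace) : Prop :=
  (forall t, 0 <= t -> Omega (c t)) /\
  (forall s t, 0 <= s -> 0 <= t -> hilbert_dist Omega (c s) (c t) = `|s - t|).

Definition projective_geodesic_ray (Omega : set projspace)
    (c : R -> projspace) : Prop :=
  geodesic_ray Omega c /\
  exists x y, [/\ Omega x, boundary Omega y &
                  c @` `[0, +oo[ = segment_co Omega x y].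

Definition quasi_geodesic (Omega : set projspace) (lambda a s t : R)
    (q : R -> projspace) : Prop :=
  (forall u, u \in `[s, t] -> Omega (q u)) /\
  (forall u v, u \in `[s, t] -> v \in `[s, t] ->
    lambda^-1 * `|u - v| - a <= hilbert_dist Omega (q u) (q v)
      <= lambda * `|u - v| + a).

Definition morse_gauge : Type := {nonneg R} -> {nonneg R} -> {nonneg R}.

Definition is_morse (Omega : set projspace) (M : morse_gauge)
    (ell : set projspace) : Prop :=
  forall (lambda a : {nonneg R}) (s t : R) (q : R -> projspace),
    1 <= lambda%:num -> s <= t ->
    quasi_geodesic Omega lambda%:num a%:num s t q ->
    ell (q s) -> ell (q t) ->
    forall u, u \in `[s, t] ->
      exists2 p, ell p & hilbert_dist Omega (q u) p <= (M lambda a)%:num.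

Definition tracks (Omega : set projspace) (K : R) (x0 : projspace)
    (gamma : nat -> PGL) (c : R -> projspace) : Prop :=
  forall n : nat,
    hilbert_dist Omega x0 (pgl_act (pgl_inv (gamma n)) (c n%:R)) < K.

(* Singular values: nonnegative square roots of the eigenvalues of A^T A with
   multiplicity, in nonincreasing order. *)
Definition is_singular_values (A : 'M[R]_d) (s : d.-tuple R) : Prop :=
  [/\ sorted >=%R s, all (>= 0) s &
      char_poly (A^T *m A) = \prod_(x <- s) ('X - (x ^+ 2)%:P)].

Definition singular_values (A : 'M[R]_d) : d.-tuple R :=
  xget [tuple 0 | i < d] (is_singular_values A).

(* Indices start at 1. *)
Definition sigma (i : nat) (A : 'M[R]_d) : R := (singular_values A)`_i.-1.

(* Quotients of [mu]s are meant in \bar R, where x / 0 = +oo for 0 < x. *)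
Definition mu (i j : nat) (g : PGL) : R :=
  ln (sigma i (lift_mx g) / sigma j (lift_mx g)).

End ProjectiveSpace.

(* Main.v *)
(* Work in the convex cone over [Omega] in the chart [f]; Hilbert distances are
   then comparisons for the order of the cone. Let [c n = y + T n (x - y)], with
   [T n] comparable to [exp (- 2 n)].

   The key point is that, since [c] is Morse, there are [N] and [q > 1] depending
   on the gauge only such that, along [N.+1] steps of [c], the width of the slice
   [f = 1] of the cone around [c n] is divided by [q], while in the directions
   tangent at [y] the ratio of the inradius at [c n] to [T n] is multiplied by
   [q]. Otherwise the cone would contain a nearly triangular planar section with
   a segment of [c] joining a vertex to the opposite side, and a path running
   around a second vertex would be a quasi-geodesic with uniform constants, with
   endpoints on [c], and too far from [c].

   As [gamma n] maps a fixed ball to within bounded distance of [c n], these two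
   estimates show that the ratios of the first two and of the last two singular
   values of [gamma n] grow at least like [q ^ (n / N.+1)], while the ratio of the
   extreme ones is at most [C exp (2 n)]. Comparing logarithms concludes. *)

Require Import Defs.
From mathcomp Require Import fingroup perm.
From mathcomp Require Import all_boot all_order all_algebra.
From mathcomp Require Import all_classical all_reals all_analysis.
From mathcomp Require Import complex ring lra.
Import Order.TTheory GRing.Theory Num.Theory.
Import numFieldNormedType.Exports.

Set Implicit Arguments.
Unset Strict Implicit.
Unset Printing Implicit Defensive.

Local Open Scope classical_set_scope.
Local Open Scope ring_scope.

(** * Homogeneous coordinates *)

Section Pairing.
Variables (R : realType) (d : nat).
Implicit Types (f : 'rV[R]_d) (v w : 'cV[R]_d) (k C : R).

(** The gauge enters only through its value at [(2, ln 16)], the constants of one fixed family of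
    test paths; [N] is then so large that a triangle of that size contradicts the Morse property.
    One triangle lemma serves both estimates, with the two ends of the chord exchanged: for the
    width, the vertex on the line of the ray lies on the side of [X] and the opposite side passes
    near [Y]; for the tangent directions the vertex is [Y]. The factor [q] is [1 + 2 * eta], with
    [eta] the thickness allowed beyond the triangle. A step has length [N.+1], not [N], because the
    approximate opposite side has to lie at a definite distance from the end of the segment in use
    ([2 * eps <= zeta]). Each singular value gap is read from a hyperplane and a test vector: the
    kernel of [f *m T] with [X0], and the kernel of [F *m T] with the preimage under [T] of the
    transpose of [F]. The constant [C] and the rank [n1] depend on the ray. They only shift
    logarithms by bounded amounts, so [xi] can be fixed before the ray. *)

Lemma pairingD f v w : pairing f (v + w) = pairing f v + pairing f w.
Proof. by rewrite /pairing mulmxDr mxE. Qed.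
Lemma pairingZ f k v : pairing f (k *: v) = k * pairing f v.
Proof. by rewrite /pairing -scalemxAr mxE. Qed.
Lemma pairingN f v : pairing f (- v) = - pairing f v.
Proof. by rewrite -scaleN1r pairingZ mulN1r. Qed.
Lemma pairingB f v w : pairing f (v - w) = pairing f v - pairing f w.
Proof. by rewrite pairingD pairingN. Qed.
Lemma pairing0 f : pairing f 0 = 0.
Proof. by rewrite /pairing mulmx0 mxE. Qed.
Lemma pairingDl f g v : pairing (f + g) v = pairing f v + pairing g v.
Proof. by rewrite /pairing mulmxDl mxE. Qed.
Lemma pairingZl k f v : pairing (k *: f) v = k * pairing f v.
Proof. by rewrite /pairing -scalemxAl mxE. Qed.
Definition pairingE := (pairingD, pairingB, pairingN, pairingZ, pairing0).

Lemma pairing_delta i v : pairing (delta_mx 0 i) v = v i 0.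
Proof. by rewrite /pairing -rowE mxE. Qed.

Lemma pairing_bound f : exists2 C, 0 < C & forall v, `|pairing f v| <= C * `|v|.
Proof.
exists (1 + \sum_i `|f 0 i|) => [|v].
  by rewrite ltr_pwDl// sumr_ge0.
rewrite /pairing mxE mulrDl mul1r; apply: (le_trans (ler_norm_sum _ _ _)).
rewrite mulr_suml -[leLHS]add0r lerD//; apply: ler_sum => i _.
rewrite normrM ler_wpM2l// -[leRHS]/(mx_norm v) mx_normrE.
by apply/bigmax_geP; right => /=; exists (i, 0).
Qed.

End Pairing.

Section Representatives.
Variables (R : realType) (d : nat).
Implicit Types (p : projspace R d) (v w : 'cV[R]_d) (f : 'rV[R]_d) (k e : R).
Local Open Scope quotient_scope.

Definition represents p v := exists2 k : R, k != 0 & v = k *: lift_vec p.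

(** Total in [v], so that a path in projective space can be given by a formula for representatives;
    [p0] is the value at 0. *)
Definition pt p0 v : projspace R d :=
  if pselect (v != 0) is left h then proj_class (nzvec_of h) else p0.

Lemma lift_vec_neq0 p : lift_vec p != 0.
Proof. exact: nzvec_neq0. Qed.

Lemma represents_neq0 p v : represents p v -> v != 0.
Proof. by move=> [k k0 ->]; rewrite scaler_eq0 negb_or k0 lift_vec_neq0. Qed.

Lemma represents_scale p v k : k != 0 -> represents p v -> represents p (k *: v).
Proof. by move=> k0 [l l0 ->]; exists (k * l); rewrite ?mulf_neq0// scalerA. Qed.

Lemma proj_class_eq (v w : nzvec R d) :
  proj_class v = proj_class w <-> exists2 k : R, k != 0 & val w = k *: val v.
Proof.
split => [/eqmodP /asboolP //|h].
by apply/eqmodP/asboolP.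
Qed.

Lemma proj_class_represents v (h : v != 0) : represents (proj_class (nzvec_of h)) v.
Proof.
have [|k k0 e] := (proj_class_eq (repr (proj_class (nzvec_of h))) (nzvec_of h)).1.
  by rewrite /proj_class reprK.
by exists k.
Qed.

Lemma represents_inj p q v : represents p v -> represents q v -> p = q.
Proof.
move=> [k k0 e] [l l0 e']; rewrite -(reprK p) -(reprK q).
apply/proj_class_eq; exists (l^-1 * k); first by rewrite mulf_neq0// invr_eq0.
by rewrite -scalerA -[val (repr p)]/(lift_vec p) -e e' scalerA mulVf// scale1r.
Qed.

Lemma represents_colinear p v w : represents p v -> represents p w ->
  exists2 k, k != 0 & w = k *: v.
Proof.
move=> [k k0 ->] [l l0 ->]; exists (l / k); first by rewrite mulf_neq0// invr_eq0.
by rewrite scalerA divfK.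
Qed.

Lemma pt_represents p0 v : v != 0 -> represents (pt p0 v) v.
Proof. by rewrite /pt; case: pselect => // h _; exact: proj_class_represents. Qed.

Lemma pt_eq p0 p v : represents p v -> pt p0 v = p.
Proof.
move=> h; apply: (represents_inj _ h); apply: pt_represents.
exact: represents_neq0 h.
Qed.

Lemma chart_coordE f p v : represents p v -> pairing f v != 0 ->
  chart_coord f p = (pairing f v)^-1 *: v.
Proof.
move=> [k k0 ->]; rewrite pairingZ mulf_eq0 negb_or k0 /= => f0.
by rewrite /chart_coord scalerA invfM mulrAC mulVf// mul1r.
Qed.

Lemma represents_chart f p : affine_chart f p -> represents p (chart_coord f p).
Proof.
move=> fp; exists (pairing f (lift_vec p))^-1 => //.
by rewrite invr_eq0.
Qed.

Lemma pairing_chart f p : affine_chart f p -> pairing f (chart_coord f p) = 1.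
Proof. by move=> fp; rewrite /chart_coord pairingZ mulVf. Qed.

Lemma affine_chartE f p v : represents p v -> affine_chart f p <-> pairing f v != 0.
Proof.
move=> [k k0 ->]; rewrite /affine_chart /= pairingZ mulf_eq0 negb_or k0 /=.
by [].
Qed.

Lemma open_proj_ball (U : set (projspace R d)) p v : open U -> U p ->
  represents p v ->
  exists2 e, 0 < e & forall w, `|w - v| < e -> exists2 q, U q & represents q w.
Proof.
move=> oU Up rv; have v0 := represents_neq0 rv.
have {Up} : U (proj_class (nzvec_of v0)).
  by rewrite (represents_inj (proj_class_represents v0) rv).
have /= [W oW WU] : open (@proj_class R d @^-1` U : set (nzvec R d)) by exact: oU.
rewrite -[U _]/((@proj_class R d @^-1` U) _) -WU /= => Wv.
have /nbhs_ballP [e /= e0 he] : nbhs v W by exact: open_nbhs_nbhs.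
(* The bound by the norm of [v] keeps [w] away from 0, which represents no point. *)
exists (Num.min e `|v|) => [|w].
  by rewrite lt_min e0 normr_gt0.
rewrite lt_min => /andP[we wv].
have w0 : w != 0.
  by apply: contraTneq wv => ->; rewrite sub0r normrN ltxx.
exists (proj_class (nzvec_of w0)); last exact: proj_class_represents.
rewrite -[U _]/((@proj_class R d @^-1` U) _) -WU /=.
by apply: he; rewrite -ball_normE /= distrC.
Qed.

Lemma closure_proj_approx (U : set (projspace R d)) p v e : closure U p ->
  represents p v -> 0 < e ->
  exists q w, [/\ U q, represents q w & `|w - v| < e].
Proof.
move=> cU rv e0; have v0 := represents_neq0 rv.
pose N : set (projspace R d) := [set q | exists2 w, represents q w & `|w - v| < e].
have oN : open N.
  rewrite /open /= /quotient_open.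
  (* The preimage of [N] in the space of nonzero vectors is the union of all dilates of the ball
     around [v], hence open. *)
  exists (\bigcup_(k in [set k : R | k != 0]) ((fun w => k *: w) @^-1` ball v e)).
    apply: bigcup_open => k k0; apply: open_comp; last exact: ball_open.
    by move=> x _; apply: scaler_continuous.
  apply/seteqP; split => u /=.
    move=> [k /= k0]; rewrite -ball_normE /= distrC => h.
    exists (k *: val u) => //; apply: represents_scale => //.
    have -> : \pi u = proj_class (nzvec_of (nzvec_neq0 u)).
      by apply/proj_class_eq; exists 1; rewrite ?oner_neq0// scale1r.
    exact: proj_class_represents.
  move=> [w rw wv].
  have ru : represents (\pi u) (val u).
    have -> : \pi u = proj_class (nzvec_of (nzvec_neq0 u)).
      by apply/proj_class_eq; exists 1; rewrite ?oner_neq0// scale1r.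
    exact: proj_class_represents.
  have [k k0 e'] := represents_colinear ru rw.
  by exists k => //; rewrite -ball_normE /= distrC -e'.
have Np : N p by exists v => //; rewrite subrr normr0.
have [q [Uq [w rw wv]]] := cU N (open_nbhs_nbhs (conj oN Np)).
by exists q, w.
Qed.

Lemma closure_proj_limit (U : set (projspace R d)) p v : represents p v ->
  (forall e, 0 < e -> exists q w, [/\ closure U q, represents q w & `|w - v| < e]) ->
  closure U p.
Proof.
move=> rv h; apply: contrapT => np.
have oC : open (~` closure U) by apply: closed_openC; exact: closed_closure.
have [e e0 he] := open_proj_ball oC np rv.
have [q [w [Uq rw wv]]] := h e e0.
have [q' Uq' rw'] := he w wv.
by apply: Uq'; rewrite (represents_inj rw' rw).
Qed.

End Representatives.

Definition cone_over (R : realType) (d : nat) (f : 'rV[R]_d)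
    (A : set (projspace R d)) : set 'cV[R]_d :=
  [set v | 0 < pairing f v /\ exists2 p, A p & represents p v].

(** Intended for the open cone [Co] over a properly convex domain and its closure [Cb]. [cone_bound]
    expresses that the slice [f = 1] is bounded, which makes the cone sharp. *)
Record convex_cone (R : realType) (d : nat) (f : 'rV[R]_d) (B : R)
    (Co Cb : set 'cV[R]_d) : Prop := ConvexCone {
  cone_bound_gt0 : 0 < B;
  cone_bound : forall v, Cb v -> `|v| <= B * pairing f v;
  coW : forall v, Co v -> Cb v;
  cb0 : Cb 0;
  cbD : forall v w, Cb v -> Cb w -> Cb (v + w);
  cbZ : forall (k : R) v, 0 <= k -> Cb v -> Cb (k *: v);
  coZ : forall (k : R) v, 0 < k -> Co v -> Co (k *: v);
  coDb : forall v w, Co v -> Cb w -> Co (v + w);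
  co_pos : forall v, Co v -> 0 < pairing f v;
  co_open : forall v, Co v -> exists2 e : R, 0 < e & forall w, `|w| < e -> Co (v + w);
  cb_closed : forall v,
    (forall e : R, 0 < e -> exists2 w, Cb w & `|w - v| < e) -> Cb v }.

(** * The cone over a properly convex domain *)

Section Omega.
Variables (R : realType) (d : nat).
Implicit Types (f : 'rV[R]_d) (v w : 'cV[R]_d) (A : set (projspace R d)) (k e : R).

Lemma cone_overZ f A k v : 0 < k -> cone_over f A v -> cone_over f A (k *: v).
Proof.
move=> k0 [fv [p Ap rv]]; split; first by rewrite pairingZ mulr_gt0.
by exists p => //; apply: represents_scale; rewrite ?gt_eqF.
Qed.

Lemma cone_overD f A v w : A `<=` affine_chart f ->
  convex_set (chart_coord f @` A) ->
  cone_over f A v -> cone_over f A w -> cone_over f A (v + w).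
Proof.
move=> Af cA [fv [p Ap rv]] [fw [q Aq rw]].
have fvw : 0 < pairing f v + pairing f w by rewrite addr_gt0.
split; first by rewrite pairingD.
have k0 : 0 <= pairing f v / (pairing f v + pairing f w).
  by rewrite divr_ge0 ?ltW.
have k1 : pairing f v / (pairing f v + pairing f w) <= 1.
  by rewrite ler_pdivrMr// mul1r lerDl ltW.
have := cA (chart_coord f p) (chart_coord f q) (Itv01 k0 k1).
move=> /(_ (mem_set (imageP _ Ap)) (mem_set (imageP _ Aq))) /set_mem [r Ar e].
exists r => //.
have rr := represents_chart (Af _ Ar).
rewrite (_ : v + w = (pairing f v + pairing f w) *: chart_coord f r).
  by apply: represents_scale => //; rewrite gt_eqF.
rewrite e (chart_coordE rv) ?gt_eqF// (chart_coordE rw) ?gt_eqF//.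
rewrite -[LHS]/(v + w) /conv/= /unstable.onem /=.
rewrite scalerDr !scalerA; congr (_ + _).
  by rewrite [X in X *: _](_ : _ = 1) ?scale1r//; field; rewrite !gt_eqF.
by rewrite [X in X *: _](_ : _ = 1) ?scale1r//; field; rewrite !gt_eqF.
Qed.

Variables (Omega : set (projspace R d)) (f : 'rV[R]_d).
Hypotheses (oOmega : open Omega) (fOmega : proper_chart Omega f).
Hypothesis cOmega : convex_set (chart_coord f @` Omega).

Definition closed_cone : set 'cV[R]_d := [set v | v = 0 \/ cone_over f (closure Omega) v].

Lemma cone_overW v : cone_over f Omega v -> cone_over f (closure Omega) v.
Proof. by move=> [fv [p Op rv]]; split=> //; exists p => //; exact: subset_closure. Qed.

Lemma cone_over_open v : cone_over f Omega v ->
  exists2 e, 0 < e & forall w, `|w| < e -> cone_over f Omega (v + w).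
Proof.
move=> [fv [p Op rv]]; have [e e0 he] := open_proj_ball oOmega Op rv.
have [C C0 hC] := pairing_bound f.
exists (Num.min e (pairing f v / C)) => [|w].
  by rewrite lt_min e0 divr_gt0.
rewrite lt_min => /andP[we wC]; split; last first.
  by apply: he; rewrite addrC addKr.
rewrite pairingD -ltrBlDr sub0r.
rewrite ltr_pdivlMr// in wC.
have := hC w; rewrite ler_norml => /andP[h _].
by lra.
Qed.

Lemma closed_cone_approx v e : closed_cone v -> 0 < e -> Omega !=set0 ->
  exists2 w, cone_over f Omega w & `|w - v| < e.
Proof.
have [_ clf _ _] := fOmega.
move=> [-> e0 [p Op]|[fv [p Op rv]] e0 _].
  have fp : pairing f (chart_coord f p) = 1.
    by apply: pairing_chart; apply: clf; exact: subset_closure.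
  have rp : represents p (chart_coord f p).
    by apply: represents_chart; apply: clf; exact: subset_closure.
  pose k := e / (1 + `|chart_coord f p|).
  have k0 : 0 < k by rewrite divr_gt0// ltr_pwDl.
  exists (k *: chart_coord f p).
    by apply: cone_overZ => //; split; [rewrite fp|exists p].
  rewrite subr0 normrZ gtr0_norm// /k mulrAC ltr_pdivrMr ?ltr_pwDl//.
  by rewrite ltr_pM2l// ltrDr.
have [C C0 hC] := pairing_bound f.
have e'0 : 0 < Num.min e (pairing f v / C) by rewrite lt_min e0 divr_gt0.
have [q [w [Oq rw]]] := closure_proj_approx Op rv e'0.
rewrite lt_min => /andP[we wC]; exists w => //; split; last by exists q.
rewrite ltr_pdivlMr// in wC.
have := hC (w - v); rewrite ler_norml pairingB => /andP[h _].
by lra.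
Qed.

Lemma cone_over_convex_cone : Omega !=set0 ->
  exists B, convex_cone f B (cone_over f Omega) closed_cone.
Proof.
have [f0 clf bnd cclO] := fOmega => ne.
have [M [_ hM]] := bnd.
have {}hM v : closed_cone v -> `|v| <= (`|M| + 1) * pairing f v.
  move=> [->|[fv [p Op rv]]]; first by rewrite normr0 pairing0 mulr0.
  have h1 : M < `|M| + 1 by rewrite (le_lt_trans (ler_norm M))// ltrDl.
  have := hM _ h1 (chart_coord f p) (imageP _ Op).
  rewrite /= (chart_coordE rv) ?gt_eqF//.
  by rewrite normrZ normfV gtr0_norm// ler_pdivrMl// mulrC.
have cD : forall v w, closed_cone v -> closed_cone w -> closed_cone (v + w).
  move=> v w [->|hv]; first by rewrite add0r.
  move=> [->|hw]; first by rewrite addr0; right.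
  by right; apply: cone_overD.
have Oclf : Omega `<=` affine_chart f.
  by move=> p Op; apply: clf; exact: subset_closure.
exists (`|M| + 1); split => //.
- by move=> v hv; right; exact: cone_overW.
- by left.
- move=> k v; rewrite le_eqVlt => /orP[/eqP<- _|k0 [->|hv]].
  + by rewrite scale0r; left.
  + by rewrite scaler0; left.
  + by right; exact: cone_overZ.
- by move=> k v; exact: cone_overZ.
(* [w] is replaced by a nearby [w'] over [Omega], and the error is moved to [v], which has room for
   it. *)
- move=> v w hv hw; have [e e0 he] := cone_over_open hv.
  have [w' hw' ww] := closed_cone_approx hw e0 ne.
  have -> : v + w = (v + (w - w')) + w' by rewrite -addrA subrK.
  apply: cone_overD => //.
  by apply: he; rewrite distrC.
- by move=> v [].
- exact: cone_over_open.
- move=> v h; have [->|v0] := eqVneq v 0; first by left.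
  have [p0 Op0] := ne.
  have rv := pt_represents p0 v0.
  have Ov : closure Omega (pt p0 v).
    apply: (closure_proj_limit rv) => e e0.
    have e'0 : 0 < Num.min e `|v| by rewrite lt_min e0 normr_gt0.
    have [w [->|[fw [q Oq rw]]]] := h _ e'0; rewrite lt_min.
      by rewrite sub0r normrN ltxx andbF.
    by move=> /andP[we _]; exists q, w.
  right; split; last by exists (pt p0 v).
  have := (affine_chartE f rv).1 (clf _ Ov).
  rewrite neq_lt => /orP[fv|//].
  have [C C0 hC] := pairing_bound f.
  have e0 : 0 < - pairing f v / C by rewrite divr_gt0// oppr_gt0.
  have [w hw] := h _ e0; rewrite ltr_pdivlMr// => ww.
  have fw : 0 <= pairing f w.
    by move: hw => [->|[/ltW//]]; rewrite pairing0.
  have := hC (w - v); rewrite ler_norml pairingB => /andP[_ h'].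
  by lra.
Qed.

End Omega.

(** * Convex cones and their chords *)

Section ConeTheory.
Variables (R : realType) (d : nat) (f : 'rV[R]_d) (B : R) (Co Cb : set 'cV[R]_d).
Hypothesis cone : convex_cone f B Co Cb.
Implicit Types (k l e : R).

Lemma cb_ge0 v : Cb v -> 0 <= pairing f v.
Proof.
move=> /(cone_bound cone) h; rewrite -(pmulr_rge0 _ (cone_bound_gt0 cone)).
exact: (le_trans (normr_ge0 v) h).
Qed.

Lemma cb_eq0 v : Cb v -> pairing f v <= 0 -> v = 0.
Proof.
move=> cv fv; apply/eqP; rewrite -normr_le0.
have := cone_bound cone cv; have := cone_bound_gt0 cone.
have := cb_ge0 cv; have := normr_ge0 v; nra.
Qed.

Lemma coD v w : Co v -> Co w -> Co (v + w).
Proof. by move=> cv /(coW cone); exact: (coDb cone). Qed.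

Lemma cobD v w : Cb v -> Co w -> Co (v + w).
Proof. by move=> cv cw; rewrite addrC; exact: (coDb cone cw cv). Qed.

Lemma co0 : ~ Co 0.
Proof. by move=> /(co_pos cone); rewrite pairing0 ltxx. Qed.

Lemma co_neq0 v : Co v -> v != 0.
Proof. by move=> cv; apply/eqP => v0; move: cv; rewrite v0; exact: co0. Qed.

Lemma cobZ k v : 0 < k -> Co (k *: v) -> Co v.
Proof.
move=> k0 /(@coZ _ _ _ _ _ _ cone k^-1) /=; rewrite invr_gt0 => /(_ k0).
by rewrite scalerA mulVf ?gt_eqF// scale1r.
Qed.

Lemma co_dir v w : Co v -> exists2 e, 0 < e & forall k, `|k| < e -> Co (v + k *: w).
Proof.
move=> /(co_open cone)[e e0 he]; exists (e / (1 + `|w|)).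
  by rewrite divr_gt0// ltr_pwDl.
move=> k; rewrite ltr_pdivlMr ?ltr_pwDl// => h; apply: he.
by rewrite normrZ (le_lt_trans _ h)// ler_wpM2l// lerDr.
Qed.

(** If [p < 0], adding [a / - p] times the last combination to the interior one eliminates [u] and
    makes a positive multiple of [v] interior. *)
Lemma chord_coef_ge0 u v (a b p q : R) : ~ Co v -> Cb v ->
  Co (a *: u + b *: v) -> 0 < a -> Cb (p *: u + q *: v) -> 0 <= p.
Proof.
move=> nv cv cy a0 cz; rewrite leNgt; apply/negP => p0.
have := coDb cone cy (cbZ cone (k := a / - p) _ cz).
rewrite divr_ge0 ?ltW ?oppr_gt0// => /(_ isT).
have -> : a *: u + b *: v + (a / - p) *: (p *: u + q *: v)
          = (b + a / - p * q) *: v.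
  rewrite scalerDr !scalerA addrACA -!scalerDl.
  by rewrite [X in X *: u](_ : _ = 0) ?scale0r ?add0r//; field; rewrite lt_eqF.
move=> h; have := co_pos cone h; rewrite pairingZ => h'.
have k0 : 0 < b + a / - p * q.
  by rewrite ltNge; apply/negP => k0; move: h'; rewrite ltNge mulr_le0_ge0// cb_ge0.
exact: nv (cobZ k0 h).
Qed.

(* [y] and the boundary vector obtained by subtracting as much of [y] as
   possible from [x]. *)
Lemma chord_end x y : Co x -> Co y -> (forall k, x != k *: y) ->
  exists2 k, 0 < k & Cb (x - k *: y) /\ ~ Co (x - k *: y).
Proof.
move=> cx cy nxy.
pose S := [set k : R | Co (x - k *: y)].
have S0 : S 0 by rewrite /S /= scale0r subr0.
have ubS : ubound S (pairing f x / pairing f y).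
  move=> k /(co_pos cone); rewrite pairingB pairingZ => h.
  by rewrite ler_pdivlMr ?(co_pos cone cy)//; lra.
have hS : has_sup S by split; [exists 0|exists (pairing f x / pairing f y)].
have [e e0 he] := co_dir (- y) cx.
have k0 : 0 < sup S.
  have : S (e / 2).
    rewrite /S /= -scalerN; apply: he.
    by rewrite gtr0_norm ?divr_gt0//; lra.
  by move=> /(ub_le_sup (ex_intro _ _ ubS)) h; lra.
have below k : k < sup S -> Co (x - k *: y).
  move=> kS; have [l Sl kl] := sup_adherent (eps := sup S - k) ltac:(lra) hS.
  have -> : x - k *: y = (x - l *: y) + (l - k) *: y.
    by apply/matrixP => i j; rewrite !mxE; ring.
  by apply: (coDb cone) => //; apply: (cbZ cone); [lra|exact: (coW cone)].
exists (sup S) => //; split.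
  apply: (cb_closed cone) => r r0.
  pose l := r / (1 + `|y|).
  have l0 : 0 < l by rewrite divr_gt0// ltr_pwDl.
  exists (x - (sup S - l) *: y); first by apply: (coW cone); apply: below; lra.
  have -> : x - (sup S - l) *: y - (x - sup S *: y) = l *: y.
    by apply/matrixP => i j; rewrite !mxE; ring.
  rewrite normrZ gtr0_norm// /l mulrAC ltr_pdivrMr ?ltr_pwDl//.
  by rewrite ltr_pM2l// ltrDr.
move=> h; have [r r0 hr] := co_dir (- y) h.
have : S (sup S + r / 2).
  rewrite /S /=.
  have -> : x - (sup S + r / 2) *: y = x - sup S *: y + (r / 2) *: - y.
    by apply/matrixP => i j; rewrite !mxE; ring.
  apply: hr.
  by rewrite gtr0_norm ?divr_gt0//; lra.
by move=> /(ub_le_sup (ex_intro _ _ ubS)) h'; lra.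
Qed.

End ConeTheory.

(** * The Hilbert metric *)

Section Hilbert.
Variables (R : realType) (d : nat) (Omega : set (projspace R d)) (f : 'rV[R]_d) (B : R).
Hypotheses (oOmega : open Omega) (fOmega : proper_chart Omega f).
Notation Co := (cone_over f Omega).
Notation Cb := (closed_cone Omega f).
Hypothesis cone : convex_cone f B Co Cb.
Implicit Types (k l e : R).

Lemma boundaryE a v : represents a v -> 0 < pairing f v ->
  boundary Omega a <-> Cb v /\ ~ Co v.
Proof.
move=> ra fa; split.
  move=> [ca ia]; split; first by right; split=> //; exists a.
  move=> [_ [p Op rp]]; apply: ia; rewrite ((interior_id Omega).1 oOmega).
  by rewrite (represents_inj ra rp).
move=> [[v0|[_ [p Op rp]]] nv].
  by move: fa; rewrite v0 pairing0 ltxx.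
split; first by rewrite (represents_inj ra rp).
by move=> /interior_subset Oa; apply: nv; split=> //; exists a.
Qed.

(** Distances and segments are defined with an arbitrary proper chart [g]; this permits the return
    to [f]. If [g] changed sign on the cone, a positive combination of [u] and [v] would lie in its
    kernel, whereas [g] does not vanish over the closure of [Omega]. *)
Lemma proper_chart_sign g u v : proper_chart Omega g ->
  cone_over f (closure Omega) u -> cone_over f (closure Omega) v ->
  0 < pairing g u * pairing g v.
Proof.
move=> [_ clg _ _].
have nz w : cone_over f (closure Omega) w -> pairing g w != 0.
  by move=> [_ [p Op rp]]; rewrite -(affine_chartE g rp); exact: clg.
wlog : u v / 0 < pairing g u.
  move=> hw cu cv; have /orP[gu|gu] : (0 < pairing g u) || (0 < - pairing g u).
    by rewrite oppr_gt0 -neq_lt eq_sym nz.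
    exact: hw.
  have /orP[gv|gv] : (0 < pairing g v) || (0 < - pairing g v).
    by rewrite oppr_gt0 -neq_lt eq_sym nz.
    by rewrite mulrC; exact: hw.
  by rewrite -mulrNN mulr_gt0.
move=> gu cu cv; rewrite pmulr_rgt0// ltNge; apply/negP => gv.
have gv' : pairing g v < 0 by rewrite lt_neqAle gv nz.
pose w := (- pairing g v) *: u + pairing g u *: v.
have cw : Cb w.
  by apply: (cbD cone); apply: (cbZ cone); rewrite ?oppr_ge0//; try right; rewrite // ltW.
case: cw => [w0|/nz].
  have := congr1 (pairing f) w0; rewrite pairingD !pairingZ pairing0.
  by move: cu.1 cv.1; nra.
by rewrite /w pairingD !pairingZ; apply/negP; rewrite negbK; apply/eqP; ring.
Qed.

(** Any witness of the distance is turned into homogeneous coordinates along the chord. The factors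
    such as [pairing g X / pairing g U] come from the change of chart and cancel in the
    cross-ratio. *)
Lemma hilbert_chord x y (r : R) X Y : x != y -> is_hilbert_dist Omega x y r ->
  represents x X -> represents y Y -> Co X -> Co Y ->
  exists U V (xu xv yu yv : R),
   [/\ [/\ Cb U, ~ Co U, Cb V & ~ Co V],
       X = xu *: U + xv *: V /\ Y = yu *: U + yv *: V,
       [/\ 0 < xu, 0 < xv, 0 < yu & 0 < yv],
       xv * yu < xu * yv & expR (2 * r) = (xu * yv) / (xv * yu)].
Proof.
move=> xy [g [a [b [s [t]]]]] /= [hg [ba bb] [s0 /andP[st t1]] [eX eY] er] rx ry cX cY.
have t0 : 0 < t := lt_trans s0 st; have s1 : s < 1 := lt_trans st t1.
have [_ clg _ _] := hg; have [_ clf _ _] := fOmega.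
have ra := represents_chart (clf _ ba.1); have rb := represents_chart (clf _ bb.1).
set U := chart_coord f a in ra; set V := chart_coord f b in rb.
have fU : pairing f U = 1 by apply/pairing_chart/clf; exact: ba.1.
have fV : pairing f V = 1 by apply/pairing_chart/clf; exact: bb.1.
have [|cU nU] := (boundaryE ra _).1 ba; first by rewrite fU.
have [|cV nV] := (boundaryE rb _).1 bb; first by rewrite fV.
have kU : cone_over f (closure Omega) U.
  by split; [rewrite fU|exists a => //; exact: ba.1].
have kV : cone_over f (closure Omega) V.
  by split; [rewrite fV|exists b => //; exact: bb.1].
have kX := cone_overW cX; have kY := cone_overW cY.
have sXU := proper_chart_sign hg kX kU; have sXV := proper_chart_sign hg kX kV.
have sYU := proper_chart_sign hg kY kU; have sYV := proper_chart_sign hg kY kV.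
have gX : pairing g X != 0 by apply: contraTneq sXU => ->; rewrite mul0r ltxx.
have gY : pairing g Y != 0 by apply: contraTneq sYU => ->; rewrite mul0r ltxx.
have gU : pairing g U != 0 by apply: contraTneq sXU => ->; rewrite mulr0 ltxx.
have gV : pairing g V != 0 by apply: contraTneq sXV => ->; rewrite mulr0 ltxx.
have AB : chart_coord g a - chart_coord g b != 0.
  rewrite subr_eq0; apply: contra xy => /eqP AB.
  have : chart_coord g x = chart_coord g y.
    by rewrite eX eY AB -!scalerDl !subrK.
  move=> e; apply/eqP; apply: (represents_inj (v := chart_coord g x)).
    by apply: represents_chart; rewrite (affine_chartE g rx).
  by rewrite e; apply: represents_chart; rewrite (affine_chartE g ry).
exists U, V, (pairing g X / pairing g U * (1 - s)), (pairing g X / pairing g V * s).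
exists (pairing g Y / pairing g U * (1 - t)), (pairing g Y / pairing g V * t).
have pos (p q : R) : 0 < p * q -> 0 < p / q.
  move=> h; have q0 : q != 0 by apply: contraTneq h => ->; rewrite mulr0 ltxx.
  have -> : p / q = (p * q) / (q ^+ 2) by field.
  by rewrite divr_gt0// exprn_even_gt0.
have pXU := pos _ _ sXU; have pXV := pos _ _ sXV.
have pYU := pos _ _ sYU; have pYV := pos _ _ sYV.
split => //.
- split.
    have := congr1 (fun v => pairing g X *: v) eX.
    rewrite (chart_coordE rx)// scalerA mulfV// scale1r => e; rewrite {1}e {e}.
    rewrite (chart_coordE ra)// (chart_coordE rb)// scalerDr !scalerA.
    by congr (_ *: _ + _ *: _); ring.
  have := congr1 (fun v => pairing g Y *: v) eY.
  rewrite (chart_coordE ry)// scalerA mulfV// scale1r => e; rewrite {1}e {e}.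
  rewrite (chart_coordE ra)// (chart_coordE rb)// scalerDr !scalerA.
  by congr (_ *: _ + _ *: _); ring.
- by split; apply: mulr_gt0; rewrite ?subr_gt0//.
- have -> : pairing g X / pairing g V * s * (pairing g Y / pairing g U * (1 - t))
    = (pairing g X / pairing g U * (pairing g Y / pairing g V)) * (s * (1 - t)).
    by field; rewrite gU gV.
  have -> : pairing g X / pairing g U * (1 - s) * (pairing g Y / pairing g V * t)
    = (pairing g X / pairing g U * (pairing g Y / pairing g V)) * ((1 - s) * t).
    by field; rewrite gU gV.
  rewrite ltr_pM2l; last exact: mulr_gt0.
  by rewrite mulrBr mulrBl mulr1 mul1r ltrD2r.
- rewrite er mulVKf ?pnatr_eq0//.
  have eAY : chart_coord g a - chart_coord g y = t *: (chart_coord g a - chart_coord g b).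
    by rewrite eY; apply/matrixP => i j; rewrite !mxE; ring.
  have eBX : chart_coord g b - chart_coord g x = (s - 1) *: (chart_coord g a - chart_coord g b).
    by rewrite eX; apply/matrixP => i j; rewrite !mxE; ring.
  have eAX : chart_coord g a - chart_coord g x = s *: (chart_coord g a - chart_coord g b).
    by rewrite eX; apply/matrixP => i j; rewrite !mxE; ring.
  have eBY : chart_coord g b - chart_coord g y = (t - 1) *: (chart_coord g a - chart_coord g b).
    by rewrite eY; apply/matrixP => i j; rewrite !mxE; ring.
  rewrite eAY eBX eAX eBY !normrZ.
  have n0 : 0 < `|chart_coord g a - chart_coord g b| by rewrite normr_gt0.
  rewrite (gtr0_norm s0) (gtr0_norm t0).
  rewrite (ltr0_norm (x := s - 1)) ?subr_lt0//.
  rewrite (ltr0_norm (x := t - 1)) ?subr_lt0//.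
  rewrite lnK; last first.
    by rewrite posrE divr_gt0// !mulr_gt0// oppr_gt0 subr_lt0.
  by field; rewrite gU gV gX gY (gt_eqF s0) (gt_eqF n0) !subr_eq0 [1 == t]eq_sym (lt_eqF t1).
Qed.

(** Rules out the default value of [xget] in [hilbert_dist]. The ends of the chord come from
    [chord_end], used in both directions. *)
Lemma hilbert_dist_exists x y X Y : x != y ->
  represents x X -> represents y Y -> Co X -> Co Y ->
  exists r, is_hilbert_dist Omega x y r.
Proof.
wlog fX : X / pairing f X = 1.
  move=> hw xy rx ry cX cY; have fX := co_pos cone cX.
  apply: (hw ((pairing f X)^-1 *: X) _ xy _ ry _ cY).
  - by rewrite pairingZ mulVf// gt_eqF.
  - by apply: represents_scale => //; rewrite invr_eq0 gt_eqF.
  - by apply: (coZ cone) => //; rewrite invr_gt0.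
wlog fY : Y / pairing f Y = 1.
  move=> hw xy rx ry cX cY; have fY := co_pos cone cY.
  apply: (hw ((pairing f Y)^-1 *: Y) _ xy rx _ cX _).
  - by rewrite pairingZ mulVf// gt_eqF.
  - by apply: represents_scale => //; rewrite invr_eq0 gt_eqF.
  - by apply: (coZ cone) => //; rewrite invr_gt0.
move=> xy rx ry cX cY.
have nXY k : X != k *: Y.
  apply: contra xy => /eqP e; have k0 : k != 0.
    by apply: contra_eq_neq e => ->; rewrite scale0r (co_neq0 cone).
  by apply/eqP/(represents_inj rx); rewrite e; exact: represents_scale.
have nYX k : Y != k *: X.
  apply: contra (nXY k^-1) => /eqP e; have k0 : k != 0.
    by apply: contra_eq_neq e => ->; rewrite scale0r (co_neq0 cone).
  by rewrite e scalerA mulVf// scale1r.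
have [k k0 [ca na]] := chord_end cone cX cY nXY.
have [l l0 [cb nb]] := chord_end cone cY cX nYX.
have k1 : k < 1.
  rewrite ltNge; apply/negP => k1.
  have := cb_eq0 cone ca; rewrite pairingB pairingZ fX fY mulr1 subr_le0 => /(_ k1) /eqP.
  by rewrite subr_eq0 (negbTE (nXY k)).
have l1 : l < 1.
  rewrite ltNge; apply/negP => l1.
  have := cb_eq0 cone cb; rewrite pairingB pairingZ fX fY mulr1 subr_le0 => /(_ l1) /eqP.
  by rewrite subr_eq0 (negbTE (nYX l)).
pose U := (1 - k)^-1 *: (X - k *: Y); pose V := (1 - l)^-1 *: (Y - l *: X).
have fU : pairing f U = 1.
  by rewrite /U pairingZ pairingB pairingZ fX fY mulr1 mulVf//; lra.
have fV : pairing f V = 1.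
  by rewrite /V pairingZ pairingB pairingZ fX fY mulr1 mulVf//; lra.
have U0 : U != 0 by apply: contra_eq_neq fU => ->; rewrite pairing0 eq_sym oner_eq0.
have V0 : V != 0 by apply: contra_eq_neq fV => ->; rewrite pairing0 eq_sym oner_eq0.
have ra := pt_represents x U0; have rb := pt_represents x V0.
have ba : boundary Omega (pt x U).
  apply/(boundaryE ra); first by rewrite fU.
  split; first by apply: (cbZ cone) => //; rewrite invr_ge0; lra.
  by apply: contra_not na; apply: (cobZ cone); rewrite invr_gt0; lra.
have bb : boundary Omega (pt x V).
  apply/(boundaryE rb); first by rewrite fV.
  split; first by apply: (cbZ cone) => //; rewrite invr_ge0; lra.
  by apply: contra_not nb; apply: (cobZ cone); rewrite invr_gt0; lra.
have kl : k * l < 1 by nra.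
exists (2^-1 * ln ((`|U - Y| * `|V - X|) / (`|U - X| * `|V - Y|))).
(* The two parameters solve [X = (1 - k) U + k Y] and [Y = (1 - l) V + l X] for [X] and [Y]. *)
exists f, (pt x U), (pt x V), (k * (1 - l) / (1 - k * l)), ((1 - l) / (1 - k * l)).
rewrite /= (chart_coordE rx) ?fX ?oner_eq0// (chart_coordE ry) ?fY ?oner_eq0//.
rewrite (chart_coordE ra) ?fU ?oner_eq0// (chart_coordE rb) ?fV ?oner_eq0//.
rewrite !invr1 !scale1r; split => //.
- split; first by rewrite divr_gt0//; nra.
  rewrite ltr_pM2r ?invr_gt0; last lra.
  rewrite ltr_pdivrMr; last lra.
  by apply/andP; split; nra.
- by split; apply/matrixP => i j; rewrite !mxE; field;
    rewrite !subr_eq0 ![1 == _]eq_sym !lt_eqF.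
Qed.

(** Birkhoff's description of the metric: its exponential is the least product [k * l] with
    [X <= k Y] and [Y <= l X] in the order of the cone. Both inequalities are tested on the
    coordinates along the chord. *)
Lemma hilbert_dist_le x y X Y k l : represents x X -> represents y Y ->
  Co X -> Co Y -> 0 < k -> 0 < l -> Cb (k *: Y - X) -> Cb (l *: X - Y) ->
  expR (2 * hilbert_dist Omega x y) <= k * l.
Proof.
move=> rx ry cX cY k0 l0 h h'; rewrite /hilbert_dist.
case: eqVneq => [xy|xy].
  rewrite mulr0 expR0.
  have := cb_ge0 cone (cbD cone (cbZ cone (ltW l0) h) h').
  rewrite !pairingE; have := co_pos cone cX; have := co_pos cone cY.
  nra.
have hr := xgetPex 0 (hilbert_dist_exists xy rx ry cX cY).
have [U [V [xu [xv [yu [yv [[cU nU cV nV] [eX eY] [xu0 xv0 yu0 yv0] lt ->]]]]]]] :=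
  hilbert_chord xy hr rx ry cX cY.
have h1 : 0 <= k * yu - xu.
  apply: (chord_coef_ge0 cone (u := U) (v := V) (a := yu) (b := yv) (q := k * yv - xv)) => //.
    by rewrite -eY.
  by rewrite (_ : _ + _ = k *: Y - X)// eX eY; apply/matrixP => i j; rewrite !mxE; ring.
have h2 : 0 <= l * xv - yv.
  apply: (chord_coef_ge0 cone (u := V) (v := U) (a := xv) (b := xu) (q := l * xu - yu)) => //.
    by rewrite addrC -eX.
  by rewrite (_ : _ + _ = l *: X - Y)// eX eY; apply/matrixP => i j; rewrite !mxE; ring.
rewrite ler_pdivrMr ?mulr_gt0//.
have -> : k * l * (xv * yu) = (k * yu) * (l * xv) by ring.
by apply: ler_pM; [exact: ltW|exact: ltW|lra|lra].
Qed.

(** The minimum is attained: for distinct points, [k] and [l] are chosen so that the two differences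
    become multiples of the ends [V] and [U] of the chord. *)
Lemma hilbert_dist_ex x y X Y : represents x X -> represents y Y ->
  Co X -> Co Y ->
  exists k l, [/\ 0 < k, 0 < l, Cb (k *: Y - X), Cb (l *: X - Y) &
    expR (2 * hilbert_dist Omega x y) = k * l].
Proof.
move=> rx ry cX cY; rewrite /hilbert_dist.
case: eqVneq => [xy|xy].
  rewrite mulr0 expR0; move: rx; rewrite xy => rx.
  have [k k0 e] := represents_colinear rx ry.
  have k1 : 0 < k.
    have := co_pos cone cX; have := co_pos cone cY; rewrite e pairingZ => h h'.
    by rewrite -(pmulr_lgt0 _ h').
  exists k^-1, k; rewrite e scalerA mulVf// scale1r !subrr invr_gt0.
  by split => //; exact: cb0 cone.
have hr := xgetPex 0 (hilbert_dist_exists xy rx ry cX cY).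
have [U [V [xu [xv [yu [yv [[cU nU cV nV] [eX eY] [xu0 xv0 yu0 yv0] lt ->]]]]]]] :=
  hilbert_chord xy hr rx ry cX cY.
exists (xu / yu), (yv / xv); split; rewrite ?divr_gt0//.
- rewrite (_ : _ - _ = (xu * yv / yu - xv) *: V).
    apply: (cbZ cone) => //; rewrite subr_ge0 ler_pdivlMr//; exact: ltW.
  by rewrite eX eY; apply/matrixP => i j; rewrite !mxE; field; rewrite gt_eqF.
- rewrite (_ : _ - _ = (xu * yv / xv - yu) *: U).
    by apply: (cbZ cone) => //; rewrite subr_ge0 ler_pdivlMr//; rewrite mulrC ltW.
  by rewrite eX eY; apply/matrixP => i j; rewrite !mxE; field; rewrite gt_eqF.
- by field; rewrite !gt_eqF.
Qed.

End Hilbert.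

(** * Functionals positive on an open convex cone *)

Section Separation.
Variables (R : realType) (d : nat) (K : set 'cV[R]_d).
Hypothesis KD : forall v w, K v -> K w -> K (v + w).
Hypothesis KZ : forall (k : R) v, 0 < k -> K v -> K (k *: v).
Hypothesis K_open : forall v w, K v -> exists2 e : R, 0 < e & K (v + e *: w).
Hypothesis K0 : ~ K 0.

Let slice j : set 'cV[R]_d := [set v | K v /\ forall i : 'I_d, (j <= i)%N -> v i 0 = 0].

(* One dimension is added at a time, as in the Hahn-Banach theorem. *)
Let slice_functional j : slice j !=set0 -> exists F : 'rV[R]_d,
  (forall v, slice j v -> 0 <= pairing F v) /\ exists2 v, slice j v & 0 < pairing F v.
Proof.
elim: j => [[v [Kv v0]]|j IH [v0 sv0]].
  by case: K0; rewrite (_ : 0 = v)//; apply/colP => i; rewrite v0// mxE.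
have [jd|jd] := ltnP j d; last first.
  have sj : slice j !=set0.
    exists v0; split; first exact: sv0.1.
    by move=> i ji; have := ltn_ord i; rewrite ltnNge (leq_trans jd ji).
  have [F [F0 [v sv Fv]]] := IH sj; exists F; split => [u [Ku u0]|].
    apply: F0; split => // i ji.
    by have := ltn_ord i; rewrite ltnNge (leq_trans jd ji).
  exists v => //; split; first exact: sv.1.
  by move=> i ji; have := ltn_ord i; rewrite ltnNge (leq_trans jd (ltnW ji)).
pose J := Ordinal jd.
have sliceW v : slice j.+1 v -> v J 0 = 0 -> slice j v.
  move=> [Kv v0'] vJ; split => // i; rewrite leq_eqVlt => /orP[/eqP ji|]; last exact: v0'.
  by rewrite (_ : i = J)//; apply: val_inj.
have slice_comb v w (a b : R) : slice j.+1 v -> slice j.+1 w -> 0 < a -> 0 < b ->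
    slice j.+1 (a *: v + b *: w).
  move=> [Kv v0'] [Kw w0'] a0 b0; split; first by apply: KD; exact: KZ.
  by move=> i ji; rewrite !mxE v0'// w0'// !mulr0 addr0.
(* If the smaller slice is empty, coordinate [J] does not vanish on the larger one, so by convexity
   it has a constant sign there and is, up to sign, the functional sought. *)
have [[k0 sk0]|nj] := pselect (slice j !=set0); last first.
  have nz v : slice j.+1 v -> v J 0 != 0.
    by move=> sv; apply/eqP => vJ; apply: nj; exists v; exact: sliceW.
  have [eps [e0 he]] : exists eps : R, eps != 0 /\ 0 < eps * v0 J 0.
    have := nz _ sv0; rewrite neq_lt => /orP[h|h].
      by exists (-1); rewrite mulN1r oppr_gt0 oppr_eq0 oner_eq0.
    by exists 1; rewrite mul1r oner_eq0.
  exists (eps *: delta_mx 0 J); split; last first.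
    by exists v0 => //; rewrite pairingZl pairing_delta.
  move=> v sv; rewrite pairingZl pairing_delta leNgt; apply/negP => hv.
  have := @slice_comb v0 v (- (eps * v J 0)) (eps * v0 J 0) sv0 sv.
  rewrite oppr_gt0 => /(_ hv he) /nz.
  by rewrite !mxE; apply/negP; rewrite negbK; apply/eqP; ring.
have [F [F0 [u su Fu]]] := IH (ex_intro _ k0 sk0).
have sliceS v : slice j v -> slice j.+1 v.
  by move=> [Kv v0']; split => // i ji; apply: v0'; exact: ltnW.
have sliceJ v : slice j v -> v J 0 = 0 by move=> [_ h]; exact: h.
have perturb (s : R) : exists2 v, slice j.+1 v & exists2 e : R, 0 < e & v J 0 = s * e.
  have [e e0 Ke] := K_open (s *: delta_mx J 0) sk0.1.
  exists (k0 + e *: (s *: delta_mx J 0)); last first.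
    by exists e => //; rewrite !mxE (sliceJ _ sk0) !eqxx/=; ring.
  split => // i ji; rewrite !mxE (sk0.2 i (ltnW ji)).
  by rewrite (_ : (i == J) = false) ?mulr0 ?addr0//; apply/eqP => iJ; rewrite iJ ltnn in ji.
(* Vectors with positive coordinate [J] bound the new coefficient from below, those with negative
   coordinate from above, and each lower bound is below each upper bound. The supremum of the lower
   bounds is admissible. *)
pose S := [set - pairing F v / v J 0 | v in [set v | slice j.+1 v /\ 0 < v J 0]].
have Sub v : slice j.+1 v -> v J 0 < 0 -> ubound S (pairing F v / - v J 0).
  move=> sv vJ _ [w [sw wJ] <-].
  rewrite ler_pdivrMr// mulrAC ler_pdivlMr ?oppr_gt0//.
  have h := @slice_comb w v (- v J 0) (w J 0) sw sv; rewrite oppr_gt0 in h.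
  have := F0 _ (sliceW _ (h vJ wJ) _).
  rewrite !mxE pairingD !pairingZ => /(_ ltac:(ring)); lra.
have [vm svm [em em0 vmJ]] := perturb (-1).
have [vp svp [ep ep0 vpJ]] := perturb 1.
have hS : has_sup S.
  split; first by exists (- pairing F vp / vp J 0), vp => //; split=> //; lra.
  by exists (pairing F vm / - vm J 0); apply: Sub => //; lra.
exists (F + sup S *: delta_mx 0 J); split; last first.
  exists u; first exact: sliceS.
  by rewrite pairingDl pairingZl pairing_delta (sliceJ _ su) mulr0 addr0.
move=> v sv; rewrite pairingDl pairingZl pairing_delta.
have [vJ|vJ|vJ] := ltgtP (v J 0) 0.
- have := ge_sup hS.1 (Sub v sv vJ).
  by rewrite ler_pdivlMr ?oppr_gt0//; lra.
- have : - pairing F v / v J 0 <= sup S.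
    by apply: (ub_le_sup hS.2); exists v.
  by rewrite ler_pdivrMr//; lra.
- by rewrite vJ mulr0 addr0; apply: F0; exact: sliceW.
Qed.

Lemma open_cone_functional : K !=set0 ->
  exists F : 'rV[R]_d, forall v, K v -> 0 < pairing F v.
Proof.
move=> [v Kv]; have [|F [F0 [w [Kw _] Fw]]] := @slice_functional d.
  by exists v; split=> // i; rewrite leqNgt ltn_ord.
have {}F0 u : K u -> 0 <= pairing F u.
  by move=> Ku; apply: F0; split=> // i; rewrite leqNgt ltn_ord.
(* Strictness: [u] can be moved slightly against [w], where [F] is positive, without leaving [K]. *)
exists F => u Ku; have [e e0 Ke] := K_open (- w) Ku.
have := F0 _ Ke; rewrite pairingD pairingZ pairingN; nra.
Qed.

End Separation.

Section ConeFunctional.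
Variables (R : realType) (d : nat) (f : 'rV[R]_d) (B : R) (Co Cb : set 'cV[R]_d).
Hypothesis cone : convex_cone f B Co Cb.

(** [K] is the open cone generated by [Co] and the direction [- v]. It misses 0 because [v] is not
    interior, and positivity on [K] forces the sign at [v]. For [v] in the boundary this is a
    supporting functional. *)
Lemma cone_functional v : Co !=set0 -> ~ Co v -> exists F : 'rV[R]_d,
  [/\ forall u, Co u -> 0 < pairing F u, forall u, Cb u -> 0 <= pairing F u
    & pairing F v <= 0].
Proof.
move=> [x cx] nv.
pose K := [set u : 'cV[R]_d | exists2 s : R, 0 <= s & Co (u + s *: v)].
have [||||| F hF] := @open_cone_functional _ _ K.
- move=> u w [s s0 cu] [t t0 cw]; exists (s + t); first exact: addr_ge0.
  by rewrite scalerDl addrACA; exact: (coD cone cu cw).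
- move=> k u k0 [s s0 cu]; exists (k * s); first by rewrite mulr_ge0// ltW.
  by rewrite -scalerA -scalerDr; exact: (coZ cone k0 cu).
- move=> u w [s s0 cu]; have [e e0 he] := co_dir cone w cu.
  exists (e / 2); first by rewrite divr_gt0.
  by exists s => //; rewrite addrAC; apply: he; rewrite gtr0_norm ?divr_gt0//; lra.
- move=> [s]; rewrite add0r le_eqVlt => /orP[/eqP<-|s0 cv].
    by rewrite scale0r; exact: (co0 cone).
  by apply: nv; exact: (cobZ cone s0 cv).
- by exists x, 0 => //; rewrite scale0r addr0.
have FCo u : Co u -> 0 < pairing F u.
  by move=> cu; apply: hF; exists 0 => //; rewrite scale0r addr0.
exists F; split => //.
- move=> u cu; rewrite leNgt; apply/negP => Fu.
  have xx := FCo _ cx.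
  have := FCo _ (coDb cone cx (cbZ cone (k := pairing F x / - pairing F u) _ cu)).
  rewrite divr_ge0 ?oppr_ge0 ?ltW// => /(_ isT).
  rewrite pairingD pairingZ (_ : _ + _ = 0) ?ltxx//; field; lra.
- rewrite leNgt; apply/negP => Fv.
  have Fx := FCo _ cx.
  have : K (x - (pairing F x / pairing F v) *: v).
    by exists (pairing F x / pairing F v); rewrite ?subrK ?divr_ge0// ltW.
  by move=> /hF; rewrite pairingB pairingZ divfK ?gt_eqF// subrr ltxx.
Qed.

End ConeFunctional.

Section ExpLemmas.
Variable R : realType.
Implicit Types a b c k l : R.

Lemma expR2_le a b k l : expR (2 * b) = k * l -> expR (2 * a) <= l * k -> a <= b.
Proof. by rewrite mulrC => e; rewrite mulrC [X in _ <= X]mulrC -e ler_expR ler_pM2r. Qed.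

Lemma expR2_le_add a b c k l k' l' : expR (2 * b) = k * l -> expR (2 * c) = k' * l' ->
  expR (2 * a) <= k * k' * (l * l') -> a <= b + c.
Proof. by rewrite mulrACA => <- <-; rewrite -expRD ler_expR; lra. Qed.

End ExpLemmas.

(** * Metric properties and lower bounds *)

Section HilbertMetric.
Variables (R : realType) (d : nat) (Omega : set (projspace R d)) (f : 'rV[R]_d) (B : R).
Hypotheses (oOmega : open Omega) (fOmega : proper_chart Omega f).
Notation Co := (cone_over f Omega).
Notation Cb := (closed_cone Omega f).
Hypothesis cone : convex_cone f B Co Cb.

Lemma co_rep x : Omega x -> exists2 X, represents x X & Co X /\ pairing f X = 1.
Proof.
move=> Ox; have [_ clf _ _] := fOmega; have fx := clf _ (subset_closure Ox).
exists (chart_coord f x); first exact: represents_chart.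
split; last exact: pairing_chart.
by split; [rewrite pairing_chart|exists x => //; exact: represents_chart].
Qed.

(** Apply [F] to [k Y - X] and [G] to [l X - Y], then multiply. This is the source of lower bounds
    on distances, as [hilbert_dist_le] is of upper bounds. *)
Lemma hilbert_functional x y X Y (F G : 'rV[R]_d) : represents x X -> represents y Y ->
  Co X -> Co Y ->
  (forall u, Cb u -> 0 <= pairing F u) -> (forall u, Cb u -> 0 <= pairing G u) ->
  pairing F X * pairing G Y <=
    expR (2 * hilbert_dist Omega x y) * (pairing F Y * pairing G X).
Proof.
move=> rx ry cX cY hF hG.
have [k [l [k0 l0 hk hl ->]]] := hilbert_dist_ex oOmega fOmega cone rx ry cX cY.
have := hF _ hk; have := hG _ hl; rewrite !pairingB !pairingZ => h1 h2.
have -> : k * l * (pairing F Y * pairing G X)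
  = (k * pairing F Y) * (l * pairing G X) by ring.
by apply: ler_pM; [exact/hF/(coW cone)|exact/hG/(coW cone)|lra|lra].
Qed.

Lemma hilbert_sym x y : Omega x -> Omega y -> hilbert_dist Omega x y = hilbert_dist Omega y x.
Proof.
have sym_le u v U V : represents u U -> represents v V -> Co U -> Co V ->
    hilbert_dist Omega u v <= hilbert_dist Omega v u.
  move=> ru rv cU cV.
  have [k [l [k0 l0 hk hl e]]] := hilbert_dist_ex oOmega fOmega cone rv ru cV cU.
  exact: (expR2_le e (hilbert_dist_le oOmega fOmega cone ru rv cU cV l0 k0 hl hk)).
move=> /co_rep[X rx [cX _]] /co_rep[Y ry [cY _]].
apply/eqP; rewrite eq_le; apply/andP; split.
  exact: (sym_le _ _ _ _ rx ry cX cY).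
exact: (sym_le _ _ _ _ ry rx cY cX).
Qed.

Lemma hilbert_triangle x y z : Omega x -> Omega y -> Omega z ->
  hilbert_dist Omega x z <= hilbert_dist Omega x y + hilbert_dist Omega y z.
Proof.
move=> /co_rep[X rx [cX _]] /co_rep[Y ry [cY _]] /co_rep[Z rz [cZ _]].
have [k [l [k0 l0 hk hl e]]] := hilbert_dist_ex oOmega fOmega cone rx ry cX cY.
have [k' [l' [k0' l0' hk' hl' e']]] := hilbert_dist_ex oOmega fOmega cone ry rz cY cZ.
have h : expR (2 * hilbert_dist Omega x z) <= k * k' * (l * l').
  apply: (hilbert_dist_le oOmega fOmega cone rx rz cX cZ).
  - exact: mulr_gt0.
  - exact: mulr_gt0.
  - rewrite (_ : _ - _ = (k *: Y - X) + k *: (k' *: Z - Y)).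
      by apply: (cbD cone) => //; apply: (cbZ cone) => //; exact: ltW.
    by apply/matrixP => i j; rewrite !mxE; ring.
  - rewrite (_ : _ - _ = (l' *: Y - Z) + l' *: (l *: X - Y)).
      by apply: (cbD cone) => //; apply: (cbZ cone) => //; exact: ltW.
    by apply/matrixP => i j; rewrite !mxE; ring.
exact: (expR2_le_add e e' h).
Qed.

End HilbertMetric.

Lemma ln16_ge0 (R : realType) : 0 <= ln (16 : R).
Proof. by rewrite ln_ge0// ler1n. Qed.

(** With [nn2], the constants of the test path. It has two pieces; on each, both order comparisons
    lose a factor 4, which costs [ln 16 / 2]. *)
Definition ln16 (R : realType) : {nonneg R} := NngNum (ln16_ge0 R).
Definition nn2 (R : realType) : {nonneg R} := NngNum (ler0n R 2).

(** For a functional [a x0 + b x1 + x2], the last three hypotheses say that it is nonpositive at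
    [(1, 1, - 2 eta)] and nonnegative at [(1, eps, 0)] and [(delta, 1, delta)]. Its kernel is then
    close to the line [x2 = 0]. *)
Lemma support_coef (R : realFieldType) (a b eps delta eta : R) :
  0 < eta -> 0 < eps < 2^-1 -> 0 < delta < 24^-1 -> delta <= eta ->
  a + b <= 2 * eta -> 0 <= a + eps * b -> 0 <= delta * a + b + delta ->
  `|a| <= 6 * eta /\ `|b| <= 6 * eta.
Proof.
move=> eta0 /andP[eps0 eps1] /andP[delta0 delta1] de O1 O2 O3.
have b1 : b <= 4 * eta.
  have [b0|/ltW b0] := leP b 0; first by lra.
  have h : eps * b <= 2^-1 * b by apply: ler_wpM2r => //; exact: ltW.
  by lra.
have b2 : - (4 * eta) <= b.
  have [b0|/ltW b0] := leP 0 b; first by lra.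
  have q1 : delta * a <= delta * (2 * eta - b) by apply: ler_wpM2l; [exact: ltW|lra].
  have q2 : delta * - b <= 24^-1 * - b by apply: ler_wpM2r; [lra|exact: ltW].
  have q3 : delta * eta <= 24^-1 * eta by apply: ler_wpM2r; exact: ltW.
  by lra.
have eb : `|eps * b| <= 2 * eta.
  rewrite normrM gtr0_norm//.
  have b4 : `|b| <= 4 * eta by rewrite ler_norml b1 b2.
  rewrite (_ : 2 * eta = 2^-1 * (4 * eta)); last by field.
  by apply: ler_pM => //; exact: ltW.
move: eb; rewrite ler_norml => /andP[_ eb].
by split; rewrite ler_norml; apply/andP; split; lra.
Qed.

Lemma quad_bounds (R : realFieldType) (eps delta zeta t t' : R) :
  0 < eps -> 2 * eps <= zeta -> 0 < delta < 24^-1 -> 0 < zeta -> zeta < 1 ->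
  zeta <= t' -> t' <= t -> t <= 1 ->
  [/\ 1 <= t / t', eps * (t / t') <= 2^-1 * t, zeta * (t / t') <= t,
    0 < delta * t <= 24^-1 * t & 0 < delta * t' <= 24^-1 * t'].
Proof.
move=> eps0 ez /andP[d0 d1] z0 z1 h1 h2 h3.
have t'0 : 0 < t' by lra. have t0 : 0 < t by lra.
split.
- by rewrite ler_pdivlMr// mul1r.
- by rewrite mulrA ler_pdivrMr//; nra.
- by rewrite mulrA ler_pdivrMr// mulrC ler_pM2l.
- by rewrite mulr_gt0//= ler_pM2r// ltW.
- by rewrite mulr_gt0//= ler_pM2r// ltW.
Qed.
Lemma le_add_halves (R : realFieldType) (a b c x y l : R) :
  a <= b + c -> b <= x + l / 2 -> c <= y + l / 2 -> a <= (x + y) + l.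
Proof. lra. Qed.

(** [p], [q], [p'], [q'] are values of functionals known up to a factor 2. Multiplying the two
    bounds by [D], which lose factors 16 and 4, produces the square of [a]. *)
Lemma cross_ratio_bound (R : realFieldType) (a b a' b' p q p' q' D : R) :
  0 < a -> 0 < b -> 0 < a' -> 0 < b' ->
  a / 2 <= p -> p <= 2 * a -> b / 2 <= q -> q <= 2 * b ->
  a' / 2 <= p' -> p' <= 2 * a' -> b' / 2 <= q' -> q' <= 2 * b' ->
  p * q' <= D * (p' * q) -> p <= D * p' ->
  a ^+ 2 * b' <= 64 * D ^+ 2 * (a' ^+ 2 * b).
Proof.
move=> a0 b0 a'0 b'0 h1 h2 h3 h4 h5 h6 h7 h8 H1 H2.
have p0 : 0 < p by lra.
have p'0 : 0 < p' by lra.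
have D0 : 0 < D by rewrite -(pmulr_lgt0 _ p'0) (lt_le_trans p0).
have G2 : a <= 4 * (D * a').
  have : D * p' <= D * (2 * a') by rewrite ler_pM2l.
  by lra.
have G1 : a * b' <= 16 * (D * (a' * b)).
  have : (a / 2) * (b' / 2) <= p * q' by apply: ler_pM => //; lra.
  have : D * (p' * q) <= D * ((2 * a') * (2 * b)).
    by rewrite ler_pM2l//; apply: ler_pM => //; lra.
  by lra.
have -> : a ^+ 2 * b' = a * (a * b') by ring.
have -> : 64 * D ^+ 2 * (a' ^+ 2 * b) = (4 * (D * a')) * (16 * (D * (a' * b))) by ring.
by apply: ler_pM => //; rewrite ?mulr_ge0// ltW.
Qed.

(** * Nearly triangular sections *)

Section Triangle.
Variables (R : realType) (d : nat) (Omega : set (projspace R d)) (f : 'rV[R]_d) (B : R).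
Hypotheses (oOmega : open Omega) (fOmega : proper_chart Omega f).
Notation Co := (cone_over f Omega).
Notation Cb := (closed_cone Omega f).
Hypothesis cone : convex_cone f B Co Cb.
Implicit Types (u a b c s t : R).
(** The section resembles the triangle with vertices [e0], [e0 + 2 e2] and [e1]; the points
    [phi 1 t 1] join [e1] to the middle of the opposite side. [eps] and [delta] measure how far the
    known vectors of the cone are from the vertices, and [hout] bounds the section across the side
    [x2 = 0]. [P0], [P1] and the later [P2] are nearly the coordinates. *)
Variables (e0 e1 e2 : 'cV[R]_d) (eps delta eta L k : R) (P0 P1 : 'rV[R]_d).
Let phi (x0 x1 x2 : R) : 'cV[R]_d := x0 *: e0 + x1 *: e1 + x2 *: e2.
Let zeta := expR (- (2 * L)).
Hypotheses (L0 : 0 < L) (eps0 : 0 < eps) (eps_zeta : 2 * eps <= zeta).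
Hypotheses (delta0 : 0 < delta) (delta_eta : delta <= eta) (eta_zeta : 24 * eta <= zeta).
Hypotheses (h10 : Cb (phi 1 eps 0)) (h12 : Cb (phi 1 eps 2)) (hd : Cb (phi delta 1 delta)).
Hypotheses (h111 : Co (phi 1 1 1)) (hout : ~ Co (phi 1 1 (- (2 * eta)))).
Hypotheses (hP0 : forall v, Cb v -> 0 <= pairing P0 v)
  (hP1 : forall v, Cb v -> 0 <= pairing P1 v).
Hypothesis P0E : forall a b c, pairing P0 (phi a b c) = a.
Hypothesis P1E : forall a b c, pairing P1 (phi a b c) = b + k * (a - c).
Hypothesis k_eps : `|k| <= eps.

Let zeta0 : 0 < zeta. Proof. exact: expR_gt0. Qed.
Let zeta1 : zeta < 1. Proof. by rewrite expR_lt1 oppr_lt0 mulr_gt0. Qed.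

Let eta0 : 0 < eta. Proof. exact: lt_le_trans delta0 delta_eta. Qed.
Let eps1 : eps < 2^-1. Proof. by move: eps_zeta zeta1; lra. Qed.
Let eta1 : eta < 24^-1. Proof. by move: eta_zeta zeta1; lra. Qed.
Let delta1 : delta < 24^-1. Proof. by move: delta_eta eta1; lra. Qed.
Let eps_delta : 0 < eps * delta < 48^-1.
Proof.
rewrite mulr_gt0//= (_ : 48^-1 = 2^-1 * 24^-1 :> R); last by field.
by apply: ltr_pM => //; exact: ltW.
Qed.

Let bounds : [/\ 0 < eta, 0 < zeta, zeta < 1, eps < 2^-1 & delta < 24^-1] /\
  [/\ 0 < eps, 2 * eps <= zeta, 0 < delta, delta <= eta & 24 * eta <= zeta].
Proof. by split. Qed.

Let phiB a b c a' b' c' s : s *: phi a b c - phi a' b' c' = phi (s * a - a') (s * b - b') (s * c - c').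
Proof. by apply/matrixP => i j; rewrite !mxE; ring. Qed.

(** A simply described part of the triangle spanned by the three known vectors; [a'], [b'] and [g]
    solve the linear system for the coefficients on them. *)
Let phi_cb a b c : eps * a <= b -> 2 * delta * b <= c -> c + 2 * delta * b <= 2 * a ->
  Cb (phi a b c).
Proof.
move=> h1 h2 h3.
have /andP[ed0 ed1] := eps_delta.
have ed : 0 < 1 - eps * delta by lra.
pose g := (b - eps * a) / (1 - eps * delta).
have g0 : 0 <= g by apply: divr_ge0; lra.
have gE : g * (1 - eps * delta) = b - eps * a by rewrite /g divfK ?gt_eqF.
have h4 : eps * delta * a <= delta * b by rewrite mulrAC mulrC ler_pM2l.
have a0 : 0 <= a by nra.
have ea : 0 <= eps * a by rewrite mulr_ge0// ltW.
have g2b : g <= 2 * b by nra.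
have dg : delta * g <= 2 * delta * b by nra.
pose b' := (c - g * delta) / 2; pose a' := a - g * delta - b'.
rewrite (_ : phi a b c = a' *: phi 1 eps 0 + b' *: phi 1 eps 2 + g *: phi delta 1 delta).
  apply: (cbD cone); last exact: (cbZ cone).
  by apply: (cbD cone); apply: (cbZ cone) => //; rewrite /a' /b'; lra.
have -> : b = eps * a + g * (1 - eps * delta) by rewrite gE; ring.
by apply/matrixP => i j; rewrite !mxE /a' /b'; field.
Qed.

Let phi_co a b c : eps * a < b -> 2 * delta * b < c -> c + 2 * delta * b < 2 * a ->
  Co (phi a b c).
Proof.
move=> h1 h2 h3.
pose s := Num.min (b - eps * a) (Num.min (c - 2 * delta * b) (2 * a - (c + 2 * delta * b))).
have s0 : 0 < s by rewrite /s !lt_min; apply/andP; split; [lra|apply/andP; split; lra].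
have s1 : s <= b - eps * a by rewrite /s ge_min lexx.
have s2 : s <= c - 2 * delta * b by rewrite /s !ge_min lexx orbT.
have s3 : s <= 2 * a - (c + 2 * delta * b) by rewrite /s !ge_min lexx !orbT.
rewrite (_ : phi a b c = s *: phi 1 1 1 + phi (a - s) (b - s) (c - s)); last first.
  by apply/matrixP => i j; rewrite !mxE; ring.
apply: (coDb cone); first exact: (coZ cone).
have es : 0 < eps * s by rewrite mulr_gt0.
have ds : 0 < delta * s by rewrite mulr_gt0.
by apply: phi_cb; lra.
Qed.

(** The third functional separates the cone from the vector of [hout]. Being positive at [phi 1 1 1]
    and not at [phi 1 1 (- (2 * eta))], it is positive on [e2] and can be normalized there. *)
Let P2_ex : exists P2 : 'rV[R]_d, (forall v, Cb v -> 0 <= pairing P2 v) /\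
  exists g0 g1 : R, [/\ forall a b c, pairing P2 (phi a b c) = g0 * a + g1 * b + c,
    `|g0| <= 6 * eta & `|g1| <= 6 * eta].
Proof.
have [[eta_gt0 zeta_gt0 zeta_lt1 eps_lt delta_lt] [eps_gt0 ez_le delta_gt0 de_le etz_le]] := bounds.
have [G [GCo GCb Gout]] := cone_functional cone (ex_intro _ _ h111) hout.
pose g0 := pairing G e0; pose g1 := pairing G e1; pose g2 := pairing G e2.
have GE a b c : pairing G (phi a b c) = g0 * a + g1 * b + g2 * c.
  by rewrite /phi !pairingD !pairingZ -/g0 -/g1 -/g2; ring.
have G2 : 0 < g2.
  have h := GCo _ h111; move: h Gout; rewrite !GE => h h'.
  have : 0 < (1 + 2 * eta) * g2 by lra.
  by rewrite pmulr_rgt0// addr_gt0// mulr_gt0.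
have H1 := GCb _ h10; have H3 := GCb _ hd; rewrite !GE in H1 H3 Gout.
pose a := g0 / g2; pose b := g1 / g2.
have aE : g0 = a * g2 by rewrite /a divfK ?gt_eqF.
have bE : g1 = b * g2 by rewrite /b divfK ?gt_eqF.
have O1 : a + b <= 2 * eta.
  by rewrite -(ler_pM2r G2); move: Gout; rewrite aE bE; lra.
have O2 : 0 <= a + eps * b.
  by rewrite -(pmulr_lge0 _ G2); move: H1; rewrite aE bE; lra.
have O3 : 0 <= delta * a + b + delta.
  by rewrite -(pmulr_lge0 _ G2); move: H3; rewrite aE bE; lra.
have [||a6 b6] := support_coef eta_gt0 _ _ delta_eta O1 O2 O3.
- by rewrite eps0.
- by rewrite delta0.
exists (g2^-1 *: G); split => [v cv|].
  by rewrite pairingZl; apply: mulr_ge0; [rewrite invr_ge0 ltW|exact: GCb].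
exists a, b; split => //.
by move=> x y z; rewrite pairingZl GE aE bE; field; rewrite gt_eqF.
Qed.

Let dist_le x y (a b c a' b' c' s t : R) : represents x (phi a b c) -> represents y (phi a' b' c') ->
  Co (phi a b c) -> Co (phi a' b' c') -> 0 < s -> 0 < t ->
  Cb (phi (s * a' - a) (s * b' - b) (s * c' - c)) ->
  Cb (phi (t * a - a') (t * b - b') (t * c - c')) ->
  expR (2 * hilbert_dist Omega x y) <= s * t.
Proof.
move=> rx ry cx cy s0 t0 hs ht.
by apply: (hilbert_dist_le oOmega fOmega cone rx ry) => //; rewrite phiB.
Qed.

(* The path first runs towards the vertex [e0], then away from it towards the
   ray of the vectors [phi 1 t 1]; along it [ln (c / b ^ 2)] grows at constant
   speed, where [(1, b, c)] are the coordinates. *)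
Let b_ u := if u <= L then expR (- (2 * u)) else zeta.
Let c_ u := if u <= L then expR (- (2 * u)) else expR (2 * u - 4 * L).

Let bc_itv u : 0 <= u <= 2 * L ->
  [/\ zeta <= b_ u <= 1, zeta <= c_ u <= 1, c_ u = expR (2 * u) * b_ u ^+ 2 &
      Co (phi 1 (b_ u) (c_ u))].
Proof.
have [[eta_gt0 zeta_gt0 zeta_lt1 eps_lt delta_lt] [eps_gt0 ez_le delta_gt0 de_le etz_le]] := bounds.
move=> /andP[u0 u2].
have H : [/\ zeta <= b_ u <= 1, zeta <= c_ u <= 1 & c_ u = expR (2 * u) * b_ u ^+ 2].
  rewrite /b_ /c_ /zeta; case: (leP u L) => uL.
    have h : expR (- (2 * L)) <= expR (- (2 * u)) <= 1.
      by rewrite ler_expR expR_le1; apply/andP; split; lra.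
    by split => //; rewrite expr2 -!expRD; congr expR; ring.
  split; first by rewrite lexx ltW.
    by rewrite ler_expR expR_le1; apply/andP; split; lra.
  by rewrite expr2 -!expRD; congr expR; ring.
have [/andP[b1 b2] /andP[c1 c2] e] := H; split; rewrite ?b1 ?b2 ?c1 ?c2//.
move: (b_ u) (c_ u) b1 b2 c1 c2 => b c b1 b2 c1 c2.
have b0 : 0 < b := lt_le_trans zeta_gt0 b1.
have db : 0 < delta * b by apply: mulr_gt0.
have db' : delta * b <= delta by rewrite ler_piMr// ltW.
by apply: phi_co; lra.
Qed.

Let seg1 x y (t t' : R) : zeta <= t' -> t' <= t -> t <= 1 ->
  represents x (phi 1 t t) -> represents y (phi 1 t' t') ->
  Co (phi 1 t t) -> Co (phi 1 t' t') ->
  expR (2 * hilbert_dist Omega x y) <= 16 * (t / t').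
Proof.
have [[eta_gt0 zeta_gt0 zeta_lt1 eps_lt delta_lt] [eps_gt0 ez_le delta_gt0 de_le etz_le]] := bounds.
move=> h1 h2 h3 rx ry cx cy.
have t'0 : 0 < t' by lra.
have [|r1 et zt dt dt'] := @quad_bounds _ eps delta zeta t t' eps0 eps_zeta _ zeta_gt0 zeta_lt1 h1 h2 h3.
  by rewrite delta0.
have -> : 16 * (t / t') = (4 * (t / t')) * 4 by ring.
apply: (dist_le rx ry) => //; first by lra.
  rewrite (_ : 4 * (t / t') * t' - t = 3 * t); last by field; rewrite gt_eqF.
  by apply: phi_cb; lra.
by apply: phi_cb; lra.
Qed.

Let seg2 x y (t t' : R) : zeta <= t' -> t' <= t -> t <= 1 ->
  represents x (phi 1 zeta t) -> represents y (phi 1 zeta t') ->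
  Co (phi 1 zeta t) -> Co (phi 1 zeta t') ->
  expR (2 * hilbert_dist Omega x y) <= 16 * (t / t').
Proof.
have [[eta_gt0 zeta_gt0 zeta_lt1 eps_lt delta_lt] [eps_gt0 ez_le delta_gt0 de_le etz_le]] := bounds.
move=> h1 h2 h3 rx ry cx cy.
have t'0 : 0 < t' by lra.
have [|r1 et zt dt dt'] := @quad_bounds _ eps delta zeta t t' eps0 eps_zeta _ zeta_gt0 zeta_lt1 h1 h2 h3.
  by rewrite delta0.
have dzt : delta * (zeta * (t / t')) <= delta * t by apply: ler_wpM2l => //; exact: ltW.
have dz : 0 < delta * zeta <= delta * t'.
  by rewrite mulr_gt0//= ler_pM2l.
have ez : eps * (t / t') <= zeta * (t / t') by apply: ler_wpM2r; lra.
have zt0 : zeta <= zeta * (t / t') by rewrite ler_pMr.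
have -> : 16 * (t / t') = (4 * (t / t')) * 4 by ring.
apply: (dist_le rx ry) => //; first by lra.
  rewrite (_ : 4 * (t / t') * t' - t = 3 * t); last by field; rewrite gt_eqF.
  apply: phi_cb; try lra.
  rewrite (_ : 4 * (t / t') * 1 - 1 = 4 * (t / t') - 1); last by rewrite mulr1.
  rewrite (_ : 4 * (t / t') * zeta - zeta = (4 * (t / t') - 1) * zeta); last by ring.
  by rewrite mulrC; apply: ler_wpM2l; lra.
by apply: phi_cb; lra.
Qed.

Let P1_itv b c : zeta <= b <= 1 -> zeta <= c <= 1 ->
  b / 2 <= pairing P1 (phi 1 b c) <= 2 * b.
Proof.
have [[eta_gt0 zeta_gt0 zeta_lt1 eps_lt delta_lt] [eps_gt0 ez_le delta_gt0 de_le etz_le]] := bounds.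
move=> /andP[b1 b2] /andP[c1 c2].
have : `|k * (1 - c)| <= eps * 1.
  by rewrite normrM; apply: ler_pM => //; rewrite ger0_norm; lra.
rewrite ler_norml => /andP[h1 h2].
by rewrite P1E; apply/andP; split; lra.
Qed.

Let q p0 u : projspace R d := pt p0 (phi 1 (b_ u) (c_ u)).

Let q_rep p0 u : 0 <= u <= 2 * L -> represents (q p0 u) (phi 1 (b_ u) (c_ u)).
Proof.
move=> hu; have [_ _ _ cu] := bc_itv hu.
by apply: pt_represents; exact: (co_neq0 cone cu).
Qed.

Let q_Omega p0 u : 0 <= u <= 2 * L -> Omega (q p0 u).
Proof.
move=> hu; have [_ _ _ [_ [p Op rp]]] := bc_itv hu.
by rewrite /q (pt_eq _ rp).
Qed.

Let q_le p0 u v : 0 <= u -> u <= v -> v <= 2 * L ->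
  hilbert_dist Omega (q p0 u) (q p0 v) <= (v - u) + ln 16.
Proof.
have same (x y : projspace R d) s t : expR (2 * hilbert_dist Omega x y) <= 16 * (expR s / expR t) ->
    hilbert_dist Omega x y <= (s - t) / 2 + ln 16 / 2.
  have l16E : expR (ln 16) = 16 :> R by rewrite lnK// posrE.
  move=> h; have {h} : expR (2 * hilbert_dist Omega x y) <= expR (ln 16 + (s - t)).
    by rewrite expRD l16E expRB.
  by rewrite ler_expR; lra.
have piece1 u' v' : 0 <= u' -> u' <= v' -> v' <= L ->
    hilbert_dist Omega (q p0 u') (q p0 v') <= (v' - u') + ln 16 / 2.
  move=> h1 h2 h3; have hL := L0.
  have hu' : 0 <= u' <= 2 * L by lra.
  have hv' : 0 <= v' <= 2 * L by lra.
  have ru := q_rep p0 hu'; have rv := q_rep p0 hv'.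
  have [/andP[bu _] _ _ cu] := bc_itv hu'; have [/andP[bv _] _ _ cv] := bc_itv hv'.
  have E w : w <= L -> c_ w = expR (- (2 * w)) /\ b_ w = expR (- (2 * w)).
    by move=> wL; rewrite /c_ /b_ wL.
  have [cuE buE] := E u' ltac:(lra); have [cvE bvE] := E v' h3.
  rewrite cuE buE in bu ru cu; rewrite cvE bvE in bv rv cv.
  have le1 : expR (- (2 * u')) <= 1 by rewrite expR_le1; lra.
  have le2 : expR (- (2 * v')) <= expR (- (2 * u')) by rewrite ler_expR; lra.
  have := same _ _ _ _ (seg1 bv le2 le1 ru rv cu cv).
  by lra.
have piece2 u' v' : L <= u' -> u' <= v' -> v' <= 2 * L ->
    hilbert_dist Omega (q p0 u') (q p0 v') <= (v' - u') + ln 16 / 2.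
  move=> h1 h2 h3; have hL := L0.
  have hu' : 0 <= u' <= 2 * L by lra.
  have hv' : 0 <= v' <= 2 * L by lra.
  have ru := q_rep p0 hu'; have rv := q_rep p0 hv'.
  have [_ /andP[c1u _] _ cu] := bc_itv hu'; have [_ /andP[_ c2v] _ cv] := bc_itv hv'.
  have E w : L <= w -> c_ w = expR (2 * w - 4 * L) /\ b_ w = zeta.
    rewrite le_eqVlt => /orP[/eqP <-|Lw].
      by rewrite /c_ /b_ lexx; split=> //; congr expR; ring.
    by rewrite /c_ /b_ leNgt Lw.
  have [cuE buE] := E u' h1; have [cvE bvE] := E v' ltac:(lra).
  rewrite cuE ?buE in c1u ru cu; rewrite cvE ?bvE in c2v rv cv.
  have le2 : expR (2 * u' - 4 * L) <= expR (2 * v' - 4 * L) by rewrite ler_expR; lra.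
  rewrite (hilbert_sym oOmega fOmega cone (q_Omega p0 hu') (q_Omega p0 hv')).
  have := same _ _ _ _ (seg2 c1u le2 c2v rv ru cv cu).
  by lra.
move=> u0 uv v2; have l16 := ln16_ge0 R.
have [vL|/ltW Lv] := leP v L; first by have := piece1 u v u0 uv vL; lra.
have [Lu|/ltW uL] := leP L u; first by have := piece2 u v Lu uv v2; lra.
have hL := L0.
have hu : 0 <= u <= 2 * L by lra.
have hv : 0 <= v <= 2 * L by lra.
have hLL : 0 <= L <= 2 * L by lra.
rewrite (_ : v - u = (L - u) + (v - L)); last by ring.
apply: (le_add_halves _ (piece1 u L u0 uL (lexx L)) (piece2 L v (lexx L) Lv v2)).
exact: (hilbert_triangle oOmega fOmega cone (q_Omega p0 hu) (q_Omega p0 hLL) (q_Omega p0 hv)).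
Qed.

(** At the middle of the path, [phi 1 zeta zeta], both [P1] and [P2] are at most [2 * zeta], whereas
    at each point [phi 1 t 1] of [ell] one of them is of order 1 at least: [P1] for [t >= 1], [P2]
    for [t <= 1]. So the middle is at distance at least [- ln (4 * zeta) / 2] from [ell]. *)
Lemma triangle_far (p0 : projspace R d) (M : morse_gauge R) (ell : set (projspace R d)) :
  is_morse Omega M ell ->
  (forall p, ell p -> exists t, [/\ 0 < t, represents p (phi 1 t 1) & Co (phi 1 t 1)]) ->
  ell (pt p0 (phi 1 1 1)) -> ell (pt p0 (phi 1 zeta 1)) ->
  1 <= 4 * zeta * expR (2 * (M (nn2 R) (ln16 R))%:num).
Proof.
have [[eta_gt0 zeta_gt0 zeta_lt1 eps_lt delta_lt] [eps_gt0 ez_le delta_gt0 de_le etz_le]] := bounds.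
have hL := L0; have l16 := ln16_ge0 R.
have [P2 [P2_ge0 [g0 [g1 [P2E]]]]] := P2_ex.
rewrite !ler_norml => /andP[g01 g02] /andP[g11 g12].
have P2_itv b c : zeta <= b <= 1 -> zeta <= c <= 1 ->
    c / 2 <= pairing P2 (phi 1 b c) <= 2 * c.
  move=> /andP[b1 b2] /andP[c1 c2].
  have b0 : 0 < b := lt_le_trans zeta_gt0 b1.
  have : `|g1 * b| <= (6 * eta) * 1.
    rewrite normrM (ger0_norm (ltW b0)); apply: ler_pM => //; first exact: ltW.
    by rewrite ler_norml g11 g12.
  rewrite ler_norml => /andP[h1 h2].
  by rewrite P2E; apply/andP; split; lra.
move=> morse hell ell1 ellz.
(* The cross-ratio for [P1], [P2] and that for [P1], [P0] together bound the growth of [c / b ^ 2]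
   by the square of [expR (2 * distance)]; this is why the multiplicative constant is 2. *)
have lower u v : 0 <= u -> u <= v -> v <= 2 * L ->
    2^-1 * (v - u) - ln 16 <= hilbert_dist Omega (q p0 u) (q p0 v).
  move=> u0 uv v2.
  have hu : 0 <= u <= 2 * L by lra.
  have hv : 0 <= v <= 2 * L by lra.
  have ru := q_rep p0 hu; have rv := q_rep p0 hv.
  have [bu cu eu ou] := bc_itv hu; have [bv cv ev ov] := bc_itv hv.
  have H1 := hilbert_functional oOmega fOmega cone ru rv ou ov hP1 P2_ge0.
  have H2 := hilbert_functional oOmega fOmega cone ru rv ou ov hP1 hP0.
  rewrite !P0E !mulr1 in H2.
  have /andP[i1 i2] := P1_itv bu cu; have /andP[i3 i4] := P2_itv _ _ bu cu.
  have /andP[j1 j2] := P1_itv bv cv; have /andP[j3 j4] := P2_itv _ _ bv cv.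
  have pos x : zeta <= x <= 1 -> 0 < x by move=> /andP[h _]; exact: lt_le_trans h.
  have := cross_ratio_bound (pos _ bu) (pos _ cu) (pos _ bv) (pos _ cv) i1 i2 i3 i4 j1 j2 j3 j4 H1 H2.
  rewrite eu ev; have := pos _ bu; have := pos _ bv.
  move: (b_ u) (b_ v) => x y y0 x0.
  rewrite (_ : x ^+ 2 * _ = expR (2 * v) * (x * y) ^+ 2); last by ring.
  rewrite (_ : _ * (y ^+ 2 * _) = 64 * expR (2 * hilbert_dist Omega (q p0 u) (q p0 v)) ^+ 2 * expR (2 * u) * (x * y) ^+ 2); last by ring.
  rewrite ler_pM2r ?exprn_gt0 ?mulr_gt0// => h.
  have : expR (2 * v) <= expR (2 * ln 16 + 4 * hilbert_dist Omega (q p0 u) (q p0 v) + 2 * u).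
    apply: (le_trans h); rewrite !expRD ler_pM2r ?expR_gt0//.
    have E2 z : expR (2 * z) = expR z ^+ 2 :> R by rewrite -expRM_natl.
    have E4 z : expR (4 * z) = expR (2 * z) ^+ 2 :> R by rewrite -E2 mulrA -natrM.
    rewrite E4 (E2 (ln 16)) lnK ?posrE// ler_pM2r ?exprn_gt0 ?expR_gt0//.
    by rewrite -natrX ler_nat.
  rewrite ler_expR; move: l16; move: (hilbert_dist _ _ _) (ln 16) => D l.
  by lra.
have qg : quasi_geodesic Omega 2 (ln 16) 0 (2 * L) (q p0).
  split=> [u|u v]; rewrite !in_itv /=; first exact: q_Omega.
  move=> hu hv; wlog uv : u v hu hv / u <= v.
    move=> hw; have [uv|/ltW vu] := leP u v; first exact: hw.
    rewrite distrC (hilbert_sym oOmega fOmega cone (q_Omega p0 hu) (q_Omega p0 hv)).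
    exact: hw.
  have /andP[u0 u2] := hu; have /andP[v0 v2] := hv.
  rewrite distrC ger0_norm ?subr_ge0// lower//=.
  by have := q_le p0 u0 uv v2; lra.
have q0 : q p0 0 = pt p0 (phi 1 1 1).
  by rewrite /q /b_ /c_ ltW// mulr0 oppr0 expR0.
have q2 : q p0 (2 * L) = pt p0 (phi 1 zeta 1).
  rewrite /q /b_ /c_ leNgt (_ : L < 2 * L) /=; last by lra.
  by rewrite (_ : 2 * (2 * L) - 4 * L = 0) ?expR0//; ring.
have L2 : 0 <= 2 * L by lra.
have n2 : 1 <= (nn2 R)%:num by rewrite /= ler1n.
have ell0 : ell (q p0 0) by rewrite q0.
have ell2 : ell (q p0 (2 * L)) by rewrite q2.
have LL : L \in `[0, 2 * L] by rewrite in_itv /=; apply/andP; split; lra.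
have [p ellp dp] := morse (nn2 R) (ln16 R) _ _ _ n2 L2 qg ell0 ell2 L LL.
have [t [t0 rp ct]] := hell _ ellp.
have hLL : 0 <= L <= 2 * L by lra.
have rz := q_rep p0 hLL; have [_ _ _ oz] := bc_itv hLL.
have bL : b_ L = zeta by rewrite /b_ lexx.
have cL : c_ L = zeta by rewrite /c_ lexx.
rewrite bL cL in rz oz.
have zz : zeta <= zeta <= 1 by rewrite lexx ltW.
have /andP[_ z1] := P1_itv zz zz; have /andP[_ z2] := P2_itv _ _ zz zz.
have D0 := expR_gt0 (2 * hilbert_dist Omega (q p0 L) p).
suff h : 1 <= 4 * zeta * expR (2 * hilbert_dist Omega (q p0 L) p).
  by apply: (le_trans h); rewrite ler_pM2l ?mulr_gt0// ler_expR ler_pM2l.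
have [t1|/ltW t1] := leP t 1.
  have := hilbert_functional oOmega fOmega cone rz rp oz ct hP0 P2_ge0.
  rewrite !P0E !mul1r P2E.
  have : `|g1 * t| <= (6 * eta) * 1.
    rewrite normrM (ger0_norm (ltW t0)); apply: ler_pM => //; first exact: ltW.
    by rewrite ler_norml g11 g12.
  rewrite ler_norml => /andP[h1 h2].
  move: D0 z2; move: (expR _) (pairing P2 _) => D z D0 z2 h.
  have : D * z <= D * (2 * zeta) by rewrite ler_pM2l.
  by lra.
have := hilbert_functional oOmega fOmega cone rz rp oz ct hP0 hP1.
rewrite !P0E !mul1r [in X in X <= _]P1E.
move: D0 z1; move: (expR _) (pairing P1 _) => D z D0 z1 h.
have : D * z <= D * (2 * zeta) by rewrite ler_pM2l.
by lra.
Qed.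

End Triangle.

(** * Projective rays *)

Section Ray.
Variables (R : realType) (d : nat) (Omega : set (projspace R d)) (f : 'rV[R]_d) (B : R).
Hypotheses (oOmega : open Omega) (fOmega : proper_chart Omega f).
Notation Co := (cone_over f Omega).
Notation Cb := (closed_cone Omega f).
Hypothesis cone : convex_cone f B Co Cb.
Implicit Types (s t e : R).

Lemma triangle_far_zeta (e0 e1 e2 : 'cV[R]_d) (eps delta eta zeta k : R) (P0 P1 : 'rV[R]_d)
    (phi := fun x0 x1 x2 : R => x0 *: e0 + x1 *: e1 + x2 *: e2)
    (M : morse_gauge R) (ell : set (projspace R d)) (p q : projspace R d) :
  0 < zeta < 1 -> 0 < eps -> 2 * eps <= zeta -> 0 < delta -> delta <= eta -> 24 * eta <= zeta ->
  Cb (phi 1 eps 0) -> Cb (phi 1 eps 2) -> Cb (phi delta 1 delta) -> Co (phi 1 1 1) ->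
  ~ Co (phi 1 1 (- (2 * eta))) ->
  (forall v, Cb v -> 0 <= pairing P0 v) -> (forall v, Cb v -> 0 <= pairing P1 v) ->
  (forall a b c, pairing P0 (phi a b c) = a) ->
  (forall a b c, pairing P1 (phi a b c) = b + k * (a - c)) ->
  `|k| <= eps -> is_morse Omega M ell ->
  (forall p, ell p -> exists t : R, [/\ 0 < t, represents p (phi 1 t 1) & Co (phi 1 t 1)]) ->
  ell p -> represents p (phi 1 1 1) -> ell q -> represents q (phi 1 zeta 1) ->
  1 <= 4 * zeta * expR (2 * (M (nn2 R) (ln16 R))%:num).
Proof.
move=> /andP[z0 z1] eps0 ez d0 de ez' h10 h12 hd h111 hout hP0 hP1 P0E P1E ke morse hell lp rp lq rq.
have zE : expR (- (2 * (- ln zeta / 2))) = zeta.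
  by rewrite mulrC divfK ?pnatr_eq0// opprK lnK// posrE.
have L0 : 0 < - ln zeta / 2 by rewrite divr_gt0// oppr_gt0 ln_lt0// z0.
rewrite -zE in ez ez' rq *.
apply: (@triangle_far _ _ Omega f B oOmega fOmega cone e0 e1 e2 eps delta eta
  (- ln zeta / 2) k P0 P1 L0 eps0 ez d0 de ez' h10 h12 hd h111 hout hP0 hP1 P0E P1E ke p M ell) => //.
  by rewrite (pt_eq p rp).
by rewrite (pt_eq p rq).
Qed.

Variables (x y : projspace R d) (X Y : 'cV[R]_d) (F : 'rV[R]_d).
Hypotheses (rX : represents x X) (rY : represents y Y).
Hypotheses (cX : Co X) (fX : pairing f X = 1) (cY : Cb Y) (nY : ~ Co Y) (fY : pairing f Y = 1).
Hypotheses (F_ge0 : forall v, Cb v -> 0 <= pairing F v) (FY : pairing F Y = 0)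
  (FX : pairing F X = 1).

Let ray t : 'cV[R]_d := Y + t *: (X - Y).

Lemma rayE t : ray t = (1 - t) *: Y + t *: X.
Proof. by apply/matrixP => i j; rewrite !mxE; ring. Qed.

Lemma ray_co t : 0 < t <= 1 -> Co (ray t).
Proof.
move=> /andP[t0 t1]; rewrite rayE; apply: (cobD cone); last exact: (coZ cone).
by apply: (cbZ cone) => //; rewrite subr_ge0.
Qed.

Lemma f_ray t : pairing f (ray t) = 1.
Proof. by rewrite rayE !pairingE fX fY; ring. Qed.

Lemma F_ray t : pairing F (ray t) = t.
Proof. by rewrite rayE !pairingE FX FY; ring. Qed.

(** The segment is given in an arbitrary chart [g], so the parameter changes by a projective map.
    Its coefficient [r] is positive by [proper_chart_sign], which preserves the half-open
    interval. *)
Lemma segment_ray p : segment_co Omega x y p -> exists t, 0 < t <= 1 /\ represents p (ray t).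
Proof.
move=> [g [t [hg gp /andP[t0 t1] e]]].
have kX := cone_overW cX.
have kY : cone_over f (closure Omega) Y.
  by case: cY => // Y0; move: fY; rewrite Y0 pairing0 => /esym/eqP; rewrite oner_eq0.
have sXY := proper_chart_sign cone hg kX kY.
have gX : pairing g X != 0 by apply: contraTneq sXY => ->; rewrite mul0r ltxx.
have gY : pairing g Y != 0 by apply: contraTneq sXY => ->; rewrite mulr0 ltxx.
pose r := pairing g X / pairing g Y.
have r0 : 0 < r.
  rewrite /r (_ : _ / _ = (pairing g X * pairing g Y) / pairing g Y ^+ 2); last by field.
  by rewrite divr_gt0// exprn_even_gt0.
pose s := (1 - t) + t * r.
have tr : 0 <= t * r by rewrite mulr_ge0// ltW.
have s0 : 0 < s by rewrite /s; lra.
exists ((1 - t) / s); split.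
  rewrite divr_gt0 ?subr_gt0//= ler_pdivrMr// mul1r /s; lra.
rewrite (_ : ray _ = (pairing g X / s) *: chart_coord g p).
  by apply: represents_scale; [rewrite mulf_neq0// invr_eq0 gt_eqF|exact: represents_chart].
rewrite e (chart_coordE rX)// (chart_coordE rY)// rayE addrC scalerDr !scalerA.
congr (_ *: _ + _ *: _); first by field; rewrite gX gt_eqF.
by rewrite (_ : 1 - (1 - t) / s = t * r / s); [rewrite /r; field; rewrite gY gt_eqF|rewrite /s; field; rewrite -/s gt_eqF].
Qed.

Variables (c : R -> projspace R d) (tau : R -> R).
Hypothesis c_geo : geodesic_ray Omega c.
Hypothesis tau_itv : forall t, 0 <= t -> 0 < tau t <= 1.
Hypothesis c_rep : forall t, 0 <= t -> represents (c t) (ray (tau t)).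

(** Along the ray [F] reads off the parameter and [f] is 1, so their cross-ratio is
    [tau s / tau t]. *)
Lemma tau_le s t : 0 <= s -> 0 <= t -> tau s <= expR (2 * `|s - t|) * tau t.
Proof.
move=> s0 t0; rewrite -(c_geo.2 s t s0 t0).
have fge v : Cb v -> 0 <= pairing f v by exact: cb_ge0 cone _.
have := hilbert_functional oOmega fOmega cone (c_rep s0) (c_rep t0)
  (ray_co (tau_itv s0)) (ray_co (tau_itv t0)) F_ge0 fge.
by rewrite !F_ray !f_ray !mulr1.
Qed.

(** The constant [tau s / tau t] is the one for which the difference is a multiple of [Y]. The other
    constant, [l], depends on the far end of the chord, beyond [X], and is estimated in two ways
    below. *)
Lemma tau_ge s t (l : R) : 0 <= s -> 0 <= t -> tau t <= tau s -> 0 < l ->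
  Cb (l *: ray (tau s) - ray (tau t)) -> expR (2 * `|s - t|) <= tau s / tau t * l.
Proof.
move=> s0 t0 ts l0 h; rewrite -(c_geo.2 s t s0 t0).
have /andP[ps _] := tau_itv s0; have /andP[pt _] := tau_itv t0.
apply: (hilbert_dist_le oOmega fOmega cone (c_rep s0) (c_rep t0)
  (ray_co (tau_itv s0)) (ray_co (tau_itv t0))) => //; first by rewrite divr_gt0.
rewrite (_ : _ - _ = (tau s / tau t - 1) *: Y).
  by apply: (cbZ cone) => //; rewrite subr_ge0 ler_pdivlMr// mul1r.
by apply/matrixP => i j; rewrite !mxE; field; rewrite gt_eqF.
Qed.

(** Here [l] tends to 1 as [tau s] tends to 0; hence the explicit factor 2 in [T_upper]. *)
Lemma tau_ge_sharp s t : 0 <= s -> 0 <= t -> tau t <= tau s -> tau s < 1 ->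
  expR (2 * `|s - t|) <= tau s / tau t * (1 - tau s)^-1.
Proof.
move=> s0 t0 ts s1; have q : 0 < 1 - tau s by rewrite subr_gt0.
have /andP[ps _] := tau_itv s0; have /andP[pt _] := tau_itv t0.
apply: tau_ge => //; first by rewrite invr_gt0.
rewrite (_ : _ - _ = ((1 - tau s)^-1 * tau s - tau t) *: X + tau t *: Y).
  apply: (cbD cone); apply: (cbZ cone) => //; [|exact: (coW cone)|exact: ltW].
  rewrite subr_ge0 (le_trans ts)// mulrC ler_pdivlMr//; nra.
by apply/matrixP => i j; rewrite !mxE; field; rewrite gt_eqF.
Qed.

(** A uniform [l] exists because [X - r Y] still lies in the cone for some [r > 0]; this includes
    [tau s = 1]. *)
Lemma tau_ge_coarse : exists2 C : R, 0 < C & forall s t, 0 <= s -> 0 <= t -> tau t <= tau s ->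
  expR (2 * `|s - t|) <= tau s / tau t * C.
Proof.
have [e e0 he] := co_dir cone (- Y) cX.
pose r := Num.min e 1 / 2.
have m0 : 0 < Num.min e 1 by rewrite lt_min e0 ltr01.
have [r0 re r1] : [/\ 0 < r, r < e & r < 1].
  have m1 : Num.min e 1 <= e by rewrite ge_min lexx.
  have m2 : Num.min e 1 <= 1 by rewrite ge_min lexx orbT.
  by rewrite /r; split; lra.
have hr : Cb (X - r *: Y) by rewrite -scalerN; apply: (coW cone); apply: he; rewrite gtr0_norm.
exists r^-1 => [|s t s0 t0 ts]; first by rewrite invr_gt0.
have /andP[ps s1] := tau_itv s0; have /andP[pt t1] := tau_itv t0.
apply: tau_ge => //; first by rewrite invr_gt0.
have h1 : 0 <= r^-1 * tau s - tau t.
  rewrite subr_ge0 mulrC ler_pdivlMr//; nra.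
have h2 : 0 <= (1 - tau s) * (r^-1 - 1) + tau t * (1 - r).
  apply: addr_ge0; apply: mulr_ge0; rewrite ?subr_ge0 ?(ltW r1)//; last exact: ltW.
  by rewrite invf_ge1// ltW.
rewrite (_ : _ - _ = (r^-1 * tau s - tau t) *: (X - r *: Y)
   + ((1 - tau s) * (r^-1 - 1) + tau t * (1 - r)) *: Y).
  by apply: (cbD cone); apply: (cbZ cone).
by apply/matrixP => i j; rewrite !mxE; field; rewrite gt_eqF.
Qed.

Lemma tau_decay : exists C t0 : R, [/\ 0 < C, 0 <= t0 &
  forall t, t0 <= t -> tau t <= C * expR (- (2 * t))].
Proof.
have [C C0 hC] := tau_ge_coarse.
have /andP[p0 p1] := tau_itv (lexx 0).
have q0 : 0 < C / tau 0 by rewrite divr_gt0.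
exists C, (1 + C / tau 0); split=> //; first by rewrite addr_ge0// ltW.
move=> t ht; have t0 : 0 <= t by apply: le_trans ht; rewrite addr_ge0// ltW.
have /andP[pt t1] := tau_itv t0.
have nt : `|0 - t| = t by rewrite sub0r normrN ger0_norm.
(* Monotonicity of [tau] has not been established. In the second case the coarse estimate with the
   two times exchanged bounds [expR (2 * t)], against the choice of the initial time. *)
have [h|/ltW h] := leP (tau t) (tau 0).
  have := hC _ _ (lexx 0) t0 h; rewrite nt => h'.
  rewrite expRN ler_pdivlMr ?expR_gt0//.
  rewrite mulrAC ler_pdivlMr// in h'; rewrite mulrC (le_trans h')//.
  by rewrite ler_piMl// ltW.
have := hC _ _ t0 (lexx 0) h; rewrite subr0 ger0_norm// => h'.
have : expR (2 * t) <= C / tau 0.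
  by apply: (le_trans h'); rewrite mulrAC ler_pM2r ?invr_gt0// ler_piMl// ltW.
have := expR_ge1Dx (2 * t); lra.
Qed.

Let T (n : nat) := tau n%:R.

Lemma T_itv n : 0 < T n <= 1.
Proof. exact/tau_itv/ler0n. Qed.

Lemma T_lower n m : expR (- (2 * m%:R)) * T n <= T (n + m)%N.
Proof.
have := tau_le (ler0n R n) (ler0n R (n + m)).
rewrite natrD opprD addNKr normrN ger0_norm ?ler0n// expRN => h.
by rewrite mulrC ler_pdivrMr ?expR_gt0// mulrC /T natrD.
Qed.

Lemma T_small e : 0 < e -> exists n0 : nat, forall n, (n0 <= n)%N -> T n < e.
Proof.
move=> e0; have [C [t0 [C0 t00 hC]]] := tau_decay.
pose n0 := (Num.truncn (Num.max t0 (C / e))).+1.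
have hn0 : Num.max t0 (C / e) < n0%:R by exact: truncnS_gt.
exists n0 => n hn; have {}hn0 : Num.max t0 (C / e) < n%:R.
  by apply: (lt_le_trans hn0); rewrite ler_nat.
move: hn0; rewrite gt_max => /andP[h1 h2].
apply: (le_lt_trans (hC _ (ltW h1))).
rewrite expRN ltr_pdivrMr ?expR_gt0//.
rewrite ltr_pdivrMr// in h2; apply: (lt_le_trans h2); rewrite mulrC ler_pM2l//.
by have := expR_ge1Dx (2 * n%:R : R); have := ler0n R n; lra.
Qed.

Lemma T_upper : exists n0 : nat, forall n m, (n0 <= n)%N ->
  T (n + m)%N <= 2 * expR (- (2 * m%:R)) * T n.
Proof.
have [n0 hn0] := T_small (e := 2^-1) ltac:(by rewrite invr_gt0).
exists n0 => n m hn; have /andP[pn _] := T_itv n.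
have [n1 hn1] := T_small pn.
(* Both [T n] and [T (n + m)] are compared with a later [T k], for which [T k < T n] is certain; the
   extra [n1] steps cancel. *)
pose k := (n + m + n1)%N.
have Tk : T k < T n by apply: hn1; rewrite leq_addl.
have /andP[pk _] := T_itv k.
have nk : `|n%:R - k%:R| = m%:R + n1%:R :> R.
  by rewrite /k -addnA natrD opprD addNKr normrN ger0_norm ?ler0n// natrD.
have nmk : `|(n + m)%:R - k%:R| = n1%:R :> R.
  by rewrite /k (natrD _ (n + m)) opprD addNKr normrN ger0_norm ?ler0n.
have h2 := hn0 n hn.
have := tau_ge_sharp (ler0n R n) (ler0n R k) (ltW Tk) ltac:(rewrite -/(T n); lra).
rewrite nk -/(T n) -/(T k) => h.
have := tau_le (ler0n R (n + m)) (ler0n R k); rewrite nmk -/(T (n + m)) -/(T k) => h'.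
apply: (le_trans h').
have {}h : expR (2 * (m%:R + n1%:R)) * T k <= 2 * T n.
  have : T n / T k * (1 - T n)^-1 <= T n / T k * 2.
    by rewrite ler_pM2l ?divr_gt0// invf_ple ?posrE//; lra.
  move=> /(le_trans h); rewrite mulrAC ler_pdivlMr//; lra.
rewrite expRN mulrAC ler_pdivlMr ?expR_gt0//.
by apply: le_trans h; rewrite mulrDr expRD; lra.
Qed.

End Ray.

(** * Contraction along a Morse ray *)

Section Contraction.
Variables (R : realType) (d : nat) (Omega : set (projspace R d)) (f : 'rV[R]_d) (B : R).
Hypotheses (oOmega : open Omega) (fOmega : proper_chart Omega f).
Notation Co := (cone_over f Omega).
Notation Cb := (closed_cone Omega f).
Hypothesis cone : convex_cone f B Co Cb.
Variables (X Y : 'cV[R]_d) (F : 'rV[R]_d).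
Hypotheses (cX : Co X) (fX : pairing f X = 1) (cY : Cb Y) (fY : pairing f Y = 1).
Hypotheses (F_ge0 : forall v, Cb v -> 0 <= pairing F v) (FY : pairing F Y = 0)
  (FX : pairing F X = 1).
Let ray t : 'cV[R]_d := Y + t *: (X - Y).
Variables (M : morse_gauge R) (ell : set (projspace R d)) (p : nat -> projspace R d)
  (T : nat -> R).
Hypothesis morse : is_morse Omega M ell.
Hypothesis ell_ray : forall q, ell q -> exists t : R, 0 < t <= 1 /\ represents q (ray t).
Hypothesis ell_p : forall n, ell (p n).
Hypothesis p_rep : forall n, represents (p n) (ray (T n)).
Hypothesis T_itv : forall n, 0 < T n <= 1.
Hypothesis T_lower : forall n m, expR (- (2 * m%:R)) * T n <= T (n + m)%N.
Hypothesis T_upper : exists n0, forall n m, (n0 <= n)%N ->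
  T (n + m)%N <= 2 * expR (- (2 * m%:R)) * T n.
Hypothesis T_small : forall e : R, 0 < e -> exists n0 : nat, forall n, (n0 <= n)%N -> T n < e.

Variable N : nat.
(** The ratio [zeta] of the parameters [N] steps apart will lie between [a] and [2 * a]. So [eta] is
    the largest value that ensures [24 * eta <= zeta], and [N_large] negates the conclusion of
    [triangle_far] at [zeta = 2 * a]. *)
Let a : R := expR (- (2 * N%:R)).
Let eta := a / 24.
Hypothesis N_large : 8 * a * expR (2 * (M (nn2 R) (ln16 R))%:num) < 1.

Let a_bounds : 0 < a < 8^-1.
Proof.
have a0 : 0 < a by exact: expR_gt0.
rewrite a0 /=; have h : 1 <= expR (2 * (M (nn2 R) (ln16 R))%:num).
  by rewrite -[X in X <= _]expR0 ler_expR mulr_ge0.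
have : 8 * a * 1 <= 8 * a * expR (2 * (M (nn2 R) (ln16 R))%:num).
  by apply: ler_wpM2l => //; rewrite mulr_ge0// ltW.
by have := N_large; lra.
Qed.

Let ray_Co t : 0 < t <= 1 -> Co (ray t). Proof. exact: (ray_co cone). Qed.
Let F_rayE t : pairing F (ray t) = t. Proof. exact: F_ray. Qed.

Let absurd_zeta zeta : zeta <= 2 * a ->
  1 <= 4 * zeta * expR (2 * (M (nn2 R) (ln16 R))%:num) -> False.
Proof.
move=> za; move: N_large; set D := expR _ => hN h.
have D0 : 0 < D by exact: expR_gt0.
have : zeta * D <= 2 * a * D by rewrite ler_pM2r.
by lra.
Qed.

Let eventually_T : exists n1 : nat, forall n, (n1 <= n)%N ->
  T n <= eta /\ forall m, T (n + m)%N <= 2 * expR (- (2 * m%:R)) * T n.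
Proof.
have eta0 : 0 < eta by rewrite divr_gt0//; case/andP: a_bounds.
have [n0 h0] := T_small eta0; have [n1 h1] := T_upper.
exists (maxn n0 n1) => n; rewrite geq_max => /andP[hn0 hn1]; split; last first.
  by move=> m; exact: h1.
exact/ltW/h0.
Qed.

Let half_step n : (forall m, T (n + m)%N <= 2 * expR (- (2 * m%:R)) * T n) ->
  2 * T n.+1 <= T n.
Proof.
move=> /(_ 1%N); rewrite addn1 mulr1 => h; have /andP[Tn _] := T_itv n.
have e2 : 4 <= expR 2 :> R.
  have := expR_ge1Dx (1 : R); rewrite (_ : 2 = 1 + 1 :> R)// expRD => h1.
  by rewrite (_ : 4 = 2 * 2 :> R); [apply: ler_pM|rewrite -natrM].
have : expR (- 2) * T n <= 4^-1 * T n.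
  by rewrite ler_pM2r// expRN lef_pV2 ?posrE ?expR_gt0.
by lra.
Qed.

(** A violating [u] gives a triangle with vertices near [Y + u], [Y - u] and the direction [X - Y].
    The vectors on the side opposite to the last one are taken at step [n + N + 1], and the segment
    of the ray runs from step [n] to step [n + N]. *)
Lemma width_step : exists n1 : nat, forall n (r : R), (n1 <= n)%N ->
  (forall u, pairing f u = 0 -> Cb (ray (T n) + u) -> Cb (ray (T n) - u) -> `|u| <= r) ->
  (forall u, pairing f u = 0 -> Cb (ray (T (n + N).+1) + u) -> Cb (ray (T (n + N).+1) - u) ->
    `|u| <= r / (1 + 2 * eta)).
Proof.
have [n1 hn1] := eventually_T; exists n1 => n r hn hr u fu cu1 cu2.
have [Teta Tup] := hn1 n hn.
have [_ /half_step Thalf] := hn1 _ (leq_trans hn (leq_addr N n)).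
have /andP[a0 a1] := a_bounds.
have eta0 : 0 < eta by rewrite divr_gt0.
rewrite leNgt; apply/negP => ltu.
have q0 : 0 < 1 + 2 * eta by lra.
have {}ltu : r < `|(1 + 2 * eta) *: u|.
  by rewrite normrZ gtr0_norm// mulrC -ltr_pdivrMr.
(* Since the enlarged vector exceeds the width [r], one of its two signs leaves the cone at
   [ray (T n)]. *)
wlog nc : u fu cu1 cu2 ltu / ~ Cb (ray (T n) + (1 + 2 * eta) *: u).
  move=> hw; have [h1|h1] := pselect (Cb (ray (T n) + (1 + 2 * eta) *: u)); last exact: (hw u).
  have [h2|h2] := pselect (Cb (ray (T n) - (1 + 2 * eta) *: u)).
    have := hr ((1 + 2 * eta) *: u); rewrite pairingZ fu mulr0 => /(_ erefl h1 h2).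
    by rewrite leNgt ltu.
  apply: (hw (- u)); rewrite ?opprK ?scalerN ?normrN//.
  by rewrite pairingN fu oppr0.
have /andP[Tn0 Tn1] := T_itv n.
have /andP[TN0 TN1] := T_itv (n + N)%N; have /andP[TS0 TS1] := T_itv (n + N).+1.
pose zeta := T (n + N)%N / T n; pose eps := T (n + N).+1 / T n.
have z1 : a <= zeta by rewrite ler_pdivlMr// T_lower.
have z2 : zeta <= 2 * a by rewrite ler_pdivrMr// Tup.
have e0 : 0 < eps by rewrite divr_gt0.
have ez : 2 * eps <= zeta by rewrite mulrA ler_pM2r ?invr_gt0.
have zT : zeta * T n = T (n + N)%N by rewrite divfK ?gt_eqF.
have eT : eps * T n = T (n + N).+1 by rewrite divfK ?gt_eqF.
have fw : pairing f (X - Y) = 0 by rewrite pairingB fX fY subrr.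
have Fw : pairing F (X - Y) = 1 by rewrite pairingB FX FY subr0.
have Fu : `|pairing F u| <= T (n + N).+1.
  have h1 := F_ge0 cu1; have h2 := F_ge0 cu2.
  rewrite pairingD F_rayE in h1; rewrite pairingB F_rayE in h2.
  by rewrite ler_norml; apply/andP; split; lra.
have phi1 t : 1 *: (Y + u) + t *: (T n *: (X - Y)) + 1 *: (- u) = ray (t * T n).
  by apply/matrixP => i j; rewrite !mxE; ring.
apply: (absurd_zeta z2).
apply: (@triangle_far_zeta _ _ Omega f B oOmega fOmega cone (Y + u) (T n *: (X - Y)) (- u)
  eps (T n) eta zeta (pairing F u / T n) f ((T n)^-1 *: F) M ell (p n) (p (n + N)%N)) => //.
- by apply/andP; split; lra.
- by rewrite /eta; lra.
- rewrite (_ : _ + _ + _ = ray (T (n + N).+1) + u)// -eT.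
  by apply/matrixP => i j; rewrite !mxE; ring.
- rewrite (_ : _ + _ + _ = ray (T (n + N).+1) - u)// -eT.
  by apply/matrixP => i j; rewrite !mxE; ring.
- rewrite (_ : _ + _ + _ = T n *: X); first by apply/(cbZ cone)/(coW cone) => //; exact: ltW.
  by apply/matrixP => i j; rewrite !mxE; ring.
- by rewrite phi1 mul1r; exact: ray_Co.
- move=> h; apply: nc; apply: (coW cone).
  rewrite (_ : ray _ + _ = 1 *: (Y + u) + 1 *: (T n *: (X - Y)) + (- (2 * eta)) *: - u)//.
  by apply/matrixP => i j; rewrite !mxE; ring.
- by move=> v cv; exact: cb_ge0 cone _ cv.
- by move=> v cv; rewrite pairingZl mulr_ge0 ?invr_ge0 ?F_ge0// ltW.
- by move=> b1 b2 b3; rewrite !pairingE fu fX fY; ring.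
- move=> b1 b2 b3; rewrite pairingZl !pairingE FY FX; field; rewrite gt_eqF//.
- by rewrite normrM normfV (gtr0_norm Tn0) ler_pM2r ?invr_gt0.
- move=> q /ell_ray[t [t0 rq]]; exists (t / T n); rewrite phi1 divfK ?gt_eqF//.
  by split=> //; [case/andP: t0 => t0 _; rewrite divr_gt0|exact: ray_Co].
- by rewrite phi1 mul1r.
- by rewrite phi1 zT.
Qed.

(** The triangle is read from the other end: the vertex on the line of the ray is [Y], and the
    opposite side passes through [ray (T n)]. Therefore [phi 1 t 1] has ray parameter inversely
    proportional to [t], the segment runs from step [n + N + 1] back to step [n + 1], and [F], [f]
    exchange their roles. *)
Lemma tangent_step : exists n1 : nat, forall n (s : R), (n1 <= n)%N ->
  (forall u, pairing f u = 0 -> pairing F u = 0 -> `|u| <= s * T n -> Cb (ray (T n) + u)) ->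
  (forall u, pairing f u = 0 -> pairing F u = 0 ->
    `|u| <= (1 + 2 * eta) * s * T (n + N).+1 -> Cb (ray (T (n + N).+1) + u)).
Proof.
have [n1 hn1] := eventually_T; exists n1 => n s hn hs v fv Fv hv.
have [Teta Tup] := hn1 n hn.
have Thalf := half_step Tup.
have [TSeta TSup] := hn1 _ (leqW hn).
have /andP[a0 a1] := a_bounds.
have eta0 : 0 < eta by rewrite divr_gt0.
apply: contrapT => nc.
have q0 : 0 < 1 + 2 * eta by lra.
have /andP[Tn0 Tn1] := T_itv n.
have /andP[TN0 TN1] := T_itv n.+1; have /andP[TS0 TS1] := T_itv (n + N).+1.
pose zeta := T (n + N).+1 / T n.+1; pose eps := T (n + N).+1 / T n.
have z1 : a <= zeta by rewrite ler_pdivlMr// -addSn T_lower.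
have z2 : zeta <= 2 * a by rewrite ler_pdivrMr// -addSn TSup.
have e0 : 0 < eps by rewrite divr_gt0.
have eT : eps * T n = T (n + N).+1 by rewrite divfK ?gt_eqF.
have zT : zeta * T n.+1 = T (n + N).+1 by rewrite divfK ?gt_eqF.
have ez : 2 * eps <= zeta.
  rewrite -(ler_pM2r Tn0) -mulrA eT -zT mulrCA ler_pM2l//.
  by rewrite (lt_le_trans _ z1).
(* [v] is carried along the lines through [Y] to the height of [ray (T n)] and freed of the factor
   [1 + 2 * eta], so that [hs] applies to it. *)
pose u := ((1 + 2 * eta) * eps)^-1 *: v.
have qe0 : 0 < (1 + 2 * eta) * eps by rewrite mulr_gt0.
have uv : v = ((1 + 2 * eta) * eps) *: u by rewrite scalerA mulfV ?scale1r// gt_eqF.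
have fu : pairing f u = 0 by rewrite pairingZ fv mulr0.
have Fu : pairing F u = 0 by rewrite pairingZ Fv mulr0.
have nv : `|v| = (1 + 2 * eta) * eps * `|u| by rewrite [in LHS]uv normrZ gtr0_norm.
have nu : `|u| <= s * T n.
  rewrite -(ler_pM2l qe0) (_ : _ * (s * T n) = (1 + 2 * eta) * s * (eps * T n)); last by ring.
  by rewrite eT -nv.
clearbody u eps zeta.
have cu1 := hs _ fu Fu nu.
have cu2 : Cb (ray (T n) - u).
  by apply: hs; rewrite ?pairingN ?fu ?Fu ?oppr0 ?normrN.
have fw : pairing f (X - Y) = 0 by rewrite pairingB fX fY subrr.
have Fw : pairing F (X - Y) = 1 by rewrite pairingB FX FY subr0.
have phi1 t : 0 < t -> 1 *: (T n *: (X - Y) + u) + t *: (eps^-1 *: Y) + 1 *: (- u) =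
    (t / eps) *: ray (eps * T n / t).
  by move=> t0; apply/matrixP => i j; rewrite !mxE; field; rewrite !gt_eqF.
have dE : eta * (T n * eps) <= 1.
  rewrite (mulrC (T n)) eT; have : eta * T (n + N).+1 <= eta * 1 by rewrite ler_pM2l.
  by rewrite /eta; lra.
apply: (absurd_zeta z2).
apply: (@triangle_far_zeta _ _ Omega f B oOmega fOmega cone
  (T n *: (X - Y) + u) (eps^-1 *: Y) (- u)
  eps eta eta zeta 0 ((T n)^-1 *: F) (eps *: f) M ell (p (n + N).+1) (p n.+1)) => //.
- by apply/andP; split; lra.
- by rewrite /eta; lra.
- rewrite (_ : _ + _ + _ = ray (T n) + u)//.
  by apply/matrixP => i j; rewrite !mxE; field; rewrite gt_eqF.
- rewrite (_ : _ + _ + _ = ray (T n) - u)//.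
  by apply/matrixP => i j; rewrite !mxE; field; rewrite gt_eqF.
- rewrite (_ : _ + _ + _ = eps^-1 *: ray (eta * (T n * eps))).
    apply: (cbZ cone); first by rewrite invr_ge0 ltW.
    by apply: (coW cone); apply: ray_Co; rewrite !mulr_gt0.
  by apply/matrixP => i j; rewrite !mxE; field; rewrite gt_eqF.
- rewrite phi1// divr1; apply: (coZ cone); first by rewrite divr_gt0.
  by apply: ray_Co; rewrite eT TS0.
- move=> h; apply: nc; apply: (coW cone).
  have := coZ cone e0 h; rewrite uv -eT.
  rewrite (_ : eps *: _ = ray (eps * T n) + ((1 + 2 * eta) * eps) *: u)//.
  by apply/matrixP => i j; rewrite !mxE; field; rewrite gt_eqF.
- by move=> w cw; rewrite pairingZl mulr_ge0 ?invr_ge0 ?F_ge0// ltW.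
- by move=> w cw; rewrite pairingZl mulr_ge0 ?(ltW e0)//; exact: cb_ge0 cone _ cw.
- by move=> b1 b2 b3; rewrite pairingZl !pairingE Fu FX FY; field; rewrite !gt_eqF.
- by move=> b1 b2 b3; rewrite pairingZl !pairingE fu fX fY; field; rewrite ?gt_eqF.
- by rewrite normr0 ltW.
- move=> q /ell_ray[t [/andP[t0 t1] rq]]; exists (eps * T n / t).
  have k0 : 0 < eps * T n / t by rewrite divr_gt0// mulr_gt0.
  rewrite phi1// (_ : eps * T n / (eps * T n / t) = t); last by field; rewrite !gt_eqF.
  split => //; first by apply: represents_scale => //; rewrite gt_eqF// divr_gt0.
  by apply: (coZ cone); [rewrite divr_gt0|apply: ray_Co; rewrite t0].
- rewrite phi1// divr1 eT; apply: represents_scale => //.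
  by rewrite gt_eqF// divr_gt0.
- have z0 : 0 < zeta := lt_le_trans a0 z1.
  rewrite phi1// eT -[X in ray (X / _)]zT mulrAC divff ?mul1r ?gt_eqF//.
  by apply: represents_scale => //; rewrite gt_eqF// divr_gt0.
Qed.

End Contraction.

(** * The spectral theorem *)

Section Spectral.
Variable R : realType.

(** Over the complex numbers the matrix is hermitian and its eigenvalues are real. Such an
    eigenvalue is a root of the real characteristic polynomial, hence has a real eigenvector. *)
Lemma symmetric_eigenvector n (M : 'M[R]_n.+1) : M^T = M ->
  exists lam (v : 'rV[R]_n.+1), v != 0 /\ v *m M = lam *: v.
Proof.
move=> symM; pose C : numClosedFieldType := (complex.complex R).
pose Mc : 'M[C]_n.+1 := map_mx (complex.real_complex R) M.
have hMc : Mc \is hermsymmx.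
  apply: realsym_hermsym.
    by apply/is_hermitianmxP; rewrite expr0 scale1r map_mx_id// /Mc -[in LHS]symM map_trmx.
  by apply/mxOverP => i j; rewrite mxE complex.complex_real.
have /hermitian_normalmx /orthomx_spectralP eMc := hMc.
have sp_real := mxOverP (hermitian_spectral_diag_real hMc).
set P := spectralmx Mc in eMc; set sp := spectral_diag Mc in eMc sp_real.
have uP : P \in unitmx by exact: spectral_unit.
have eP : P *m Mc = diag_mx sp *m P.
  by have := congr1 (mulmx P) eMc; rewrite !mulmxA mulmxV// mul1mx.
have ev : eigenvalue Mc (sp 0 0).
  apply/eigenvalueP; exists (row 0 P).
    by rewrite -row_mul eP row_mul row_diag_mx -scalemxAl -rowE.
  apply/eqP => r0; have := row_mul 0 P (invmx P).
  rewrite mulmxV// r0 mul0mx => /rowP /(_ 0); rewrite !mxE eqxx => /eqP.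
  by rewrite oner_eq0.
move: ev; rewrite eigenvalue_root_char -(complex.RRe_real (sp_real 0 0)).
rewrite -map_char_poly fmorph_root -eigenvalue_root_char => /eigenvalueP[v vM v0].
by exists (complex.Re (sp 0 0)), v.
Qed.

(* A Householder reflection. *)
Lemma orthogonal_first_row n (v : 'rV[R]_n.+1) : v *m v^T = 1%:M ->
  exists Q : 'M[R]_n.+1, [/\ Q^T = Q, Q *m Q = 1%:M & delta_mx 0 0 *m Q = v].
Proof.
move=> v1; pose e : 'rV[R]_n.+1 := delta_mx 0 0.
have ee : e *m e^T = 1%:M.
  by apply/matrixP => i j; rewrite !ord1 /e trmx_delta mul_delta_mx !mxE !eqxx.
pose w := v - e.
have [w0|w0] := eqVneq w 0.
  exists 1%:M; rewrite trmx1 mulmx1; split=> //; rewrite mulmx1.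
  by move/eqP: w0; rewrite subr_eq0 => /eqP ->.
pose al := (w *m w^T) 0 0.
have wal : w *m w^T = al%:M by apply/matrixP => i j; rewrite !ord1 [RHS]mxE eqxx mulr1n.
have al0 : al != 0.
  apply: contra w0 => /eqP h; apply/eqP/rowP => j; rewrite mxE.
  move/eqP: h; rewrite /al mxE psumr_eq0; last first.
    by move=> i _; rewrite !mxE -expr2 sqr_ge0.
  by move=> /allP /(_ j (mem_index_enum _)); rewrite !mxE -expr2 sqrf_eq0 => /eqP.
have ew : e *m w^T = (- (al / 2))%:M.
  have h : w *m w^T = (2 - 2 * (e *m v^T) 0 0)%:M.
    have ve : v *m e^T = e *m v^T.
      by apply/matrixP => i j; rewrite !mxE; apply: eq_bigr => k _; rewrite !ord1 !mxE mulrC.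
    rewrite /w linearB /= mulmxBl !mulmxBr v1 ee ve.
    by apply/matrixP => i j; rewrite !ord1 !mxE !eqxx !mulr1n; ring.
  have := congr1 (fun A : 'M[R]_1 => A 0 0) (etrans (esym wal) h).
  rewrite !mxE eqxx !mulr1n => ->.
  rewrite /w linearB /= mulmxBr ee.
  by apply/matrixP => i j; rewrite !ord1 !mxE !eqxx !mulr1n; field.
exists (1%:M - (2 / al) *: (w^T *m w)); split.
- by rewrite linearB /= trmx1 linearZ /= trmx_mul trmxK.
- have : (w^T *m w) *m (w^T *m w) = al *: (w^T *m w).
    by rewrite mulmxA -(mulmxA w^T) wal mul_mx_scalar -scalemxAl.
  move: (w^T *m w) => W WW.
  rewrite mulmxBr mulmx1 mulmxBl mul1mx -scalemxAl -scalemxAr WW !scalerA.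
  by apply/matrixP => i j; rewrite !mxE; field.
- rewrite -/e mulmxBr mulmx1 -scalemxAr mulmxA ew mul_scalar_mx scalerA.
  rewrite (_ : _ * _ = -1); last by field.
  by rewrite scaleN1r opprK /w addrC subrK.
Qed.

(** Deflation: conjugation by the reflection that exchanges the first basis vector and a unit
    eigenvector clears the first row, and by symmetry the first column. *)
Lemma symmetric_diagonalization n (M : 'M[R]_n) : M^T = M ->
  exists (P : 'M[R]_n) (s : 'rV[R]_n), P *m P^T = 1%:M /\ P *m M *m P^T = diag_mx s.
Proof.
elim: n M => [|n IH] M symM.
  by exists 1%:M, 0; split; apply/matrixP => -[].
have [lam [v0 [v0n v0M]]] := symmetric_eigenvector symM.
pose al := (v0 *m v0^T) 0 0.
have al0 : 0 < al.
  rewrite lt_neqAle /al mxE sumr_ge0 ?andbT; last first.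
    by move=> i _; rewrite !mxE -expr2 sqr_ge0.
  apply: contra v0n => /eqP /esym /eqP; rewrite psumr_eq0; last first.
    by move=> i _; rewrite !mxE -expr2 sqr_ge0.
  move=> /allP h; apply/eqP/rowP => j; rewrite mxE.
  by have := h j (mem_index_enum _); rewrite !mxE -expr2 sqrf_eq0 => /eqP.
pose v := (Num.sqrt al)^-1 *: v0.
have vv : v *m v^T = 1%:M.
  have e : v0 *m v0^T = al%:M by apply/matrixP => i j; rewrite !ord1 [RHS]mxE eqxx mulr1n.
  rewrite /v linearZ /= -scalemxAl -scalemxAr scalerA e scale_scalar_mx -expr2 exprVn.
  by rewrite sqr_sqrtr ?ltW// mulVf// gt_eqF.
have vM : v *m M = lam *: v by rewrite -scalemxAl v0M scalerA mulrC -scalerA.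
have [Q [symQ QQ eQ]] := orthogonal_first_row vv.
pose N : 'M[R]_(1 + n) := Q *m M *m Q.
have symN : N^T = N by rewrite /N !trmx_mul symQ symM mulmxA.
have N0 : delta_mx 0 0 *m N = lam *: (delta_mx 0 0 : 'rV[R]_(1 + n)).
  rewrite /N !mulmxA eQ vM -scalemxAl; congr (_ *: _).
  by rewrite -eQ -mulmxA QQ mulmx1.
have Nrow j : N 0 j = lam * (j == 0)%:R.
  have := congr1 (fun A : 'rV[R]_(1 + n) => A 0 j) N0.
  by rewrite -rowE !mxE eqxx.
pose N1 := drsubmx N.
have l0 : lshift n 0 = 0 :> 'I_(1 + n) by apply: val_inj.
have NE : N = block_mx lam%:M 0 0 N1.
  rewrite -[LHS]submxK; congr block_mx.
  - apply/matrixP => i j; rewrite !ord1 [LHS]mxE [LHS]mxE [RHS]mxE eqxx mulr1n l0 Nrow eqxx.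
    by rewrite mulr1.
  - by apply/matrixP => i j; rewrite !ord1 [LHS]mxE [LHS]mxE [RHS]mxE l0 Nrow mulr0.
  - apply/matrixP => i j; rewrite !ord1 [LHS]mxE [LHS]mxE [RHS]mxE l0.
    by rewrite -symN mxE Nrow mulr0.
have [P1 [s1 [P1P P1N]]] : exists (P : 'M[R]_n) (s : 'rV[R]_n),
    P *m P^T = 1%:M /\ P *m N1 *m P^T = diag_mx s.
  by apply: IH; rewrite /N1 trmx_drsub symN.
pose P : 'M[R]_(1 + n) := block_mx 1%:M 0 0 P1.
have PT : P^T = block_mx 1%:M 0 0 P1^T by rewrite /P tr_block_mx !trmx0 trmx1.
have PP : P *m P^T = 1%:M.
  rewrite PT /P mulmx_block !mulmx0 !mul0mx !addr0 !add0r mul1mx P1P.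
  by rewrite -scalar_mx_block.
have PNP : P *m N *m P^T = diag_mx (row_mx lam%:M s1 : 'rV[R]_(1 + n)).
  rewrite PT NE /P !mulmx_block !mulmx0 !mul0mx !addr0 !add0r !mul1mx !mulmx1.
  rewrite P1N diag_mx_row; congr block_mx; last by rewrite mul0mx.
  by apply/matrixP => i j; rewrite !ord1 !mxE !eqxx.
exists (P *m Q); exists (row_mx lam%:M s1 : 'rV[R]_(1 + n)); split.
  by rewrite trmx_mul symQ mulmxA -(mulmxA _ Q Q) QQ mulmx1.
have -> : P *m Q *m M *m (P *m Q)^T = P *m N *m P^T.
  by rewrite trmx_mul symQ /N !mulmxA.
exact: PNP.
Qed.

Lemma char_poly_orthogonal n (P M : 'M[R]_n) : P *m P^T = 1%:M ->
  char_poly (P *m M *m P^T) = char_poly M.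
Proof.
move=> PP; have PP' : P^T *m P = 1%:M by exact: mulmx1C.
rewrite /char_poly.
have -> : char_poly_mx (P *m M *m P^T) =
    map_mx (polyC : R -> {poly R}) P *m char_poly_mx M *m map_mx (polyC : R -> {poly R}) P^T.
  rewrite /char_poly_mx mulmxBr mulmxBl -!map_mxM /=; congr (_ - _).
  by rewrite scalar_mxC -mulmxA -map_mxM /= PP map_mx1 mulmx1.
by rewrite !det_mulmx mulrAC -det_mulmx -map_mxM PP map_mx1 det1 mul1r.
Qed.

Lemma prod_XsubC_perm (s t : seq R) :
  \prod_(x <- s) ('X - x%:P) = \prod_(x <- t) ('X - x%:P) -> perm_eq s t.
Proof.
elim: s t => [|x s IH] t.
  move=> /(congr1 (fun p : {poly R} => size p)); rewrite !size_prod_XsubC /=.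
  by case: t.
move=> e; have xt : x \in t.
  by rewrite -root_prod_XsubC -e root_prod_XsubC mem_head.
have pt := perm_to_rem xt.
rewrite perm_sym (perm_trans pt)// perm_cons perm_sym; apply: IH.
move: e; rewrite (perm_big _ pt) /= !big_cons => /mulfI; apply.
by rewrite polyXsubC_eq0.
Qed.

End Spectral.

(** * Singular values *)

Section SingularValues.
Variables (R : realType) (d : nat).
Implicit Types (A : 'M[R]_d) (v : 'cV[R]_d) (w : 'rV[R]_d).

Local Notation ev i := (delta_mx i 0 : 'cV[R]_d).

Definition sqn v : R := \sum_i v i 0 ^+ 2.

Lemma sqn_mx v : v^T *m v = (sqn v)%:M.
Proof.
apply/matrixP => i j; rewrite !ord1 !mxE eqxx mulr1n.
by apply: eq_bigr => k _; rewrite !mxE.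
Qed.

Lemma sqn_ge0 v : 0 <= sqn v.
Proof. by apply: sumr_ge0 => i _; rewrite sqr_ge0. Qed.

Lemma sqnZ (k : R) v : sqn (k *: v) = k ^+ 2 * sqn v.
Proof. by rewrite /sqn mulr_sumr; apply: eq_bigr => i _; rewrite mxE exprMn. Qed.

Lemma norm_le_sqn v : `|v| ^+ 2 <= sqn v.
Proof.
rewrite -(sqr_sqrtr (sqn_ge0 v)) ler_pXn2r ?nnegrE ?sqrtr_ge0//.
rewrite -[leLHS]/(mx_norm v) mx_normrE; apply/bigmax_leP; split => [|[i j] _ /=].
  exact: sqrtr_ge0.
rewrite ord1 -sqrtr_sqr ler_wsqrtr// /sqn (bigD1 i)//= lerDl.
by apply: sumr_ge0 => k _; rewrite sqr_ge0.
Qed.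

Lemma sqn_le_norm v : sqn v <= d%:R * `|v| ^+ 2.
Proof.
rewrite /sqn mulr_natl -[X in _ *+ X]card_ord -sumr_const; apply: ler_sum => i _.
rewrite -real_normK ?num_real// ler_pXn2r ?nnegrE//.
rewrite -[leRHS]/(mx_norm v) mx_normrE.
by apply/bigmax_geP; right => /=; exists (i, 0).
Qed.

Lemma orthogonal_sqn (P : 'M[R]_d) v : P *m P^T = 1%:M -> sqn (P *m v) = sqn v.
Proof.
move=> /mulmx1C PP; have := sqn_mx (P *m v); rewrite trmx_mul mulmxA -(mulmxA v^T) PP mulmx1 sqn_mx.
by move=> /matrixP /(_ 0 0); rewrite !mxE !eqxx !mulr1n.
Qed.

Lemma quad_diag (s : 'rV[R]_d) v : (v^T *m diag_mx s *m v) 0 0 = \sum_i s 0 i * v i 0 ^+ 2.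
Proof.
rewrite mxE; apply: eq_bigr => i _; rewrite mul_mx_diag !mxE; ring.
Qed.

Lemma gram_diag_ge0 A (P : 'M[R]_d) (s : 'rV[R]_d) : P *m P^T = 1%:M ->
  P *m (A^T *m A) *m P^T = diag_mx s -> forall i, 0 <= s 0 i.
Proof.
move=> PP e i; have -> : s 0 i = sqn (A *m (P^T *m ev i)).
  have : (A *m (P^T *m ev i))^T *m (A *m (P^T *m ev i)) =
    (ev i)^T *m (P *m (A^T *m A) *m P^T) *m ev i.
    by rewrite !trmx_mul trmxK !mulmxA.
  rewrite sqn_mx e => /matrixP /(_ 0 0); rewrite quad_diag mxE eqxx mulr1n => ->.
  rewrite (bigD1 i)//= big1 => [|j ji]; rewrite !mxE.
    by rewrite !eqxx /= expr1n mulr1 addr0.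
  by rewrite (negbTE ji) /= expr0n mulr0.
exact: sqn_ge0.
Qed.

Lemma char_poly_diag (s : 'rV[R]_d) : char_poly (diag_mx s) = \prod_i ('X - (s 0 i)%:P).
Proof.
rewrite char_poly_trig; last exact: diag_mx_is_trig.
by apply: eq_bigr => i _; rewrite mxE eqxx mulr1n.
Qed.

Lemma singular_valuesP A : is_singular_values A (singular_values A).
Proof.
apply: (xgetPex _ (P := is_singular_values A)).
have symM : (A^T *m A)^T = A^T *m A by rewrite trmx_mul trmxK.
have [P [s [PP e]]] := symmetric_diagonalization symM.
have s0 := gram_diag_ge0 PP e.
pose t := [tuple Num.sqrt (s 0 i) | i < d].
exists [tuple of sort >=%R t]; split.
- by apply: sort_sorted => x y; rewrite /= le_total.
- by rewrite all_sort; apply/allP => x /mapP[i _ ->]; exact: sqrtr_ge0.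
- rewrite -(char_poly_orthogonal _ PP) e char_poly_diag.
  rewrite (perm_big t) /=; last by rewrite perm_sort.
  rewrite big_map big_enum /=; apply: eq_bigr => i _.
  by rewrite sqr_sqrtr.
Qed.

Local Notation sv A i := (nth 0 (singular_values A) i).

Lemma sv_ge0 A i : (i < d)%N -> 0 <= sv A i.
Proof.
move=> id; have [_ /allP h _] := singular_valuesP A.
by apply: h; rewrite mem_nth// size_tuple.
Qed.

Lemma sv_le A i j : (i <= j < d)%N -> sv A j <= sv A i.
Proof.
move=> /andP[ij jd]; have [h _ _] := singular_valuesP A.
have tr : transitive (>=%R : rel R) by move=> x y z /= h1 h2; exact: le_trans h2 h1.
have rf : reflexive (>=%R : rel R) by move=> x /=.
apply: (sorted_leq_nth tr rf 0 h) => //; rewrite inE size_tuple//.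
exact: leq_ltn_trans jd.
Qed.

(** Orthonormal coordinates that diagonalize the quadratic form of [A]. The characteristic
    polynomial determines the eigenvalues only as a multiset, hence the permutation [p] of the
    rows. *)
Lemma singular_basis A : exists2 P : 'M[R]_d, P *m P^T = 1%:M &
  forall v, sqn (A *m v) = \sum_(i < d) sv A i ^+ 2 * (P *m v) i 0 ^+ 2.
Proof.
have symM : (A^T *m A)^T = A^T *m A by rewrite trmx_mul trmxK.
have [P [s [PP e]]] := symmetric_diagonalization symM.
have [_ _] := singular_valuesP A.
rewrite -(char_poly_orthogonal _ PP) e char_poly_diag.
set t := singular_values A => h.
have /tuple_permP[p hp] : perm_eq [seq x ^+ 2 | x <- t] [tuple s 0 i | i < d].
  apply: prod_XsubC_perm; rewrite big_map -h [RHS]big_map -[RHS]/(\big[_/_]_(i <- enum 'I_d) _) big_enum /=.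
  by apply: eq_bigr.
have tp (i : 'I_d) : nth 0 t i ^+ 2 = s 0 (p i).
  have := congr1 (fun q : seq R => nth 0 q i) hp; cbv beta.
  rewrite (nth_map 0) ?size_tuple// => ->.
  by rewrite nth_mktuple tnth_mktuple.
exists (row_perm p P).
  apply/matrixP => i j; have /matrixP /(_ (p i) (p j)) := PP.
  rewrite !mxE (inj_eq perm_inj) => <-.
  by apply: eq_bigr => k _; rewrite !mxE.
move=> v; have Mv : A^T *m A = P^T *m diag_mx s *m P.
  by rewrite -e !mulmxA (mulmx1C PP) mul1mx -!mulmxA (mulmx1C PP) mulmx1.
have : (A *m v)^T *m (A *m v) = (P *m v)^T *m diag_mx s *m (P *m v).
  have -> : (A *m v)^T *m (A *m v) = v^T *m (A^T *m A) *m v by rewrite trmx_mul !mulmxA.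
  by rewrite Mv trmx_mul !mulmxA.
rewrite sqn_mx => /matrixP /(_ 0 0); rewrite quad_diag mxE eqxx mulr1n => ->.
rewrite (reindex_inj (@perm_inj _ p)) /=; apply: eq_bigr => i _.
rewrite -tp; congr (_ * _ ^+ 2).
by rewrite !mxE; apply: eq_bigr => k _; rewrite !mxE.
Qed.

Lemma sqn_mul_le A v : sqn (A *m v) <= sv A 0 ^+ 2 * sqn v.
Proof.
have [P PP ->] := singular_basis A; rewrite -(orthogonal_sqn v PP) mulr_sumr.
apply: ler_sum => i _; rewrite ler_wpM2r ?sqr_ge0//.
have d0 := leq_ltn_trans (leq0n i) (ltn_ord i).
by rewrite ler_pXn2r ?nnegrE ?sv_ge0// sv_le/=.
Qed.

Lemma sqn_mul_ge A v : sv A d.-1 ^+ 2 * sqn v <= sqn (A *m v).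
Proof.
have [P PP ->] := singular_basis A; rewrite -(orthogonal_sqn v PP) mulr_sumr.
apply: ler_sum => i _; rewrite ler_wpM2r ?sqr_ge0//.
have d0 := leq_ltn_trans (leq0n i) (ltn_ord i).
rewrite ler_pXn2r ?nnegrE ?sv_ge0 ?ltn_predL// sv_le// ltn_predL d0 andbT.
by rewrite -ltnS prednK.
Qed.

Lemma singular_vector A (i : 'I_d) : exists v, sqn v = 1 /\ sqn (A *m v) = sv A i ^+ 2.
Proof.
have [P PP h] := singular_basis A.
have Pv : P *m (P^T *m ev i) = ev i by rewrite mulmxA PP mul1mx.
have S (s : 'I_d -> R) : \sum_j s j * (ev i) j 0 ^+ 2 = s i.
  rewrite (bigD1 i)//= big1 => [|j ji]; rewrite !mxE.
    by rewrite !eqxx /= expr1n mulr1 addr0.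
  by rewrite (negbTE ji) /= expr0n mulr0.
exists (P^T *m ev i); split; last by rewrite h Pv S.
rewrite -(orthogonal_sqn _ PP) Pv; rewrite -[RHS](S (fun=> 1)).
by apply: eq_bigr => j _; rewrite mul1r.
Qed.

(* Courant-Fischer: a hyperplane meets the span of two singular vectors. *)
Lemma singular_plane A w (i j : 'I_d) : (i < j)%N -> exists v,
  [/\ pairing w v = 0, 0 < sqn v & sv A j ^+ 2 * sqn v <= sqn (A *m v) <= sv A i ^+ 2 * sqn v].
Proof.
move=> ij; have [P PP h] := singular_basis A.
have nij : i != j by rewrite neq_ltn ij.
pose a := pairing w (P^T *m ev i); pose b := pairing w (P^T *m ev j).
have [al [be [abE ab0]]] : exists al be : R, al * a + be * b = 0 /\ 0 < al ^+ 2 + be ^+ 2.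
  have [a0|a0] := eqVneq a 0.
    by exists 1, 0; rewrite a0 mulr0 mul0r addr0 expr1n expr0n addr0.
  exists (- b), a; split; first by ring.
  by rewrite ltr_wpDl ?sqr_ge0// exprn_even_gt0.
pose c : 'cV[R]_d := al *: ev i + be *: ev j.
have Pv : P *m (P^T *m c) = c by rewrite mulmxA PP mul1mx.
have S (s : 'I_d -> R) : \sum_k s k * c k 0 ^+ 2 = s i * al ^+ 2 + s j * be ^+ 2.
  rewrite (bigD1 i)//= (bigD1 j) 1?eq_sym//= big1 => [|k /andP[ki kj]].
    by rewrite !mxE !eqxx (negbTE nij) eq_sym (negbTE nij) /= !mulr1 !mulr0 addr0 add0r addr0.
  by rewrite !mxE (negbTE ki) (negbTE kj) /= !mulr0 addr0 expr0n mulr0.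
have sc : sqn (P^T *m c) = al ^+ 2 + be ^+ 2.
  rewrite -(orthogonal_sqn _ PP) Pv; transitivity (1 * al ^+ 2 + 1 * be ^+ 2); last by rewrite !mul1r.
  by rewrite -(S (fun=> 1)); apply: eq_bigr => k _; rewrite mul1r.
exists (P^T *m c); split.
- by rewrite /c mulmxDr -!scalemxAr pairingD !pairingZ.
- by rewrite sc.
- have hij : sv A j ^+ 2 <= sv A i ^+ 2.
    by rewrite ler_pXn2r ?nnegrE ?sv_ge0// sv_le// ltn_ord (ltnW ij).
  rewrite h Pv (S (fun k : 'I_d => sv A k ^+ 2)) sc.
  have := sqr_ge0 al; have := sqr_ge0 be; move: hij.
  move: (_ ^+ 2) (sv A i ^+ 2) (al ^+ 2) (be ^+ 2) => x y p q; nra.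
Qed.

End SingularValues.

Notation sv A i := (nth 0 (singular_values A) i).

(** * Singular value gaps from a hyperplane and a test vector *)

Section Gaps.
Variables (R : realType) (d : nat) (A T : 'M[R]_d) (k : R).
Hypotheses (k0 : k != 0) (TE : T = k *: A).
Implicit Types (b : R).

Let sqnT v : sqn (T *m v) = k ^+ 2 * sqn (A *m v).
Proof. by rewrite TE -scalemxAl sqnZ. Qed.

Let k2 : 0 < k ^+ 2. Proof. by rewrite exprn_even_gt0. Qed.

(** By Courant-Fischer [b2] bounds the square of the second singular value of [T] from above, while
    [v] shows that the square of the first is at least [b1]. The scalar [k] cancels. *)
Lemma first_gap_le w v b1 b2 : (1 < d)%N -> 0 < sqn v -> 0 <= b2 -> b1 * sqn v <= sqn (T *m v) ->
  (forall u, pairing w u = 0 -> sqn (T *m u) <= b2 * sqn u) ->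
  b1 * sv A 1 ^+ 2 <= b2 * sv A 0 ^+ 2.
Proof.
move=> d1 v0 b20 h1 h2.
have [u [wu u0 /andP[hu _]]] := singular_plane A w (i := Ordinal (ltnW d1)) (j := Ordinal d1) isT.
have H2 : k ^+ 2 * sv A 1 ^+ 2 <= b2.
  rewrite -(ler_pM2r u0); apply: le_trans (h2 _ wu); rewrite sqnT -[leLHS]mulrA.
  by apply: ler_wpM2l; [exact: ltW|].
have H1 : b1 <= k ^+ 2 * sv A 0 ^+ 2.
  rewrite -(ler_pM2r v0); apply: (le_trans h1); rewrite sqnT -[leRHS]mulrA.
  by apply: ler_wpM2l; [exact: ltW|exact: sqn_mul_le].
rewrite -(ler_pM2l k2).
have := sqr_ge0 (sv A 0); have := sqr_ge0 (sv A 1); move: k2 H1 H2.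
move: (k ^+ 2) (sv A 0 ^+ 2) (sv A 1 ^+ 2) => x y z x0 H1 H2 z0 y0.
have : b1 * (x * z) <= (x * y) * (x * z) by rewrite ler_wpM2r// mulr_ge0// ltW.
have : (x * y) * (x * z) <= (x * y) * b2 by rewrite ler_wpM2l// mulr_ge0// ltW.
lra.
Qed.

Lemma last_gap_ge w v b1 b2 : (1 < d)%N -> 0 < sqn v -> 0 <= b2 -> sqn (T *m v) <= b1 * sqn v ->
  (forall u, pairing w u = 0 -> b2 * sqn u <= sqn (T *m u)) ->
  b2 * sv A d.-1 ^+ 2 <= b1 * sv A d.-2 ^+ 2.
Proof.
move=> d1 v0 b20 h1 h2.
have dd : (d.-1 < d)%N by rewrite ltn_predL ltnW.
have dd2 : (d.-2 < d.-1)%N by rewrite ltn_predL -ltnS prednK// ltnW.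
have [u [wu u0 /andP[_ hu]]] := singular_plane A w (i := Ordinal (ltn_trans dd2 dd)) (j := Ordinal dd) dd2.
have H2 : b2 <= k ^+ 2 * sv A d.-2 ^+ 2.
  rewrite -(ler_pM2r u0); apply: (le_trans (h2 _ wu)); rewrite sqnT -[leRHS]mulrA.
  by apply: ler_wpM2l; [exact: ltW|].
have H1 : k ^+ 2 * sv A d.-1 ^+ 2 <= b1.
  rewrite -(ler_pM2r v0); apply: le_trans h1; rewrite sqnT -[leLHS]mulrA.
  by apply: ler_wpM2l; [exact: ltW|exact: sqn_mul_ge].
rewrite -(ler_pM2l k2).
have := sqr_ge0 (sv A d.-2); have := sqr_ge0 (sv A d.-1); move: k2 H1 H2.
move: (k ^+ 2) (sv A d.-2 ^+ 2) (sv A d.-1 ^+ 2) => x y z x0 H1 H2 z0 y0.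
have : b2 * (x * z) <= (x * y) * (x * z) by rewrite ler_wpM2r// mulr_ge0// ltW.
have : (x * y) * (x * z) <= (x * y) * b1 by rewrite ler_wpM2l// mulr_ge0// ltW.
lra.
Qed.

Lemma total_gap_le b1 b2 : (0 < d)%N -> 0 <= b2 ->
  (forall u, sqn (T *m u) <= b1 * sqn u) -> (forall u, b2 * sqn u <= sqn (T *m u)) ->
  b2 * sv A 0 ^+ 2 <= b1 * sv A d.-1 ^+ 2.
Proof.
move=> d0 b20 h1 h2; have dd : (d.-1 < d)%N by rewrite ltn_predL.
have [v [v1 /= vA]] := singular_vector A (Ordinal d0).
have [u [u1 /= uA]] := singular_vector A (Ordinal dd).
have H1 := h1 v; have H2 := h2 u; rewrite !sqnT v1 u1 vA uA !mulr1 in H1 H2.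
rewrite -(ler_pM2l k2).
have := sqr_ge0 (sv A 0); have := sqr_ge0 (sv A d.-1); move: k2 H1 H2.
move: (k ^+ 2) (sv A 0 ^+ 2) (sv A d.-1 ^+ 2) => x y z x0 H1 H2 z0 y0.
have : b2 * (x * y) <= (x * z) * (x * y) by rewrite ler_wpM2r// mulr_ge0// ltW.
have : (x * z) * (x * y) <= (x * z) * b1 by rewrite ler_wpM2l// mulr_ge0// ltW.
lra.
Qed.

End Gaps.

(** * Automorphisms tracking a ray *)

Section Automorphism.
Variables (R : realType) (d : nat) (Omega : set (projspace R d)) (f : 'rV[R]_d) (B : R).
Hypotheses (oOmega : open Omega) (fOmega : proper_chart Omega f).
Notation Co := (cone_over f Omega).
Notation Cb := (closed_cone Omega f).
Hypothesis cone : convex_cone f B Co Cb.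
Local Open Scope quotient_scope.

Lemma pgl_act_represents (g : PGL R d) p v : represents p v ->
  represents (pgl_act g p) (lift_mx g *m v).
Proof.
move=> [k k0 ->]; rewrite -scalemxAr; apply: represents_scale => //.
exact: proj_class_represents.
Qed.

Lemma lift_mx_inv (g : PGL R d) : exists2 k : R, k != 0 &
  lift_mx (pgl_inv g) = k *: invmx (lift_mx g).
Proof.
have : mx_prop (Sub (invmx (lift_mx g)) (pgl_inv_subproof g)) (repr (pgl_inv g)).
  by apply/eqmodP; rewrite reprK.
by move=> /asboolP[k k0 e]; exists k.
Qed.

(** A lift may send the cone to its opposite, and [s] is the correcting sign. One sign serves the
    whole cone: otherwise a positive combination of interior vectors would be sent into the kernel
    of [f]. The closed cone is reached by perturbing along [X0]. *)
Lemma aut_linear (g : PGL R d) X0 : Aut Omega g -> Co X0 ->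
  exists s : R, [/\ s != 0, forall v, Co (s *: lift_mx g *m v) <-> Co v,
    forall v, Cb v -> Cb (s *: lift_mx g *m v) &
    forall v, Cb (s *: lift_mx g *m v) -> Cb v].
Proof.
move=> gO c0; set A := lift_mx g; have uA : A \in unitmx by exact: lift_mx_unit.
have [_ clf _ _] := fOmega.
have Oclf p : Omega p -> affine_chart f p by move=> Op; apply: clf; exact: subset_closure.
have AO v : Co v -> exists2 p, Omega p & represents p (A *m v).
  move=> [_ [p Op rp]]; exists (pgl_act g p); last exact: pgl_act_represents.
  by rewrite -gO; exists p.
have fA v : Co v -> pairing f (A *m v) != 0.
  by move=> /AO[p /Oclf fp rp]; rewrite -(affine_chartE f rp).
pose s : R := Num.sg (pairing f (A *m X0)).
have s0 : s != 0 by rewrite sgr_eq0 fA.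
have sX : 0 < s * pairing f (A *m X0) by rewrite -normrEsg normr_gt0 fA.
pose S := s *: A.
have SE v : S *m v = s *: (A *m v) by rewrite -scalemxAl.
have fS v : Co v -> 0 < pairing f (S *m v).
  move=> cv; rewrite SE pairingZ ltNge; apply/negP => h.
  have := fA ((s * pairing f (A *m X0)) *: v + (- (s * pairing f (A *m v))) *: X0).
  rewrite mulmxDr -!scalemxAr pairingD !pairingZ.
  have -> : s * pairing f (A *m X0) * pairing f (A *m v) +
    - (s * pairing f (A *m v)) * pairing f (A *m X0) = 0 by ring.
  rewrite eqxx => /(_ _)/negP; apply => //.
  apply: (coDb cone); first exact: (coZ cone).
  by apply: (cbZ cone); [rewrite oppr_ge0|exact: (coW cone)].
have SCo v : Co v -> Co (S *m v).
  move=> cv; split; first exact: fS.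
  by have [p Op rp] := AO v cv; exists p => //; rewrite SE; exact: represents_scale.
have uS : S \in unitmx by rewrite unitmxZ// unitfE.
have SCo' v : Co (S *m v) -> Co v.
  move=> [fv [p Op rp]]; have [q Oq qp] : (pgl_act g @` Omega) p by rewrite gO.
  have [u ru [cu fu]] := co_rep fOmega Oq.
  have rAu := pgl_act_represents g ru; rewrite qp in rAu.
  have [l l0 e] := represents_colinear rAu rp.
  have vE : v = (l / s) *: u.
    apply: (can_inj (mulKmx uS)); rewrite e -scalemxAr SE scalerA divfK//.
  have ls : 0 < l / s.
    by rewrite -(pmulr_lgt0 _ (fS _ cu)) -pairingZ scalemxAr -vE.
  by rewrite vE; apply: (coZ cone).
exists s; split=> //.
- by move=> v; split; [exact: SCo'|exact: SCo].
- move=> v cv; apply: (cb_closed cone) => e e0.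
  pose del := e / (1 + `|S *m X0|).
  have del0 : 0 < del by rewrite divr_gt0// ltr_pwDl.
  exists (S *m (v + del *: X0)).
    by apply/(coW cone)/SCo/(cobD cone) => //; exact: (coZ cone).
  rewrite mulmxDr addrC addKr -scalemxAr normrZ gtr0_norm// /del mulrAC ltr_pdivrMr ?ltr_pwDl//.
  by rewrite ltr_pM2l// ltrDr.
- move=> v cv; apply: (cb_closed cone) => e e0.
  pose del := e / (1 + `|X0|).
  have del0 : 0 < del by rewrite divr_gt0// ltr_pwDl.
  exists (v + del *: X0).
    apply/(coW cone)/SCo'; rewrite mulmxDr; apply: (cobD cone) => //.
    by rewrite -scalemxAr; apply: (coZ cone) => //; exact: SCo.
  rewrite addrC addKr normrZ gtr0_norm// /del mulrAC ltr_pdivrMr ?ltr_pwDl//.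
  by rewrite ltr_pM2l// ltrDr.
Qed.

(** The distance bounds only the product [k * l]. Absorbing [l] into the scale of [T] gives
    [Y <= T X0 <= expR (2 * K) Y] in the order of the cone. *)
Lemma track_linear (g : PGL R d) x0 y X0 Y (K : R) : Aut Omega g ->
  represents x0 X0 -> Co X0 -> represents y Y -> Co Y ->
  hilbert_dist Omega x0 (pgl_act (pgl_inv g) y) < K ->
  exists (k : R) (T : 'M[R]_d), [/\ k != 0, T = k *: lift_mx g,
    forall v, Cb v -> Cb (T *m v), forall v, Cb (T *m v) -> Cb v &
    Cb (T *m X0 - Y) /\ Cb (expR (2 * K) *: Y - T *m X0)].
Proof.
move=> gO r0 c0 rY cY dK.
have [s [s0 SCo SCb SCb']] := aut_linear gO c0.
set S := s *: lift_mx g in SCo SCb SCb'.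
have uS : S \in unitmx by rewrite unitmxZ ?unitfE// lift_mx_unit.
pose W := invmx S *m Y.
have SW : S *m W = Y by rewrite mulKVmx.
have cW : Co W by apply/SCo; rewrite SW.
have rW : represents (pgl_act (pgl_inv g) y) W.
  have [k k0 e] := lift_mx_inv g.
  have := pgl_act_represents (pgl_inv g) rY; rewrite e -scalemxAl => h.
  have -> : W = (s^-1 / k) *: (k *: (invmx (lift_mx g) *m Y)).
    rewrite /W /S invmxZ; last by rewrite unitmxZ ?unitfE// lift_mx_unit.
    by rewrite -scalemxAl scalerA divfK.
  by apply: represents_scale; rewrite ?mulf_neq0 ?invr_eq0.
have [k [l [k0 l0 hk hl e]]] := hilbert_dist_ex oOmega fOmega cone r0 rW c0 cW.
exists (l * s), (l *: S); split.
- by rewrite mulf_neq0// gt_eqF.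
- by rewrite scalerA.
- by move=> v cv; rewrite -scalemxAl; apply: (cbZ cone); [exact: ltW|exact: SCb].
- move=> v; rewrite -scalemxAl => h; apply: SCb'.
  have := cbZ cone (k := l^-1) _ h; rewrite scalerA mulVf ?gt_eqF// scale1r; apply.
  by rewrite invr_ge0 ltW.
have h1 := SCb _ hk; have h2 := SCb _ hl.
rewrite mulmxBr -scalemxAr SW in h1; rewrite mulmxBr -scalemxAr SW in h2.
split; first by rewrite -scalemxAl.
have kl : k * l <= expR (2 * K) by rewrite -e ler_expR ler_pM2l// ltW.
rewrite (_ : _ - _ = l *: (k *: Y - S *m X0) + (expR (2 * K) - k * l) *: Y).
  apply: (cbD cone); first by apply: (cbZ cone) => //; exact: ltW.
  by apply: (cbZ cone); [rewrite subr_ge0|exact: (coW cone)].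
rewrite -scalemxAl; move: (S *m X0) => Z.
by apply/matrixP => i j; rewrite !mxE; ring.
Qed.

End Automorphism.

(** Homogeneity turns an implication between balls into an inequality of quadratic forms; [d]
    compares the maximum norm with the Euclidean one. If [S1 *m u = 0], all multiples of [u] satisfy
    the hypothesis, so [S2 *m u = 0]. *)
Lemma sqn_hom (R : realType) (d : nat) (S1 S2 : 'M[R]_d) (w : 'rV[R]_d) (r b : R) : 0 < r -> 0 <= b ->
  (forall v, pairing w v = 0 -> `|S1 *m v| <= r -> `|S2 *m v| <= b) ->
  forall u, pairing w u = 0 -> sqn (S2 *m u) <= d%:R * (b / r) ^+ 2 * sqn (S1 *m u).
Proof.
move=> r0 b0 h u wu.
suff hn : `|S2 *m u| <= b / r * `|S1 *m u|.
  apply: (le_trans (sqn_le_norm _)); rewrite -mulrA ler_wpM2l//.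
  apply: (@le_trans _ _ ((b / r * `|S1 *m u|) ^+ 2)).
    by apply: lerXn2r; rewrite ?nnegrE// (le_trans _ hn).
  by rewrite exprMn ler_wpM2l ?sqr_ge0//; exact: norm_le_sqn.
have hk (k : R) : 0 < k -> `|S1 *m u| * k <= r -> `|S2 *m u| * k <= b.
  move=> k0; have := h (k *: u); rewrite pairingZ wu mulr0 => /(_ erefl).
  by rewrite -!scalemxAr !normrZ gtr0_norm// !(mulrC k).
have [n0|n0] := eqVneq `|S1 *m u| 0.
  rewrite n0 mulr0 leNgt; apply/negP => n2.
  have := hk ((b + 1) / `|S2 *m u|); rewrite n0 mul0r (mulrC `|S2 *m u|) divfK ?gt_eqF// => h1.
  have b1 : 0 < b + 1 by lra.
  have := h1 (divr_gt0 b1 n2) (ltW r0).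
  by lra.
have n1 : 0 < `|S1 *m u| by rewrite lt_neqAle eq_sym n0 normr_ge0.
have := hk (r / `|S1 *m u|); rewrite divr_gt0// (mulrC `|S1 *m u|) divfK// lexx => /(_ isT isT).
by rewrite mulrA ler_pdivrMr// -ler_pdivlMr// mulrAC.
Qed.

(** * Norm estimates from the order of the cone *)

Section Operator.
Variables (R : realType) (d : nat) (Omega : set (projspace R d)) (f : 'rV[R]_d) (B : R).
Notation Co := (cone_over f Omega).
Notation Cb := (closed_cone Omega f).
Hypothesis cone : convex_cone f B Co Cb.
Implicit Types (u v a : 'cV[R]_d) (rho : R) (F : 'rV[R]_d).
Variables (X0 c : 'cV[R]_d) (Lam : R) (T : 'M[R]_d) (r0 : R).
Hypotheses (TCb : forall v, Cb v -> Cb (T *m v)) (TCb' : forall v, Cb (T *m v) -> Cb v).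
Hypotheses (fX0 : pairing f X0 = 1) (fc : pairing f c = 1) (Lam0 : 0 < Lam) (r00 : 0 < r0).
Hypothesis X0_ball : forall v, `|v| <= r0 -> Cb (X0 + v).
Hypotheses (h1 : Cb (T *m X0 - c)) (h2 : Cb (Lam *: c - T *m X0)).

Let B0 : 0 < B := cone_bound_gt0 cone.

Lemma symmetric_bound a u : Cb (a + u) -> Cb (a - u) -> `|u| <= B * pairing f a.
Proof.
move=> cu1 cu2; have := cone_bound cone cu1; have := cone_bound cone cu2.
have : `|(a + u) - (a - u)| <= `|a + u| + `|a - u| by exact: ler_normB.
have -> : (a + u) - (a - u) = 2 *: u by apply/matrixP => i j; rewrite !mxE; ring.
by rewrite normrZ ger0_norm// !pairingD pairingN; lra.
Qed.

Let T_ball v : `|v| <= r0 -> Cb (T *m X0 + T *m v) /\ Cb (T *m X0 - T *m v).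
Proof.
move=> hv; rewrite -mulmxDr -mulmxBr; split; apply: TCb; apply: X0_ball => //.
by rewrite normrN.
Qed.

Let Lam_add u : Cb (T *m X0 + u) -> Cb (Lam *: c + u).
Proof.
move=> hu; rewrite (_ : _ + _ = (Lam *: c - T *m X0) + (T *m X0 + u)); first exact: (cbD cone).
by rewrite addrA subrK.
Qed.

Let back v : Cb (c + T *m v) -> Cb (X0 + v).
Proof.
move=> hv; apply: TCb'; rewrite mulmxDr.
rewrite (_ : _ + _ = (T *m X0 - c) + (c + T *m v)); first exact: (cbD cone).
by rewrite addrA subrK.
Qed.

Lemma operator_norm v : `|v| <= r0 -> `|T *m v| <= B * Lam.
Proof.
move=> /T_ball[/Lam_add h /Lam_add h']; have := symmetric_bound h h'.
by rewrite pairingZ fc mulr1.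
Qed.

(** The ball around [X0] is sent into the cone and [T *m X0 <= Lam *: c], so [Lam *: c] plus or
    minus [T *m v] lies in the cone. After division by [Lam] the width at [c] applies. *)
Lemma operator_width rho v :
  (forall u, pairing f u = 0 -> Cb (c + u) -> Cb (c - u) -> `|u| <= rho) ->
  pairing (f *m T) v = 0 -> `|v| <= r0 -> `|T *m v| <= Lam * rho.
Proof.
move=> hrho fv /T_ball[/Lam_add h /Lam_add h'].
have Li : 0 <= Lam^-1 by rewrite invr_ge0 ltW.
have sc u : Cb (Lam *: c + u) -> Cb (c + Lam^-1 *: u).
  by move=> /(cbZ cone Li); rewrite scalerDr scalerA mulVf ?gt_eqF// scale1r.
have := hrho (Lam^-1 *: (T *m v)).
rewrite pairingZ /pairing mulmxA -/(pairing _ _) fv mulr0 => /(_ erefl (sc _ h)).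
rewrite -scalerN => /(_ (sc _ h')).
by rewrite normrZ gtr0_norm ?invr_gt0// ler_pdivrMl.
Qed.

Lemma operator_inverse v : Cb (c + T *m v) -> Cb (c - T *m v) -> `|v| <= B.
Proof.
rewrite -mulmxN => /back h /back h'; have := symmetric_bound h h'.
by rewrite fX0 mulr1.
Qed.

Lemma operator_functional F v : (forall u, Cb u -> 0 <= pairing F u) -> 0 <= pairing F c ->
  `|pairing F (T *m v)| <= Lam * pairing F c / r0 * `|v|.
Proof.
move=> F0 Fc.
have H u : `|u| <= r0 -> `|pairing F (T *m u)| <= Lam * pairing F c.
  move=> /T_ball[/Lam_add h /Lam_add h'].
  have := F0 _ h; have := F0 _ h'; rewrite pairingB pairingD pairingZ => i1 i2.
  by rewrite ler_norml; apply/andP; split; lra.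
have [->|v0] := eqVneq v 0; first by rewrite mulmx0 pairing0 !normr0 mulr0.
have nv : 0 < `|v| by rewrite normr_gt0.
have := H ((r0 / `|v|) *: v); rewrite normrZ gtr0_norm ?divr_gt0// divfK ?gt_eqF// lexx => /(_ isT).
rewrite -scalemxAr pairingZ normrM gtr0_norm ?divr_gt0// => h.
rewrite mulrAC ler_pdivlMr//; move: h; rewrite mulrAC ler_pdivrMr//; lra.
Qed.

Lemma operator_lower : 0 < pairing f (T *m X0) /\ 1 <= pairing f (T *m X0).
Proof.
have := cb_ge0 cone h1; rewrite pairingB fc => h; split; lra.
Qed.

End Operator.

Lemma le_sqrt_mul (R : realType) (x y c : R) : 0 <= x -> 0 <= y -> 0 <= c ->
  x ^+ 2 <= c * y ^+ 2 -> x <= Num.sqrt c * y.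
Proof.
move=> x0 y0 c0 h; rewrite -(ger0_norm x0) -sqrtr_sqr -(ger0_norm y0) -[X in _ * X]sqrtr_sqr.
by rewrite -sqrtrM// ler_wsqrtr.
Qed.

(** The step is iterated along the class of [n - n1] modulo [p], starting from the bound [r]
    available everywhere; hence the integer quotient. *)
Lemma iterate_step (R : realType) (P : nat -> R -> Prop) (n1 p : nat) (g r : R) :
  (forall n s, (n1 <= n)%N -> P n s -> P (n + p)%N (g * s)) -> (forall n, P n r) ->
  forall n, (n1 <= n)%N -> P n (g ^+ ((n - n1) %/ p) * r).
Proof.
move=> hs h0 n hn; have := divn_eq (n - n1) p.
move: ((n - n1) %/ p)%N ((n - n1) %% p)%N => k m e.
have {e}-> : n = (n1 + m + k * p)%N by rewrite -addnA (addnC m) -e subnKC.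
elim: k => [|k IH]; first by rewrite expr0 mul1r addn0.
rewrite mulSn addnCA addnC exprS -mulrA; apply: hs => //.
by rewrite -addnA leq_addr.
Qed.

Section GapAt.
Variables (R : realType) (d : nat) (Omega : set (projspace R d)) (f : 'rV[R]_d) (B : R).
Notation Co := (cone_over f Omega).
Notation Cb := (closed_cone Omega f).
Hypothesis cone : convex_cone f B Co Cb.
Implicit Types (u v : 'cV[R]_d) (rho : R) (F : 'rV[R]_d).
Variables (X0 c : 'cV[R]_d) (Lam Cf : R) (A T : 'M[R]_d) (r0 k : R).
Hypotheses (TCb : forall v, Cb v -> Cb (T *m v)) (TCb' : forall v, Cb (T *m v) -> Cb v).
Hypotheses (fX0 : pairing f X0 = 1) (fc : pairing f c = 1) (Lam0 : 0 < Lam) (r00 : 0 < r0).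
Hypothesis X0_ball : forall v, `|v| <= r0 -> Cb (X0 + v).
Hypotheses (h1 : Cb (T *m X0 - c)) (h2 : Cb (Lam *: c - T *m X0)).
Hypotheses (Cf0 : 0 < Cf) (fCf : forall v, `|pairing f v| <= Cf * `|v|).
Hypotheses (k0 : k != 0) (TE : T = k *: A) (uA : A \in unitmx) (d1 : (1 < d)%N).

Let B0 : 0 < B := cone_bound_gt0 cone.
Let d0 : 0 < d%:R :> R. Proof. by rewrite ltr0n ltnW. Qed.

Let sqn_gt0 v : v != 0 -> 0 < sqn v.
Proof. by move=> v0; apply: lt_le_trans (norm_le_sqn v); rewrite exprn_gt0// normr_gt0. Qed.

Let X0_neq0 : X0 != 0.
Proof. by apply: contra_eq_neq fX0 => ->; rewrite pairing0 eq_sym oner_eq0. Qed.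

(** On the kernel of [f *m T] the operator is bounded through the width at [c]; [X0] is not
    contracted, since [f] is at least 1 at its image. *)
Lemma first_gap_at rho : 0 <= rho ->
  (forall u, pairing f u = 0 -> Cb (c + u) -> Cb (c - u) -> `|u| <= rho) ->
  sv A 1 ^+ 2 <= d%:R * (Lam * rho / r0) ^+ 2 * (Cf ^+ 2 * sqn X0) * sv A 0 ^+ 2.
Proof.
move=> rho0 hrho; have q0 := sqn_gt0 X0_neq0.
have p0 : 0 < Cf ^+ 2 * sqn X0 by rewrite mulr_gt0// exprn_gt0.
have b20 : 0 <= d%:R * (Lam * rho / r0) ^+ 2 by rewrite mulr_ge0 ?sqr_ge0.
have H1 : (Cf ^+ 2 * sqn X0)^-1 * sqn X0 <= sqn (T *m X0).
  rewrite invfM -mulrA mulVf ?gt_eqF// mulr1 -[leLHS]mul1r ler_pdivrMr ?exprn_gt0// mulrC.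
  apply: (@le_trans _ _ ((Cf * `|T *m X0|) ^+ 2)); last first.
    by rewrite exprMn ler_wpM2l ?sqr_ge0// norm_le_sqn.
  have [_ h] := operator_lower cone fc h1.
  by rewrite -[leLHS](expr1n _ 2); apply: lerXn2r;
    rewrite ?nnegrE ?mulr_ge0 ?(ltW Cf0)// (le_trans h)// (le_trans (ler_norm _)).
have H2 u : pairing (f *m T) u = 0 -> sqn (T *m u) <= d%:R * (Lam * rho / r0) ^+ 2 * sqn u.
  move=> fu; rewrite -[in X in _ * X](mul1mx u); apply: sqn_hom fu => //.
    by rewrite mulr_ge0// ltW.
  by move=> v fv; rewrite mul1mx; exact: (operator_width cone TCb Lam0 X0_ball h2 hrho fv).
have := first_gap_le k0 TE d1 q0 b20 H1 H2.
by rewrite mulrC ler_pdivrMr//; lra.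
Qed.

(** Dually, on the kernel of [F *m T] the inradius at [c] bounds [T] from below. The test vector is
    the preimage of the transpose of [F]: it is contracted because the functional [F *m T] has norm
    controlled by [Lam * tn / r0]. *)
Lemma last_gap_at F (tn rn : R) : (forall u, Cb u -> 0 <= pairing F u) -> pairing F c = tn -> 0 < tn ->
  0 < rn -> F != 0 -> (forall u, pairing F u = 0 -> `|u| <= rn -> Cb (c + u)) ->
  sv A d.-1 ^+ 2 <= d%:R * (B / rn) ^+ 2 * ((Lam * tn / r0) ^+ 2 / sqn F^T) * sv A d.-2 ^+ 2.
Proof.
move=> F0 Fc tn0 rn0 Fn0 hrn.
have uT : T \in unitmx by rewrite TE unitmxZ ?unitfE.
have phi0 : 0 < sqn F^T by apply: sqn_gt0; rewrite trmx_eq0.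
pose v := invmx T *m F^T.
have Tv : T *m v = F^T by rewrite mulKVmx.
have Fv : pairing F (T *m v) = sqn F^T.
  by rewrite Tv /pairing -[F in F *m _]trmxK sqn_mx mxE eqxx.
have v0 : 0 < sqn v.
  apply: sqn_gt0; apply: contra Fn0 => /eqP v0; move: Tv; rewrite v0 mulmx0 => /eqP.
  by rewrite eq_sym trmx_eq0.
have p0 : 0 < d%:R * (B / rn) ^+ 2 by rewrite mulr_gt0// exprn_gt0// divr_gt0.
have H1 : sqn (T *m v) <= (Lam * tn / r0) ^+ 2 / sqn F^T * sqn v.
  rewrite {1}Tv mulrAC ler_pdivlMr// -expr2.
  have := operator_functional cone TCb r00 X0_ball h2 v F0; rewrite Fc Fv => /(_ (ltW tn0)).
  rewrite ger0_norm ?sqn_ge0// => h.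
  apply: (@le_trans _ _ ((Lam * tn / r0 * `|v|) ^+ 2)).
    by apply: lerXn2r; rewrite ?nnegrE ?sqn_ge0// (le_trans _ h)// sqn_ge0.
  by rewrite exprMn ler_wpM2l ?sqr_ge0// norm_le_sqn.
have H2 u : pairing (F *m T) u = 0 -> (d%:R * (B / rn) ^+ 2)^-1 * sqn u <= sqn (T *m u).
  move=> Fu; rewrite mulrC ler_pdivrMr// mulrC -[in X in X <= _](mul1mx u).
  apply: sqn_hom Fu => //; first exact: ltW.
  move=> w; rewrite /pairing -mulmxA -/(pairing _ _) => Fw hw; rewrite mul1mx.
  apply: (operator_inverse cone TCb' fX0 h1); first exact: hrn.
  by apply: hrn; rewrite ?pairingN ?Fw ?oppr0 ?normrN.
have := last_gap_ge k0 TE d1 v0 (ltW _) H1 H2; rewrite invr_gt0 => /(_ p0).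
by rewrite mulrC ler_pdivrMr//; lra.
Qed.

Lemma total_gap_at (del : R) : 0 < del -> (forall u, `|u| <= del -> Cb (c + u)) ->
  sv A 0 ^+ 2 <= d%:R * (B / del) ^+ 2 * (d%:R * (B * Lam / r0) ^+ 2) * sv A d.-1 ^+ 2.
Proof.
move=> del0 hdel.
have p0 : 0 < d%:R * (B / del) ^+ 2 by rewrite mulr_gt0// exprn_gt0// divr_gt0.
have p0f u : pairing (0 : 'rV[R]_d) u = 0 by rewrite /pairing mul0mx mxE.
have H1 u : sqn (T *m u) <= d%:R * (B * Lam / r0) ^+ 2 * sqn u.
  rewrite -[in X in _ * X](mul1mx u); apply: sqn_hom (p0f u) => //.
    by rewrite mulr_ge0// ltW.
  by move=> v _; rewrite mul1mx; exact: (operator_norm cone TCb fc X0_ball h2).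
have H2 u : (d%:R * (B / del) ^+ 2)^-1 * sqn u <= sqn (T *m u).
  rewrite mulrC ler_pdivrMr// mulrC -[in X in X <= _](mul1mx u).
  apply: sqn_hom (p0f u) => //; first exact: ltW.
  move=> w _ hw; rewrite mul1mx.
  apply: (operator_inverse cone TCb' fX0 h1); first exact: hdel.
  by apply: hdel; rewrite normrN.
have := total_gap_le k0 TE (ltnW d1) (ltW _) H1 H2; rewrite invr_gt0 => /(_ p0).
by rewrite mulrC ler_pdivrMr//; lra.
Qed.

End GapAt.

Lemma sv_gt0 (R : realType) (d : nat) (A : 'M[R]_d) i : A \in unitmx -> (i < d)%N -> 0 < sv A i.
Proof.
move=> uA id; have [v [v1 vA]] := singular_vector A (Ordinal id).
rewrite lt_neqAle sv_ge0// andbT eq_sym; apply/eqP => s0.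
have : A *m v = 0.
  apply/eqP; rewrite -normr_le0 -(ler_pXn2r (n := 2)) ?nnegrE// (le_trans (norm_le_sqn _))//.
  by rewrite vA /= s0.
move=> /(congr1 (mulmx (invmx A))); rewrite mulKmx// mulmx0 => v0.
by move: v1; rewrite v0 /sqn big1 => [/esym/eqP|j _]; rewrite ?oner_eq0// mxE expr0n.
Qed.

Lemma two_points_dim (R : realType) (d : nat) (f : 'rV[R]_d) (X Y : 'cV[R]_d) :
  pairing f X = 1 -> pairing f Y = 1 -> X != Y -> (1 < d)%N.
Proof.
case: d f X Y => [|[|d]]// f X Y; first by move=> _ _; rewrite (flatmx0 X) (flatmx0 Y) eqxx.
rewrite /pairing !mxE !big_ord1 => fX fY; apply: contraNltn => _; apply/eqP/matrixP => i j.
have f0 : f 0 0 != 0 by apply: contra_eq_neq fX => ->; rewrite mul0r eq_sym oner_eq0.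
by rewrite !ord1; apply: (mulfI f0); rewrite fX fY.
Qed.

Lemma le_sum3 (R : realFieldType) (x y z : R) : 0 <= x -> 0 <= y -> 0 <= z ->
  [/\ 0 < 1 + x + y + z, x <= 1 + x + y + z, y <= 1 + x + y + z & z <= 1 + x + y + z].
Proof. by move=> x0 y0 z0; split; lra. Qed.

Lemma ler_mul_trans (R : realFieldType) (x s C g z : R) : 0 <= g -> 0 <= z -> s <= C ->
  x <= s * (g * z) -> x <= C * g * z.
Proof.
move=> g0 z0 sC hx; rewrite -mulrA (le_trans hx)//; apply: ler_wpM2r => //.
exact: mulr_ge0.
Qed.

(** * Growth of the singular value gaps *)

Section Growth.
Variables (R : realType) (d : nat) (Omega : set (projspace R d)) (f : 'rV[R]_d) (B : R).
Hypotheses (oOmega : open Omega) (fOmega : proper_chart Omega f).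
Notation Co := (cone_over f Omega).
Notation Cb := (closed_cone Omega f).
Hypothesis cone : convex_cone f B Co Cb.
Variables (x0 : projspace R d) (X0 : 'cV[R]_d) (K : R) (M : morse_gauge R) (N : nat).
Hypotheses (rX0 : represents x0 X0) (cX0 : Co X0) (fX0 : pairing f X0 = 1).
Let a : R := expR (- (2 * N%:R)).
Hypothesis N_large : 8 * a * expR (2 * (M (nn2 R) (ln16 R))%:num) < 1.
Let q : R := 1 + 2 * (a / 24).

Let a_itv : 0 < a <= 1.
Proof. by rewrite expR_gt0 /= expR_le1 oppr_le0 mulr_ge0. Qed.

Let q_gt1 : 1 < q.
Proof. by have /andP[a0 _] := a_itv; rewrite /q; lra. Qed.

Let q_exp k : q ^+ k <= expR (2 * k%:R).
Proof.
have q2 : q <= expR 2.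
  have := expR_ge1Dx (2 : R); have /andP[_ a1] := a_itv; rewrite /q; lra.
rewrite mulrC expRM_natl; apply: lerXn2r => //; rewrite ?nnegrE ?expR_ge0//.
by have := q_gt1; lra.
Qed.

Let cone_ball v : Co v -> exists2 r : R, 0 < r & forall u, `|u| <= r -> Cb (v + u).
Proof.
move=> /(co_open cone)[e e0 he]; exists (e / 2); first by rewrite divr_gt0.
by move=> u hu; apply/(coW cone)/he; lra.
Qed.

Section OneRay.
Variables (c : R -> projspace R d) (gamma : nat -> PGL R d).
Hypotheses (c_ray : projective_geodesic_ray Omega c)
  (c_morse : is_morse Omega M (c @` `[0, +oo[))
  (gamma_aut : forall n, Aut Omega (gamma n)) (c_track : tracks Omega K x0 gamma c).
Let A n := lift_mx (gamma n).
Let k n1 n := ((n - n1) %/ N.+1)%N.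

Let support Y : ~ Co Y -> Cb Y -> exists F : 'rV[R]_d,
  [/\ forall u, Co u -> 0 < pairing F u, forall u, Cb u -> 0 <= pairing F u & pairing F Y = 0].
Proof.
move=> nY cY; have [F [FCo FCb FY]] := cone_functional cone (ex_intro _ _ cX0) nY.
by exists F; split=> //; apply/le_anti; rewrite FY FCb.
Qed.

Lemma gap_growth : (1 < d)%N /\ exists (C : R) (n1 : nat), 0 < C /\ forall n, (n1 <= n)%N ->
  [/\ sv (A n) 1 <= C * q^-1 ^+ k n1 n * sv (A n) 0,
      sv (A n) d.-1 <= C * q^-1 ^+ k n1 n * sv (A n) d.-2 &
      sv (A n) 0 <= C * expR (2 * n%:R) * sv (A n) d.-1].
Proof.
have [c_geo [x [y [Ox by_ c_seg]]]] := c_ray.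
have [_ clf _ _] := fOmega.
have [X rX [cX fX]] := co_rep fOmega Ox.
have fy : affine_chart f y by apply: clf; exact: by_.1.
pose Y := chart_coord f y.
have rY : represents y Y by exact: represents_chart.
have fY : pairing f Y = 1 by exact: pairing_chart.
have fY0 : 0 < pairing f Y by rewrite fY.
have [cY nY] := (boundaryE oOmega rY fY0).1 by_.
have [F0 [F0Co F0Cb F0Y]] := support nY cY.
pose F := (pairing F0 X)^-1 *: F0.
have FX0 := F0Co _ cX.
have F_ge0 v : Cb v -> 0 <= pairing F v.
  by move=> cv; rewrite pairingZl; apply: mulr_ge0; [rewrite invr_ge0 ltW|exact: F0Cb].
have FY : pairing F Y = 0 by rewrite pairingZl F0Y mulr0.
have FX : pairing F X = 1 by rewrite pairingZl mulVf// gt_eqF.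
have XY : X != Y by apply/eqP => XY; apply: nY; rewrite -XY.
have d1 := two_points_dim fX fY XY; split=> //.
pose ray (t : R) : 'cV[R]_d := Y + t *: (X - Y).
have ell_ray p : (c @` `[0, +oo[) p -> exists t : R, 0 < t <= 1 /\ represents p (ray t).
  rewrite c_seg; exact: (segment_ray cone rX rY cX cY fY).
have c_in t : 0 <= t -> (c @` `[0, +oo[) (c t).
  by move=> t0; exists t => //; rewrite /= in_itv /= t0.
have /choice[tau htau] : forall t : R, exists s : R, 0 <= t -> 0 < s <= 1 /\ represents (c t) (ray s).
  move=> t; have [t0|t0] := pselect (0 <= t); last by exists 0.
  by have [s hs] := ell_ray _ (c_in t t0); exists s.
have tau_itv t : 0 <= t -> 0 < tau t <= 1 by move=> /htau[].
have tau_rep t : 0 <= t -> represents (c t) (ray (tau t)) by move=> /htau[].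
pose T (n : nat) := tau n%:R.
have Titv n : 0 < T n <= 1 by exact/tau_itv/ler0n.
have Trep n : represents (c n%:R) (ray (T n)) by exact/tau_rep/ler0n.
have Tlow := T_lower oOmega fOmega cone cX fX cY fY F_ge0 FY FX c_geo tau_itv tau_rep.
have Tup := T_upper oOmega fOmega cone cX fX cY fY F_ge0 FY FX c_geo tau_itv tau_rep.
have Tsmall := T_small oOmega fOmega cone cX cY c_geo tau_itv tau_rep.
have ell_c n : (c @` `[0, +oo[) (c n%:R) by exact/c_in/ler0n.
have [nw hw] := width_step oOmega fOmega cone cX fX cY fY F_ge0 FY FX c_morse ell_ray
  ell_c Trep Titv Tlow Tup Tsmall N_large.
have [nt ht] := tangent_step oOmega fOmega cone cX fX cY fY F_ge0 FY FX c_morse ell_ray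
  ell_c Trep Titv Tlow Tup Tsmall N_large.
have [nu hu] := Tup.
have [nh hh] := Tsmall 2^-1 ltac:(by rewrite invr_gt0).
pose n1 := maxn (maxn nw nt) (maxn nu nh).
have q1 := q_gt1; have q0 : 0 < q by lra.
have cray n : Co (ray (T n)) by exact: (ray_co cone cX cY (Titv n)).
have fray n : pairing f (ray (T n)) = 1 by exact: f_ray.
have Fray n : pairing F (ray (T n)) = T n by exact: F_ray.
have width n : (n1 <= n)%N -> forall u, pairing f u = 0 ->
    Cb (ray (T n) + u) -> Cb (ray (T n) - u) -> `|u| <= q^-1 ^+ k n1 n * B.
  pose P n r := forall u, pairing f u = 0 -> Cb (ray (T n) + u) -> Cb (ray (T n) - u) -> `|u| <= r.
  apply: (@iterate_step _ P).
    move=> m r hm hP u; rewrite addnS mulrC; apply: hw => //.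
    by apply: leq_trans hm; rewrite /n1 !leq_max leqnn.
  move=> m u _ c1 c2; have := symmetric_bound cone c1 c2.
  by rewrite fray mulr1.
have [rX' rX'0 hrX] := cone_ball cX.
have ball n u : `|u| <= T n * rX' -> Cb (ray (T n) + u).
  have /andP[T0 T1] := Titv n => hu'.
  rewrite /ray (_ : _ + _ + _ = (1 - T n) *: Y + T n *: (X + (T n)^-1 *: u)).
    apply: (cbD cone); apply: (cbZ cone) => //; [by rewrite subr_ge0|exact: ltW|].
    by apply: hrX; rewrite normrZ gtr0_norm ?invr_gt0// ler_pdivrMl.
  by apply/matrixP => i j; rewrite !mxE; field; rewrite gt_eqF.
have tangent n : (n1 <= n)%N -> forall u, pairing f u = 0 -> pairing F u = 0 ->
    `|u| <= q ^+ k n1 n * rX' * T n -> Cb (ray (T n) + u).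
  pose P n s := forall u, pairing f u = 0 -> pairing F u = 0 -> `|u| <= s * T n -> Cb (ray (T n) + u).
  apply: (@iterate_step _ P).
    move=> m s hm hP u; rewrite addnS; apply: ht => //.
    by apply: leq_trans hm; rewrite /n1 !leq_max leqnn orbT.
  by move=> m u _ _; rewrite mulrC; exact: ball.
have Tq n : (n1 <= n)%N -> T n * q ^+ k n1 n <= 2.
  move=> hn; have := hu n1 (n - n1)%N; rewrite subnKC// => h.
  have {}h : T n <= 2 * expR (- (2 * (n - n1)%:R)) * T n1.
    by apply: h; rewrite /n1 !leq_max leqnn !orbT.
  have /andP[T0 T1] := Titv n1; have /andP[T2 _] := Titv n.
  have qk : q ^+ k n1 n <= expR (2 * (n - n1)%:R).
    by apply: (le_trans (q_exp _)); rewrite ler_expR ler_pM2l// ler_nat leq_div.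
  have qk0 : 0 <= q ^+ k n1 n by rewrite exprn_ge0// ltW.
  apply: (@le_trans _ _ (2 * expR (- (2 * (n - n1)%:R)) * expR (2 * (n - n1)%:R))).
    apply: ler_pM => //; first exact: ltW.
    by apply: (le_trans h); rewrite ler_piMr// mulr_ge0// expR_ge0.
  by rewrite -mulrA -expRD addNr expR0 mulr1.
have [Cf Cf0 fCf] := pairing_bound f.
pose del := 1 + Cf * `|Y|.
have del0 : 0 < del by rewrite ltr_pwDl// mulr_ge0// ltW.
(* The first bound makes the vector [2 *: u'] below admissible for [tangent]; the second, with [Tq],
   gives a value of [f] at [u] of size at most 1/4. *)
pose kap := Num.min (rX' / (2 * del)) (8 * Cf)^-1.
have kap0 : 0 < kap by rewrite lt_min divr_gt0 ?mulr_gt0// invr_gt0 mulr_gt0.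
have kap1 : kap <= rX' / (2 * del) by rewrite ge_min lexx.
have kap2 : kap <= (8 * Cf)^-1 by rewrite ge_min lexx orbT.
(* [tangent] controls vectors killed by both [f] and [F], but a whole hyperplane is wanted. The
   component of [u] along [Y] is split off and absorbed by half of [ray (T n)], whose coefficient on
   [Y] exceeds 1/4. *)
have tangent' n : (n1 <= n)%N -> forall u, pairing F u = 0 ->
    `|u| <= kap * (T n * q ^+ k n1 n) -> Cb (ray (T n) + u).
  move=> hn u Fu hu'; have /andP[T0 T1] := Titv n.
  have Th : T n < 2^-1 by apply: hh; apply: leq_trans hn; rewrite /n1 !leq_max leqnn !orbT.
  have qk0 : 0 < T n * q ^+ k n1 n by rewrite mulr_gt0// exprn_gt0.
  pose u' := u - pairing f u *: Y.
  have fu' : pairing f u' = 0 by rewrite pairingB pairingZ fY mulr1 subrr.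
  have Fu' : pairing F u' = 0 by rewrite pairingB pairingZ FY mulr0 Fu subr0.
  have nu' : `|u'| <= del * `|u|.
    rewrite /u' (le_trans (ler_normB _ _))// normrZ mulrDl mul1r lerD2l.
    by rewrite mulrAC ler_wpM2r.
  have h1 : Cb (ray (T n) + 2 *: u').
    apply: tangent => //; rewrite ?pairingZ ?fu' ?Fu' ?mulr0//.
    rewrite normrZ ger0_norm//.
    have h2 : 2 * (del * `|u|) <= rX' * (T n * q ^+ k n1 n).
      apply: (@le_trans _ _ (2 * (del * (rX' / (2 * del) * (T n * q ^+ k n1 n))))).
        by rewrite !ler_pM2l// (le_trans hu')// ler_pM2r.
      by rewrite le_eqVlt; apply/orP; left; apply/eqP; field; rewrite gt_eqF.
    apply: (@le_trans _ _ (2 * (del * `|u|))); first by rewrite ler_pM2l.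
    by rewrite (_ : q ^+ _ * rX' * T n = rX' * (T n * q ^+ k n1 n)); [|ring].
  have fu4 : `|pairing f u| <= 4^-1.
    apply: (le_trans (fCf u)).
    apply: (@le_trans _ _ (Cf * ((8 * Cf)^-1 * 2))).
      rewrite ler_pM2l// (le_trans hu')//; apply: ler_pM => //; [exact: ltW|exact: ltW|exact: Tq].
    by rewrite le_eqVlt; apply/orP; left; apply/eqP; field; rewrite gt_eqF.
  move: fu4; rewrite ler_norml => /andP[f1 f2].
  rewrite (_ : _ + _ = 2^-1 *: (ray (T n) + 2 *: u') +
     ((2^-1 * (1 - T n) + pairing f u) *: Y + (2^-1 * T n) *: X)).
    apply: (cbD cone); first exact: (cbZ cone).
    apply: (cbD cone); apply: (cbZ cone) => //;
      [by lra|by rewrite mulr_ge0// ltW|exact: (coW cone)].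
  by apply/matrixP => i j; rewrite !mxE; field.
have [r0 r00 X0_ball] := cone_ball cX0.
pose Lam := expR (2 * K); have Lam0 : 0 < Lam by exact: expR_gt0.
have F_neq0 : F != 0.
  by apply: contra_eq_neq FX => ->; rewrite /pairing mul0mx mxE eq_sym oner_eq0.
have B0 := cone_bound_gt0 cone.
have sq0 : 0 < sqn F^T.
  by apply: lt_le_trans (norm_le_sqn _); rewrite exprn_gt0// normr_gt0 trmx_eq0.
(* Constants for the squared singular values, whence the square roots below. *)
pose C1 := d%:R * (Lam * B / r0) ^+ 2 * (Cf ^+ 2 * sqn X0).
pose C2 := d%:R * (B / kap) ^+ 2 * ((Lam / r0) ^+ 2 / sqn F^T).
pose C3 := d%:R * (B / (T 0%N * rX')) ^+ 2 * (d%:R * (B * Lam / r0) ^+ 2).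
have dsq (z : R) : 0 <= d%:R * z ^+ 2 by apply: mulr_ge0; [exact: ler0n|exact: sqr_ge0].
have C10 : 0 <= C1.
  by apply: mulr_ge0 => //; apply: mulr_ge0; [exact: sqr_ge0|exact: sqn_ge0].
have C20 : 0 <= C2.
  by apply: mulr_ge0 => //; apply: divr_ge0; [exact: sqr_ge0|exact: ltW].
have C30 : 0 <= C3 by apply: mulr_ge0.
exists (1 + Num.sqrt C1 + Num.sqrt C2 + Num.sqrt C3), n1.
have s1 := sqrtr_ge0 C1; have s2 := sqrtr_ge0 C2; have s3 := sqrtr_ge0 C3.
have [CC0 le1 le2 le3] := le_sum3 s1 s2 s3; split=> //.
move=> n hn; have /andP[T0 T1] := Titv n.
have [kk [TT [kk0 TE TCb TCb' [h1 h2]]]] :=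
  track_linear oOmega fOmega cone (gamma_aut n) rX0 cX0 (Trep n) (cray n) (c_track n).
have uA : A n \in unitmx by exact: lift_mx_unit.
have d0 : (0 < d)%N by exact: ltnW.
have dd : (d.-1 < d)%N by rewrite ltn_predL.
have dd2 : (d.-2 < d)%N by rewrite (leq_ltn_trans (leq_pred _)).
have g0 : 0 < q^-1 ^+ k n1 n by rewrite exprn_gt0// invr_gt0.
have qk0 : 0 < q ^+ k n1 n by rewrite exprn_gt0.
have rho0 : 0 <= q^-1 ^+ k n1 n * B by rewrite mulr_ge0 ?ltW.
have E1 := first_gap_at cone TCb fX0 (fray n) Lam0 r00 X0_ball h1 h2 Cf0 fCf kk0 TE d1 rho0 (width n hn).
have rn0 : 0 < kap * (T n * q ^+ k n1 n) by rewrite !mulr_gt0.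
have E2 := last_gap_at cone TCb TCb' fX0 r00 X0_ball h1 h2 kk0 TE uA d1
  F_ge0 (Fray n) T0 rn0 F_neq0 (tangent' n hn).
have E3 := total_gap_at cone TCb TCb' fX0 (fray n) Lam0 r00 X0_ball h1 h2 kk0 TE d1
  (mulr_gt0 T0 rX'0) (ball n).
have S0 := ltW (sv_gt0 uA d0); have S1 := ltW (sv_gt0 uA d1).
have Sd := ltW (sv_gt0 uA dd); have Sd2 := ltW (sv_gt0 uA dd2).
split.
- apply: (ler_mul_trans (ltW g0) S0 le1).
    apply: le_sqrt_mul => //; first by rewrite mulr_ge0// ltW.
    apply: (le_trans E1); rewrite le_eqVlt; apply/orP; left; apply/eqP.
    by rewrite /C1; field; rewrite gt_eqF.
- apply: (ler_mul_trans (ltW g0) Sd2 le2).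
    apply: le_sqrt_mul => //; first by rewrite mulr_ge0// ltW.
    apply: (le_trans E2); rewrite le_eqVlt; apply/orP; left; apply/eqP.
    rewrite /C2 exprVn; move: (q ^+ k n1 n) qk0 => Q Q0.
    rewrite -/Lam -/(A n).
    by field; rewrite !gt_eqF.
- apply: (ler_mul_trans (expR_ge0 _) Sd le3).
    apply: le_sqrt_mul => //; first by rewrite mulr_ge0// expR_ge0.
    apply: (le_trans E3).
    rewrite [in leRHS]exprMn [leRHS]mulrA ler_wpM2r ?sqr_ge0//.
    have /andP[T00 _] := Titv 0%N.
    have TT0 : T 0%N <= expR (2 * n%:R) * T n.
      have := Tlow 0%N n; rewrite add0n expRN mulrC ler_pdivrMr ?expR_gt0//.
      by rewrite mulrC.
    have : (B / (T n * rX')) ^+ 2 <= (B / (T 0%N * rX')) ^+ 2 * expR (2 * n%:R) ^+ 2.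
      have p0 : 0 < B / (T n * rX') by rewrite divr_gt0// mulr_gt0.
      have p1 : B / (T n * rX') <= B / (T 0%N * rX') * expR (2 * n%:R).
        rewrite ler_pdivrMr ?mulr_gt0//.
        rewrite (_ : _ * (T n * rX') = B * (expR (2 * n%:R) * T n / T 0%N)).
          by rewrite ler_peMr ?(ltW B0)// ler_pdivlMr// mul1r.
        by move: (expR _) => e; field; rewrite !gt_eqF.
      rewrite -exprMn; apply: lerXn2r => //; rewrite nnegrE; first exact: ltW.
      exact: (le_trans (ltW p0)).
    move=> h; have D0 : 0 <= d%:R * (d%:R * (B * Lam / r0) ^+ 2) by apply: mulr_ge0.
    by have := ler_wpM2l D0 h; congr (is_true (_ <= _)); rewrite /C3; ring.
Qed.

End OneRay.

End Growth.

(** * Logarithms and limits *)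

Lemma limn_esup_le (R : realType) (u : nat -> \bar R) (l : \bar R) n0 :
  (forall n, (n0 <= n)%N -> (u n <= l)%E) -> (limn_esup u <= l)%E.
Proof.
move=> h; apply: (@le_trans _ _ (ereal_sup (u @` [set n | (n0 <= n)%N]))).
  by apply: ereal_inf_lbound; exists [set n | (n0 <= n)%N] => //; exists n0.
by apply: ge_ereal_sup => _ [n /= hn <-]; exact: h.
Qed.

Lemma limn_einf_ge (R : realType) (u : nat -> \bar R) (l : \bar R) n0 :
  (forall n, (n0 <= n)%N -> (l <= u n)%E) -> (l <= limn_einf u)%E.
Proof.
by move=> h; rewrite leeNr; apply: limn_esup_le (n0) _ => n hn; rewrite leeN2 h.
Qed.

(** [g] has slope at least [e = ln q / N.+1] and [t] slope at most 2. As [z * e = 2 + e], the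
    difference [z * g - t] gains [e] per step and eventually absorbs all additive constants; so [z]
    is independent of [C] and [n1]. *)
Lemma linear_growth (R : realType) (q C : R) N n1 : 1 < q -> 0 < C ->
  exists n2, (n1 <= n2)%N /\ forall n, (n2 <= n)%N -> forall g t : R,
    ((n - n1) %/ N.+1)%:R * ln q - ln C <= g -> t <= 2 * n%:R + ln C ->
    0 < g /\ t <= (2 * N.+1%:R / ln q + 1) * g.
Proof.
move=> q1 C0; have L0 : 0 < ln q by rewrite ln_gt0.
move: (ln C) (ln q) L0 => c L L0.
have N0 : N.+1%:R != 0 :> R by rewrite pnatr_eq0.
pose e := L / N.+1%:R; have e0 : 0 < e by rewrite divr_gt0.
pose z := 2 * N.+1%:R / L + 1.
have z1 : 1 < z by rewrite /z ltrDr divr_gt0// mulr_gt0.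
have ze : z * e = 2 + e 
  by rewrite /z /e; move: (N.+1%:R) N0 => w w0; field; rewrite w0 gt_eqF.
pose D := e * n1%:R + L + c; pose E := z * `|D| + `|c|.
exists (maxn n1 (Num.truncn (E / e)).+1); split; first exact: leq_maxl.
move=> n; rewrite geq_max => /andP[hn1 hn2] g t hg ht; rewrite -/z.
have en : E < e * n%:R.
  rewrite mulrC -ltr_pdivrMr//; apply: lt_le_trans (truncnS_gt _) _.
  by rewrite ler_nat.
have gn : e * n%:R - D <= g.
  apply: le_trans hg; rewrite /D.
  have : ((n - n1)%N)%:R <= ((n - n1) %/ N.+1).+1%:R * N.+1%:R :> R.
    by rewrite -natrM ler_nat ltnW// ltn_ceil.
  rewrite natrB// -natr1; move: (_ %/ _)%:R => k hk.
  have {}hk : e * (n%:R - n1%:R) <= (k + 1) * L.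
    rewrite (_ : (k + 1) * L = e * ((k + 1) * N.+1%:R)); first by rewrite ler_pM2l.
    by rewrite /e; move: (N.+1%:R) N0 => w w0; field.
  by lra.
have D1 := ler_norm D; have D0 := normr_ge0 D; have c1 := ler_norm c; have c0 := normr_ge0 c.
have zD : `|D| <= z * `|D| by rewrite ler_peMl// ltW.
have zD' : z * D <= z * `|D| by rewrite ler_pM2l//; lra.
split; first by rewrite /E in en; lra.
have hz : z * (e * n%:R - D) <= z * g by rewrite ler_pM2l//; lra.
have : z * (e * n%:R - D) = 2 * n%:R + e * n%:R - z * D by rewrite mulrBr mulrA ze; ring.
by rewrite /E in en; lra.
Qed.

Lemma log_gap (R : realType) (q C x y : R) (k : nat) : 0 < q -> 0 < C -> 0 < x -> 0 < y ->
  x <= C * q^-1 ^+ k * y -> k%:R * ln q - ln C <= ln y - ln x.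
Proof.
move=> q0 C0 x0 y0 h; have g0 : 0 < q^-1 ^+ k by rewrite exprn_gt0// invr_gt0.
have : ln x <= ln (C * q^-1 ^+ k * y) by rewrite ler_ln ?posrE ?mulr_gt0.
rewrite [ln (C * _ * y)]lnM ?posrE ?mulr_gt0// [ln (C * _)]lnM ?posrE//.
by rewrite lnXn ?invr_gt0// lnV ?posrE// mulNrn -mulr_natl; lra.
Qed.

Lemma log_total (R : realType) (C x y : R) (n : nat) : 0 < C -> 0 < x -> 0 < y ->
  x <= C * expR (2 * n%:R) * y -> ln x - ln y <= 2 * n%:R + ln C.
Proof.
move=> C0 x0 y0 h; have g0 := expR_gt0 (2 * n%:R : R).
have : ln x <= ln (C * expR (2 * n%:R) * y) by rewrite ler_ln ?posrE ?mulr_gt0.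
rewrite [ln (C * _ * y)]lnM ?posrE ?mulr_gt0// [ln (C * _)]lnM ?posrE// expRK.
by lra.
Qed.

Theorem corollary1p7 (R : realType) (d : nat) (Omega : set (projspace R d))
    (x0 : projspace R d) (K : R) (M : morse_gauge R)
    (hOmega : properly_convex Omega) (hx0 : Omega x0) (hK : 0 < K) :
  exists xi : R, 1 < xi /\
    forall (c : R -> projspace R d) (gamma : nat -> PGL R d),
      projective_geodesic_ray Omega c ->
      is_morse Omega M (c @` `[0, +oo[) ->
      (forall n, Aut Omega (gamma n)) ->
      tracks Omega K x0 gamma c ->
      ((1 + (xi - 1)^-1)%:E <
         limn_einf (fun n => (mu 1 d (gamma n))%:E / (mu 1 d.-1 (gamma n))%:E))%E /\
      (limn_esup (fun n => (mu 1 d (gamma n))%:E / (mu 1 2 (gamma n))%:E) < xi%:E)%E.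
Proof.
have [ne oOmega [f fOmega convOmega]] := hOmega.
have [B cone] := cone_over_convex_cone oOmega fOmega convOmega ne.
have [X0 rX0 [cX0 fX0]] := co_rep fOmega hx0.
pose m := (M (nn2 R) (ln16 R))%:num.
have [N N_large] : exists N : nat, 8 * expR (- (2 * N%:R)) * expR (2 * m) < 1.
  pose E : R := 8 * expR (2 * m).
  exists (Num.truncn E).+1; rewrite mulrAC -/E expRN ltr_pdivrMr ?expR_gt0// mul1r.
  apply: lt_le_trans (truncnS_gt _) _; apply: le_trans (expR_ge1Dx _).
  by move: ((Num.truncn E).+1%:R) (ler0n R (Num.truncn E).+1) => w w0; lra.
have [q q1 growth] : exists2 q : R, 1 < q & forall c gamma,
    projective_geodesic_ray Omega c -> is_morse Omega M (c @` `[0, +oo[) ->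
    (forall n, Aut Omega (gamma n)) -> tracks Omega K x0 gamma c ->
    (1 < d)%N /\ exists C n1, 0 < C /\ forall n, (n1 <= n)%N ->
    [/\ sv (lift_mx (gamma n)) 1
          <= C * q^-1 ^+ ((n - n1) %/ N.+1) * sv (lift_mx (gamma n)) 0,
        sv (lift_mx (gamma n)) d.-1
          <= C * q^-1 ^+ ((n - n1) %/ N.+1) * sv (lift_mx (gamma n)) d.-2 &
        sv (lift_mx (gamma n)) 0 <= C * expR (2 * n%:R) * sv (lift_mx (gamma n)) d.-1].
  exists (1 + 2 * (expR (- (2 * N%:R)) / 24)).
    by have := expR_gt0 (- (2 * N%:R) : R); lra.
  move=> c gamma cray cM gA gT.
  exact: (gap_growth oOmega fOmega cone rX0 cX0 fX0 N_large cray cM gA gT).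
pose z := 2 * N.+1%:R / ln q + 1.
have z1 : 1 < z by rewrite /z ltrDr divr_gt0 ?ln_gt0// mulr_gt0.
(* The ratios are eventually bounded by [z] in the wide sense; the added 1 makes both limit
   inequalities strict. *)
exists (z + 1); split; first by lra.
move=> c gamma cray cM gA gT.
have [d1 [C [n1 [C0 hC]]]] := growth c gamma cray cM gA gT.
have [n2 [n12 hn2]] := @linear_growth R q C N n1 q1 C0.
have q0 : 0 < q by lra.
have dd : (d.-1 < d)%N by rewrite ltn_predL ltnW.
have dd2 : (d.-2 < d)%N by rewrite (leq_ltn_trans (leq_pred _)).
have ratio n : (n2 <= n)%N -> [/\ 0 < mu 1 2 (gamma n),
    mu 1 d (gamma n) <= z * mu 1 2 (gamma n),
    0 < mu 1 d (gamma n) - mu 1 d.-1 (gamma n),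
    mu 1 d (gamma n) <= z * (mu 1 d (gamma n) - mu 1 d.-1 (gamma n)) &
    0 <= mu 1 d.-1 (gamma n)].
  move=> hn; have hn1 := leq_trans n12 hn; have [h1 h2 h3] := hC n hn1.
  have uA := lift_mx_unit (gamma n); rewrite /mu /sigma /=.
  have S0 := sv_gt0 uA (ltnW d1); have S1 := sv_gt0 uA d1.
  have Sd := sv_gt0 uA dd; have Sd2 := sv_gt0 uA dd2.
  have le02 : sv (lift_mx (gamma n)) d.-2 <= sv (lift_mx (gamma n)) 0 by rewrite sv_le.
  move: h1 h2 h3 S0 S1 Sd Sd2 le02.
  move: (sv _ 0) (sv _ 1) (sv _ d.-1) (sv _ d.-2) => s0 s1 sd sd2 h1 h2 h3 S0 S1 Sd Sd2 le02.
  rewrite !lnM ?posrE ?invr_gt0// !lnV ?posrE//.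
  have [p1 p2] := hn2 n hn _ _ (log_gap q0 C0 S1 S0 h1) (log_total C0 S0 Sd h3).
  have [p3 p4] := hn2 n hn _ _ (log_gap q0 C0 Sd Sd2 h2) (log_total C0 S0 Sd h3).
  have E : ln s0 - ln sd - (ln s0 - ln sd2) = ln sd2 - ln sd by ring.
  by rewrite E; split=> //; rewrite subr_ge0 ler_ln.
split.
- apply: (@lt_le_trans _ _ (1 + (z - 1)^-1)%:E).
    by rewrite lte_fin ltrD2l ltf_pV2 ?posrE; lra.
  apply: (limn_einf_ge (n0 := n2)) => n hn; have [_ _ b0 hb m0] := ratio n hn.
  move: (mu 1 d _) (mu 1 d.-1 _) b0 hb m0 => t s b0 hb s0.
  (* The denominator vanishes for example when [d = 2]; the quotient is then [+oo]. *)
  have [->|s_neq0] := eqVneq s 0.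
    by rewrite inve0 gt0_muley ?lte_fin ?leey//; lra.
  have {s_neq0}s0 : 0 < s by rewrite lt_neqAle eq_sym s_neq0.
  rewrite inver gt_eqF// -EFinM lee_fin ler_pdivlMr//.
  (* [t <= z * (t - s)] amounts to [z * s <= (z - 1) * t], and [z / (z - 1)] is [1 + (z - 1)^-1]. *)
  have zs : (1 + (z - 1)^-1) * s * (z - 1) = z * s by field; rewrite subr_eq0 gt_eqF.
  by rewrite -(@ler_pM2r _ (z - 1)) ?subr_gt0// zs; lra.
- apply: (@le_lt_trans _ _ z%:E); last by rewrite lte_fin; lra.
  apply: (limn_esup_le (n0 := n2)) => n hn; have [a0 ha _ _ _] := ratio n hn.
  by rewrite inver gt_eqF// -EFinM lee_fin ler_pdivrMr.
Qed.
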